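(* Let $K\in\mathbb N\cup\{\infty\}$, let $f$ be the flux function of totally asymmetric $K$-exclusion, let $\rho_0$ be a bounded measurable function on $\mathbb R$ with $0\le\rho_0(x)\le K$, and let $u(x,t)$ and $\rho(x,t)=\frac{\partial}{\partial x}u(x,t)$ be the functions defined from $\rho_0$ by the Hopf-Lax formula (see context). Then $\rho(x,t)$ is characterized among the weak solutions of $$\rho_t+f(\rho)_x=0,\qquad \rho(x,0)=\rho_0(x)$$ by maximal current over time, in the following sense. Suppose $\lambda(x,t)$ is a nonnegative, locally bounded measurable function on $\mathbb R\times(0,\infty)$, with values in the domain $[0,K]$ of $f$, such that $$\int_0^\infty\int_{\mathbb R}\bigl[\lambda(x,t)\phi_t(x,t)+f(\lambda(x,t))\phi_x(x,t)\bigr]\,dx\,dt+\int_{\mathbb R}\rho_0(x)\phi(x,0)\,dx=0$$ for all compactly supported and continuously differentiable test functions $\phi$ on $\mathbb R\times[0,\infty)$. Fix $t>0$. Then for almost all $x\in\mathbb R$, $$\int_0^t f(\lambda(x,s))\,ds\le\int_0^t f(\rho(x,s))\,ds.$$ Conversely, if equality holds in this inequality for almost all $(x,t)$, then $\lambda(x,t)=\rho(x,t)$ for almost all $(x,t)$.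
   Context: Convention: if $K=\infty$, $[0,K]$ means $[0,\infty)$. Flux $f$ and its dual $g$. Let $\{D_i:i\in\mathbb Z\}$ be independent rate 1 Poisson point processes on $(0,\infty)$. Define $\xi(t)=(\xi(i,t):i\in\mathbb Z)$ by $\xi(i,0)=0$ for $i\ge0$, $\xi(i,0)=-Ki$ for $i<0$ ($=+\infty$ if $K=\infty$), and at each epoch $t$ of $D_i$, $\xi(i,t)=\min\{\xi(i,t-)+1,\ \xi(i-1,t-),\ \xi(i+1,t-)+K\}$ (last term omitted if $K=\infty$), with no other changes. It is known that there is a deterministic nonincreasing, nonnegative convex function $g$ on $\mathbb R$ ($[0,\infty]$-valued if $K=\infty$) with $\lim_{n\to\infty}\frac1n\xi([nx],nt)=t\,g(x/t)$ a.s. for all $x\in\mathbb R$, $t>0$. The flux of totally asymmetric $K$-exclusion is $f(\rho)=\inf_{x\in\mathbb R}\{g(x)+\rho x\}$, $\rho\in[0,K]$. Known facts: $f$ is continuous, concave and nonnegative, and $g(x)=\sup_{0\le\rho\le K}\{f(\rho)-x\rho\}$. If $K<\infty$: $f(\rho)=f(K-\rho)$, $g(x)=0$ for $x\ge1$ and $g(x)=-Kx$ for $x\le-1$. If $K=1$: $f(\rho)=\rho(1-\rho)$. If $K=\infty$: $f(\rho)=\rho/(1+\rho)$, $g(x)=(1-\sqrt x)^2$ for $0\le x\le1$, $g(x)=0$ for $x>1$, $g(x)=\infty$ for $x<0$. The solution $\rho(x,t)$. Define $u_0$ by $u_0(0)=0$ and $u_0(b)-u_0(a)=\int_a^b\rho_0(x)\,dx$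 for all $a<b$. Set $u(x,0)=u_0(x)$ and, for $t>0$, $u(x,t)=\sup_{y\in\mathbb R}\{u_0(y)-t\,g((x-y)/t)\}$ (Hopf-Lax formula). The function $u$ is Lipschitz on $\mathbb R\times[0,\infty)$, and $\rho(x,t)=\frac{\partial}{\partial x}u(x,t)$ is its almost everywhere defined $x$-derivative. *)

(* Defs.v *)
From HB Require Import structures.
From mathcomp Require Import all_boot all_order all_algebra finmap.
From mathcomp Require Import all_classical all_reals all_analysis.
Import Order.TTheory GRing.Theory Num.Theory.
Import numFieldNormedType.Exports.

Set Implicit Arguments.
Unset Strict Implicit.
Unset Printing Implicit Defensive.

Local Open Scope classical_set_scope.
Local Open Scope ring_scope.

(* Poisson point processes *)

(* [fset_set] is empty on infinite sets; [count_points] is only meaningful for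
   the locally finite sets of [poisson_process]. *)
Definition count_points (R : realType) (A B : set R) : nat :=
  #|` fset_set (A `&` B)|%fset.

(* The restriction to [a < b] matters: [poisson_pmf] is not a mass function at
   rate 0. *)
Record poisson_process (R : realType) (d : measure_display)
    (T : measurableType d) (P : probability T R) (r : R)
    (D : T -> set R) : Prop := {
  poisson_pos : forall w, D w `<=` `]0, +oo[ ;
  poisson_locally_finite : forall w b, finite_set (D w `&` `]0, b]) ;
  poisson_measurable : forall a b k,
    measurable [set w | count_points (D w) `]a, b] = k] ;
  poisson_law : forall (a b : R) k, 0 <= a -> a < b ->
    P [set w | count_points (D w) `]a, b] = k] =
    (poisson_pmf (r * (b - a)) k)%:E ;
  poisson_independent_increments : forall (n : nat) (t : nat -> R)
      (k : nat -> nat),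
    0 <= t 0%N -> {homo t : i j / (i <= j)%N >-> i <= j} ->
    P (\bigcap_(j in `I_n)
         [set w | count_points (D w) `]t j, t j.+1] = k j]) =
    (\prod_(j < n)
       P [set w | count_points (D w) `]t j, t j.+1] = k j])%E }.

(* the sigma-algebra generated by a point process on the half-line *)
Definition sigma_points (R : realType) (T : Type) (D : T -> set R) :
    set (set T) :=
  <<s [set E | exists a b k, E = [set w | count_points (D w) `]a, b] = k]] >>.

Definition independent_processes (R : realType) (d : measure_display)
    (T : measurableType d) (P : probability T R) (I : choiceType)
    (D : I -> T -> set R) : Prop :=
  forall (J : {fset I}) (E : I -> set T),
    (forall i, i \in J -> sigma_points (D i) (E i)) ->
    P (\bigcap_(i in [set` J]) E i) = (\prod_(i <- J) P (E i))%E.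

(* Totally asymmetric K-exclusion; [K = None] stands for infinite capacity. *)

Definition capacity (R : realType) (K : option nat) : \bar R :=
  if K is Some k then (k%:R)%:E else +oo%E.

Definition initial_height (R : realType) (K : option nat) (i : int) : \bar R :=
  if (0 <= i)%R then 0%E else (capacity R K * ((- i)%:~R)%:E)%E.

Definition height_update (R : realType) (K : option nat) (h : int -> \bar R)
    (i : int) : \bar R :=
  let m := Order.min (h i + 1)%E (h (i - 1)%R) in
  if K is Some k then Order.min m (h (i + 1)%R + (k%:R)%:E)%E else m.

(* [xi i t] is the height of site [i] at time [t], driven by one realization of
   the epochs [D i]. Since heights are locally constant to the left of [t],
   "for all [s < t] close to [t]" evaluates the update at the left limits. *)
Record K_exclusion_height (R : realType) (K : option nat) (D : int -> set R)
    (xi : int -> R -> \bar R) : Prop := {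
  height_init : forall i, xi i 0 = initial_height R K i ;
  height_jump : forall i t, D i t ->
    \forall s \near t^'-, xi i t = height_update K (fun j => xi j s) i ;
  height_const : forall i (s t : R), 0 <= s -> s <= t ->
    D i `&` `]s, t] = set0 -> xi i t = xi i s }.

Definition convex_ereal (R : realType) (g : R -> \bar R) : Prop :=
  forall (x y s : R), 0 < s -> s < 1 ->
    (g (s * x + (1 - s) * y)%R <= s%:E * g x + (1 - s)%:E * g y)%E.

(* the deterministic function [g] given by the law of large numbers for the
   heights *)
Record limit_shape (R : realType) (d : measure_display)
    (T : measurableType d) (P : probability T R) (K : option nat)
    (xi : T -> int -> R -> \bar R) (g : R -> \bar R) : Prop := {
  shape_ge0 : forall x, (0 <= g x)%E ;
  shape_fin : K <> None -> forall x, (g x < +oo)%E ;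
  shape_noninc : forall x y : R, x <= y -> (g y <= g x)%E ;
  shape_convex : convex_ereal g ;
  shape_limit : forall x t : R, 0 < t -> {ae P, forall w,
    ((n%:R^-1 : R)%:E * xi w (Num.floor (n%:R * x)%R) (n%:R * t)%R)%E @[n --> \oo]
      --> (t%:E * g (x / t)%R)%E } }.

Definition flux (R : realType) (g : R -> \bar R) (rho : R) : R :=
  fine (ereal_inf [set (g x + (rho * x)%:E)%E | x in [set: R]]).

(* Hopf-Lax formula *)

Definition hopf_lax (R : realType) (g : R -> \bar R) (u0 : R -> R)
    (x t : R) : R :=
  if 0 < t then
    fine (ereal_sup
      [set ((u0 y)%:E - t%:E * g ((x - y) / t)%R)%E | y in [set: R]])
  else u0 x.

(* At the Lebesgue-null set of points where the derivative does not exist,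
   [derive1] takes an arbitrary value. *)
Definition hopf_lax_density (R : realType) (g : R -> \bar R) (u0 : R -> R)
    (x t : R) : R :=
  derive1 (fun y => hopf_lax g u0 y t) x.

(* Weak solutions *)

(* Compactly supported C^1 functions on the closed half-plane {t >= 0} are
   represented by compactly supported C^1 functions on the plane: by reflection
   at t = 0 and a cut-off, every one of the former is a restriction of one of
   the latter. *)
Definition test_function (R : realType) (phi : R -> R -> R) : Prop :=
  [/\ forall x t, derivable (phi ^~ t) x 1 /\ derivable (phi x) t 1,
      continuous (fun z : R * R => derive1 (phi ^~ z.2) z.1),
      continuous (fun z : R * R => derive1 (phi z.1) z.2) &
      compact (closure [set z : R * R | phi z.1 z.2 != 0])].

(* The weak identity is an equation in the extended reals, where the integral of
   a function with infinite positive and negative parts is -oo; it therefore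
   contains the integrability of its space-time integrand near t = 0. *)
Record weak_solution (R : realType) (K : option nat) (f : R -> R)
    (rho0 : R -> R) (lambda : R -> R -> R) : Prop := {
  weak_measurable : measurable_fun [set z : R * R | 0 < z.2]
    (fun z : R * R => lambda z.1 z.2) ;
  weak_range : forall x t : R, 0 < t ->
    0 <= lambda x t /\ ((lambda x t)%:E <= capacity R K)%E ;
  weak_locally_bounded : forall x t : R, 0 < t ->
    bounded_near (fun z : R * R => lambda z.1 z.2) (nbhs (x, t)) ;
  weak_identity : forall phi, test_function phi ->
    ((\int[lebesgue_measure]_(t in `]0%R, +oo[) \int[lebesgue_measure]_x
       (lambda x t * derive1 (phi x) t + f (lambda x t) * derive1 (phi ^~ t) x)%:E)
     + \int[lebesgue_measure]_x (rho0 x * phi x 0)%:E = 0)%E }.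

(* Main.v *)
(* Only two consequences of the particle system are needed: g(0) is finite,
   because site 0 jumps at most as often as its Poisson clock rings and the count
   on (0, n] is below 2n infinitely often with positive probability; and
   g(q) >= - r q for q <= 0 and densities r, because heights never drop below
   their initial values.  The latter holds up to time T since almost surely there
   are, arbitrarily far on both sides, sites without epochs in (0, T], which cut
   the line into finite blocks.

   The Hopf-Lax height u(., t) is nondecreasing and Lipschitz, and by the
   semigroup property its right time derivative is - f(rho) wherever it is
   differentiable in x.  Summing double difference quotients by parts gives the
   weak equation for rho, and integrating in time gives
   u_0(x) - u(x, t) = int_0^t f(rho(x, s)) ds for almost every x.

   For a weak solution lambda, the test function H(x + q tau(s)) - H(x), with H'
   a bump and tau(s) a smoothing of the positive part of t - s, and the inequality
   f(lambda) - q lambda <= g(q) yield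
   int_0^t f(lambda(x, s)) ds <= t g(q) + u_0(x) - u_0(x - q t) for almost every x.
   The infimum over q of the right-hand side is u_0(x) - u(x, t).

   If the time integrals agree almost everywhere, then f(lambda) = f(rho) almost
   everywhere, and subtracting the two weak identities for products
   psi(x) tau(s) shows that lambda - rho integrates to 0 over every rectangle. *)

Require Import Defs.
From HB Require Import structures.
From mathcomp Require Import all_boot all_order all_algebra finmap.
From mathcomp Require Import all_classical all_reals all_analysis.
From mathcomp Require Import measurable_realfun ring lra zify.
Import Order.TTheory GRing.Theory Num.Theory.
Import numFieldNormedType.Exports.

Set Implicit Arguments.
Unset Strict Implicit.
Unset Printing Implicit Defensive.

Local Open Scope classical_set_scope.
Local Open Scope ring_scope.

(** * Monotone Lipschitz functions *)

(** Three obstacles shape the argument. First, a weak solution is bounded only locally in the open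
    half-plane: for infinite capacity [lambda] may blow up as t tends to 0, and Fubini may fail for
    a general test function. Every test function applied to [lambda] is therefore constant in time
    on an interval ]0, e]; this costs an error of order e, removed at the end. Second, [g] may be
    infinite to the left of 0, so a velocity cannot be approximated from both sides. Infima over
    velocities are reached through rationals just to the right, where the monotonicity of [g]
    controls its value; the same rationals keep the exceptional null sets countable in number.
    Third, [u] is only Lipschitz, and only its right time derivative is identified. Since [hopf_lax]
    equals [u0] for all t <= 0, [u] lives on the whole plane, where translation invariance replaces
    integration by parts and leaves no boundary; the initial term of the weak equation is the
    contribution of the lower half-plane. *)

Lemma aeS d (T : measurableType d) (R : realType) (mu : {measure set T -> \bar R})
    (P Q : T -> Prop) :
  (forall x, P x -> Q x) -> {ae mu, forall x, P x} -> {ae mu, forall x, Q x}.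
Proof. by move=> PQ; exact: filterS. Qed.

Lemma aeS2 d (T : measurableType d) (R : realType) (mu : {measure set T -> \bar R})
    (P Q S : T -> Prop) : (forall x, P x -> Q x -> S x) ->
  {ae mu, forall x, P x} -> {ae mu, forall x, Q x} -> {ae mu, forall x, S x}.
Proof. by move=> PQS; exact: filterS2. Qed.

Definition mono_lip (R : realType) (L : R) (F : R -> R) :=
  forall x y, x <= y -> 0 <= F y - F x <= L * (y - x).

Lemma mono_lip_ndecr (R : realType) (L : R) (F : R -> R) :
  mono_lip L F -> {homo F : x y / x <= y}.
Proof. by move=> LF x y /LF /andP[+ _]; rewrite subr_ge0. Qed.

Lemma mono_lip_lip (R : realType) (L : R) (F : R -> R) x y :
  mono_lip L F -> `|F x - F y| <= L * `|x - y|.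
Proof.
move=> LF; have [xy|/ltW yx] := leP x y.
  have /andP[h1 h2] := LF _ _ xy.
  by rewrite distrC ger0_norm// distrC ger0_norm// subr_ge0.
have /andP[h1 h2] := LF _ _ yx.
by rewrite ger0_norm// ger0_norm// subr_ge0.
Qed.

Lemma lip_continuous (R : realType) (L : R) (F : R -> R) :
  (forall x y, `|F x - F y| <= L * `|x - y|) -> continuous F.
Proof.
move=> LF x; apply/cvgrPdist_lt => e e0.
have L1 : 0 < `|L| + 1 by rewrite ltr_wpDl.
near=> y.
have yx : `|x - y| < e / (`|L| + 1).
  near: y; apply/nbhs_ballP; exists (e / (`|L| + 1)) => //=; exact: divr_gt0.
apply: le_lt_trans (LF _ _) _.
rewrite ltr_pdivlMr// in yx; apply: le_lt_trans yx.
rewrite [leRHS]mulrC ler_wpM2r//.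
by rewrite (le_trans (ler_norm _))// lerDl.
Unshelve. all: by end_near. Qed.

Lemma mono_lip_continuous (R : realType) (L : R) (F : R -> R) :
  mono_lip L F -> continuous F.
Proof.
move=> LF; apply: (@lip_continuous _ L) => x y; exact: mono_lip_lip LF.
Qed.

Section mono_lip_derivable.
Context {R : realType}.
Local Notation mu := (@lebesgue_measure R).

(** A Lebesgue-null set is covered by half-open intervals of total length below [e / (|L| + 1)], and
    [F] stretches each of them by a factor of at most [|L| + 1]; the added 1 keeps the denominator
    positive. *)
Lemma lebesgue_stieltjes_mono_lip_dominates (L : R) (F : cumulative R R) :
  mono_lip L F -> lebesgue_stieltjes_measure F `<< mu.
Proof.
move=> LF; apply/null_content_dominatesP => A mA A0.
apply/eqP; rewrite -measure_le0; apply/lee_addgt0Pr => e e0; rewrite add0e.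
have L1 : 0 < `|L| + 1 by rewrite ltr_wpDl.
have : (mu A < (e / (`|L| + 1))%:E)%E by rewrite A0 lte_fin divr_gt0.
move=> /ereal_inf_lt[_ [B [mB AB] <-] Be].
apply: (@le_trans _ _ (\sum_(k <oo) (wlength F (B k)))%E).
  by apply: ereal_inf_lbound; exists B.
apply: (@le_trans _ _ (\sum_(k <oo) ((`|L| + 1)%:E * wlength idfun (B k)))%E).
  apply: lee_nneseries => [k _ _|k _]; first exact: wlength_ge0.
  have /ocitvP[->|[[a b]/= ab ->]] := mB k.
    by rewrite !wlength0 mule0.
  rewrite !wlength_itv_bnd ?(ltW ab)//= -EFinM lee_fin.
  have /andP[_ h] := LF _ _ (ltW ab); apply: (le_trans h).
  rewrite ler_wpM2r ?subr_ge0 ?(ltW ab)//.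
  by rewrite (le_trans (ler_norm _))// lerDl.
rewrite nneseriesZl//.
apply: (@le_trans _ _ ((`|L| + 1)%:E * (e / (`|L| + 1))%:E)%E).
  by rewrite lee_wpmul2l// ?lee_fin ?ltW.
by rewrite -EFinM lee_fin mulrC divfK// gt_eqF.
Qed.

Lemma mono_lip_density (L : R) (F : R -> R) (k : R) : mono_lip L F -> 0 < k ->
  exists h : R -> R, [/\ mu.-integrable [set: R] (EFin \o h),
    (forall a b : R, - k <= a -> a <= b -> b <= k ->
      (\int[mu]_(t in `]a, b]) (h t)%:E = (F b - F a)%:E)%E) &
    forall x, - k < x <= k ->
      F x = F (- k) + \int[mu]_(t in `]-oo, x]) h t].
Proof.
move=> LF k0.
have Fnd : nondecreasing F := mono_lip_ndecr LF.
have Frc := right_continuousW (mono_lip_continuous LF).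
pose G : cumulative R R := HB.pack_for (cumulative R R) F
  (isCumulative.Build R _ R F Fnd Frc).
have LG : mono_lip L G by [].
(* The Stieltjes measure of the whole line may be infinite; its restriction to [D] is a finite
   measure, to which the Radon-Nikodym theorem applies. *)
pose D := `]- k, k]%classic.
have mD : measurable (D : set (measurableTypeR R)) by exact: measurable_itv.
have GE a b : a <= b ->
    lebesgue_stieltjes_measure G `]a, b]%classic = (F b - F a)%:E.
  move=> ab; rewrite /lebesgue_stieltjes_measure/= /measure_extension/=.
  rewrite (@measurable_mu_extE _ _ _ (wlength G))//=; last by exists (a, b).
  by rewrite wlength_itv_bnd.
have Dfin : (lebesgue_stieltjes_measure G D < +oo)%E.
  by rewrite GE ?ltry//; lra.
pose nu : {finite_measure set (measurableTypeR R) -> \bar R} := mfrestr mD Dfin.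
have numu : nu `<< mu.
  apply/null_content_dominatesP => A mA A0.
  rewrite /nu/= /mfrestr/= /mrestr.
  apply/eqP; rewrite -measure_le0.
  have /null_content_dominatesP/(_ A mA A0)<- :=
    lebesgue_stieltjes_mono_lip_dominates LG.
  by apply: le_measure; rewrite ?inE//; exact: measurableI.
have [h [h0 hfin hint hE]] := radon_nikodym_sigma_finite numu.
exists (fine \o h).
have hEF : EFin \o (fine \o h) = h by apply/funext => x /=; rewrite fineK.
split; first by rewrite hEF.
  move=> a b ka ab bk; under eq_integral do rewrite /= fineK//.
  rewrite -hE//.
  rewrite /nu/= /mfrestr/= /mrestr setIidl ?GE//.
  by move=> y; rewrite /D/= !in_itv/= => /andP[ay yb]; rewrite (le_lt_trans ka)// (le_trans yb).
move=> x /andP[kx xk].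
rewrite /Rintegral; under eq_integral do rewrite fineK//.
rewrite -hE//.
rewrite /nu/= /mfrestr/= /mrestr.
have -> : (`]-oo, x] `&` D = `]- k, x])%classic.
  apply/seteqP; split => y/=; rewrite /D/= !in_itv/=.
    by move=> [yx /andP[-> _]].
  by move=> /andP[ky yx]; split => //; rewrite ky (le_trans yx).
by rewrite GE ?ltW//= addrC subrK.
Qed.

(** On the truncated range [F] is a constant plus an indefinite integral, so Lebesgue's
    differentiation theorem identifies its derivative with the density. *)
Lemma mono_lip_density_derive1 (L : R) (F : R -> R) (k : R) : mono_lip L F -> 0 < k ->
  exists h : R -> R, [/\ mu.-integrable [set: R] (EFin \o h),
    (forall a b : R, - k <= a -> a <= b -> b <= k ->
      (\int[mu]_(t in `]a, b]) (h t)%:E = (F b - F a)%:E)%E) &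
    {ae mu, forall x, - k < x < k -> derivable F x 1 /\ derive1 F x = h x}].
Proof.
move=> LF k0; have [h [hint hE hF]] := mono_lip_density LF k0.
exists h; split => //.
have hloc : locally_integrable [set: R] h.
  by apply: open_integrable_locally => //; exact: openT.
have hy y : mu.-integrable `]-oo, y] (EFin \o h).
  by apply: (integrableS measurableT) => //; exact: measurable_itv.
move: (FTC1Ny hy hloc); apply: aeS => x [dx h'] /andP[kx xk].
pose f := fun y : R => F (- k) + \int[mu]_(t in `]-oo, y]) h t.
have df : derivable f x 1 by exact: (derivableD (derivable_cst _ _ _) dx).
have fF : {near x, f =1 F}.
  near=> y; rewrite [RHS]hF//; apply/andP; split.
    by near: y; exact: lt_nbhsr.
  by apply/ltW; near: y; exact: lt_nbhsl.
split; first by refine (near_eq_derivable (f:=f) _ df).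
rewrite derive1E -(near_eq_derive (f:=f) _ fF)//.
by rewrite (deriveD (derivable_cst _ _ _) dx) derive_cst add0r -derive1E.
Unshelve. all: by end_near. Qed.

Lemma mono_lip_derivable_ae (L : R) (F : R -> R) : mono_lip L F ->
  {ae mu, forall x, derivable F x 1}.
Proof.
move=> LF.
have /ae_foralln : forall n : nat,
    {ae mu, forall x, - n.+1%:R < x < n.+1%:R -> derivable F x 1}.
  move=> n; have [//|h [_ _]] := @mono_lip_density_derive1 _ _ n.+1%:R LF.
  by apply: aeS => x + nx => /(_ nx)[].
apply: aeS => x /(_ (Num.bound `|x|)); apply.
have := archi_boundP (normr_ge0 x); rewrite ltr_norml -natr1; lra.
Qed.

(** Any measurable [m] that agrees almost everywhere with the derivative will do, so the
    measurability of [derive1 F] never has to be settled. *)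
Lemma mono_lip_FTC (L : R) (F m : R -> R) (a b : R) : mono_lip L F -> a <= b ->
  measurable_fun [set: R] m ->
  {ae mu, forall x, a < x <= b -> derivable F x 1 -> m x = derive1 F x} ->
  (\int[mu]_(x in `]a, b]) (m x)%:E = (F b - F a)%:E)%E.
Proof.
move=> LF ab mm mF; pose k := `|a| + `|b| + 1.
have k0 : 0 < k by rewrite ltr_wpDl// addr_ge0.
have [h [hint hE hF]] := mono_lip_density_derive1 LF k0.
have ka : - k <= a.
  by rewrite /k; have := ler_norm (- a); rewrite normrN; have := normr_ge0 b; lra.
have bk : b < k by rewrite /k; have := ler_norm b; have := normr_ge0 a; lra.
rewrite -hE//; last exact: ltW.
apply: ae_eq_integral => //.
- by apply/measurable_EFinP; exact: (measurable_funS _ _ mm).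
- by apply: measurable_int; apply: (integrableS measurableT) hint.
apply: aeS2 mF hF => x mFx hFx /=; rewrite in_itv/= => /andP[ax xb].
have [|dF <-] := hFx; first by rewrite (le_lt_trans ka)//= (le_lt_trans xb).
by rewrite mFx// ax.
Qed.

End mono_lip_derivable.

(** * The Hopf-Lax formula *)

Lemma derivable_expansion (R : realType) (w : R -> R) (x e : R) :
  derivable w x 1 -> 0 < e -> exists2 d, 0 < d &
    forall k, `|k| < d -> `|w (x + k) - w x - k * derive1 w x| <= e * `|k|.
Proof.
move=> dw e0; rewrite derive1E.
have /cvgrPdist_le/(_ e e0) : (fun h : R => h^-1 *: ((w \o shift x) (h *: 1) - w x))
    @ 0^' --> 'D_1 w x by exact: dw.
move=> [d /= d0 dP]; exists d => // k kd.
have [->|k0] := eqVneq k 0; first by rewrite addr0 subrr mul0r subr0 normr0 mulr0.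
have := dP k; rewrite /= sub0r normrN => /(_ kd k0).
rewrite /shift/= scaler1 -[X in _ -> X <= _]normrN => h.
have -> : - (w (x + k) - w x - k * 'D_1 w x) =
    k * ('D_1 w x - k^-1 *: (w (k + x) - w x)).
  by rewrite /GRing.scale/= mulrBr mulVKf// (addrC k); ring.
by rewrite normrM mulrC ler_wpM2r.
Qed.

(** The limit of a divergent quotient is the default value, which is 0 here; bounds on the density
    thus hold at every point, not only almost everywhere. *)
Lemma derive1_not_derivable (R : realType) (w : R -> R) (x : R) :
  ~ derivable w x 1 -> derive1 w x = 0.
Proof.
move=> dw; apply: dvgP => cw; apply: dw.
move: cw; rewrite /derivable.
rewrite (_ : (fun h => h^-1 *: (w (h + x) - w x)) =
  (fun h : R => h^-1 *: ((w \o shift x) (h *: 1) - w x)))//.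
by apply/funext => h; rewrite /= scaler1.
Qed.

Lemma mono_lip_derive1 (R : realType) (L : R) (w : R -> R) (x : R) :
  0 <= L -> mono_lip L w -> 0 <= derive1 w x <= L.
Proof.
move=> L0 wL; have [dw|dw] := pselect (derivable w x 1); last first.
  by rewrite derive1_not_derivable ?lexx.
set p := derive1 w x.
suff H e : 0 < e -> - e <= p <= L + e.
  apply/andP; split; apply/ler_addgt0Pl => e e0; have /andP[] := H e e0; lra.
move=> e0; have [d d0 /(_ (d / 2))] := derivable_expansion dw e0.
have d20 : 0 < d / 2 by rewrite divr_gt0.
rewrite gtr0_norm// -/p => /(_ ltac:(lra)); rewrite ler_norml => /andP[h1 h2].
have /andP[h3 h4] := wL x (x + d / 2) ltac:(lra).
have {}h4 : w (x + d / 2) - w x <= L * (d / 2) by move: h4; rewrite addrAC subrr add0r.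
apply/andP; split; rewrite -(ler_pM2r d20); lra.
Qed.

(** [sb_at0] bounds the infimum in [flux] from above and [sb_lower] bounds it from below, so that
    for admissible densities [fine] is applied to a finite number. *)
Record shape_bounds (R : realType) (K : option nat) (g : R -> \bar R) : Prop := {
  sb_ge0 : forall q, (0 <= g q)%E ;
  sb_noninc : forall q r : R, q <= r -> (g r <= g q)%E ;
  sb_convex : convex_ereal g ;
  sb_at0 : (g 0%R < +oo)%E ;
  sb_lower : forall q r, q <= 0 -> 0 <= r -> (r%:E <= capacity R K)%E ->
    (0 <= g q + (r * q)%:E)%E }.

Section hopf_lax_semigroup.
Context (R : realType) (K : option nat) (g : R -> \bar R) (L : R) (u0 : R -> R).
Hypothesis gP : shape_bounds K g.
Hypothesis L0 : 0 <= L.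
Hypothesis LK : (L%:E <= capacity R K)%E.
Hypothesis u0L : mono_lip L u0.

Local Notation G := (fun q => fine (g q)).
Local Notation u := (hopf_lax g u0).
Local Notation f := (flux g).

Lemma shapeE q : (g q < +oo)%E -> g q = (G q)%:E.
Proof. by move=> gq; rewrite fineK// ge0_fin_numE// (sb_ge0 gP). Qed.

Lemma shape_real_ge0 q : 0 <= G q.
Proof. by rewrite fine_ge0// (sb_ge0 gP). Qed.

Lemma shape_fin_ge0 q : 0 <= q -> (g q < +oo)%E.
Proof. by move=> q0; apply: le_lt_trans (sb_at0 gP); exact: (sb_noninc gP). Qed.

Lemma shape_real_noninc q r : q <= r -> (g q < +oo)%E -> G r <= G q.
Proof.
move=> qr gq; have gr : (g r < +oo)%E by apply: le_lt_trans gq; exact: (sb_noninc gP).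
by rewrite -lee_fin -!shapeE// (sb_noninc gP).
Qed.

Lemma shape_real_lower q r : 0 <= r -> (r%:E <= capacity R K)%E ->
  (g q < +oo)%E -> 0 <= G q + r * q.
Proof.
move=> r0 rK gq; have [q0|/ltW q0] := leP q 0.
  by have := sb_lower gP q0 r0 rK; rewrite shapeE// -EFinD lee_fin.
by rewrite addr_ge0// ?mulr_ge0// shape_real_ge0.
Qed.

Lemma shape_real_convex q r s : (g q < +oo)%E -> (g r < +oo)%E -> 0 < s -> s < 1 ->
  (g (s * q + (1 - s) * r) < +oo)%E /\
  G (s * q + (1 - s) * r) <= s * G q + (1 - s) * G r.
Proof.
move=> gq gr s0 s1; have h := sb_convex gP q r s0 s1.
rewrite (shapeE gq) (shapeE gr) -!EFinM -EFinD in h.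
have h' : (g (s * q + (1 - s) * r)%R < +oo)%E by rewrite (le_lt_trans h)// ltry.
by split => //; rewrite -lee_fin -shapeE.
Qed.

Lemma flux_le q r : 0 <= r -> (r%:E <= capacity R K)%E -> (g q < +oo)%E ->
  f r <= G q + r * q.
Proof.
move=> r0 rK gq; rewrite /flux.
set S := (X in ereal_inf X).
have S0 : (0 <= ereal_inf S)%E.
  apply: le_ereal_inf_tmp => _ [z _ <-]; case: (ltP (g z) +oo%E) => gz.
    by rewrite shapeE// -EFinD lee_fin shape_real_lower.
  by move: gz; rewrite leye_eq => /eqP ->; rewrite addye.
have Sq : (ereal_inf S <= (G q + r * q)%:E)%E.
  by apply: ereal_inf_lbound; exists q => //; rewrite shapeE// EFinD.
by rewrite -lee_fin fineK// ge0_fin_numE// (le_lt_trans Sq)// ltry.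
Qed.

Lemma flux_ge r c : 0 <= r -> (r%:E <= capacity R K)%E ->
  (forall q, (g q < +oo)%E -> c <= G q + r * q) -> c <= f r.
Proof.
move=> r0 rK cP; rewrite /flux.
set S := (X in ereal_inf X).
have S0 : (c%:E <= ereal_inf S)%E.
  apply: le_ereal_inf_tmp => _ [z _ <-]; case: (ltP (g z) +oo%E) => gz.
    by rewrite shapeE// -EFinD lee_fin cP.
  by move: gz; rewrite leye_eq => /eqP ->; rewrite addye// leey.
have Sq : (ereal_inf S <= (G 0 + r * 0)%:E)%E.
  apply: ereal_inf_lbound; exists 0 => //.
  by rewrite shapeE ?(sb_at0 gP)// EFinD.
rewrite -lee_fin fineK//; apply/fin_numPlt.
by rewrite (lt_le_trans _ S0) ?ltNyr//= (le_lt_trans Sq)// ltry.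
Qed.

Lemma flux_ge0 r : 0 <= r -> (r%:E <= capacity R K)%E -> 0 <= f r.
Proof. by move=> r0 rK; apply: flux_ge => // q gq; exact: shape_real_lower. Qed.

Lemma flux_bound r : 0 <= r -> (r%:E <= capacity R K)%E -> f r <= G 0.
Proof.
by move=> r0 rK; have := flux_le r0 rK (sb_at0 gP); rewrite mulr0 addr0.
Qed.

(** For q > 0 the point [x - t * q] lies to the left, where [w] is smaller. For q <= 0 the gain of
    [w] is at most [L * t * |q|], and [sb_lower] at density [L] says that [t * G q] pays for it.
    Stated for any [w], to apply to [u0] and to the later heights alike. *)
Lemma hopf_lax_le0 (w : R -> R) (x t q : R) : mono_lip L w -> 0 <= t ->
  (g q < +oo)%E -> w (x - t * q) - t * G q <= w x.
Proof.
move=> wL t0 gq; have [q0|/ltW q0] := leP q 0.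
  have /andP[_] := wL x (x - t * q) ltac:(by rewrite lerDl oppr_ge0 mulr_ge0_le0).
  have := shape_real_lower L0 LK gq => h1 h2.
  have : 0 <= t * (G q + L * q) by exact: mulr_ge0.
  lra.
have /andP[+ _] := wL (x - t * q) x ltac:(by rewrite gerBl mulr_ge0).
have : 0 <= t * G q by rewrite mulr_ge0// shape_real_ge0.
lra.
Qed.

Lemma hopf_lax_sup (x t : R) : 0 < t ->
  let S := [set ((u0 y)%:E - t%:E * g ((x - y) / t)%R)%E | y in [set: R]] in
  [/\ (forall q, (g q < +oo)%E -> ((u0 (x - t * q) - t * G q)%:E <= ereal_sup S)%E),
      (forall c, (forall q, (g q < +oo)%E -> u0 (x - t * q) - t * G q <= c) ->
        (ereal_sup S <= c%:E)%E) & ereal_sup S \is a fin_num].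
Proof.
move=> t0 S.
have P1 q : (g q < +oo)%E -> ((u0 (x - t * q) - t * G q)%:E <= ereal_sup S)%E.
  move=> gq; apply: ereal_sup_ubound; exists (x - t * q) => //.
  have -> : (x - (x - t * q)) / t = q.
    by rewrite opprB addrCA subrr addr0 mulrAC divff ?mul1r ?gt_eqF.
  by rewrite (shapeE gq) EFinB EFinM.
have P2 c : (forall q, (g q < +oo)%E -> u0 (x - t * q) - t * G q <= c) ->
    (ereal_sup S <= c%:E)%E.
  move=> cP; apply: ge_ereal_sup => _ [y _ <-].
  case: (ltP (g ((x - y) / t)) +oo%E) => gy.
    rewrite (shapeE gy) -EFinM -EFinB lee_fin; have := cP _ gy.
    by rewrite (mulrC t ((x - y) / t)) divfK ?gt_eqF// opprB addrCA subrr addr0.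
  move: gy; rewrite leye_eq => /eqP ->.
  by rewrite gt0_muley ?lte_fin// addeNy leNye.
split => //; apply/fin_numPlt; apply/andP; split.
  by apply: lt_le_trans (P1 0 (sb_at0 gP)); rewrite ltNyr.
apply: le_lt_trans (P2 (u0 x) _) (ltry _) => q gq.
by apply: hopf_lax_le0 => //; exact: ltW.
Qed.

Lemma hopf_lax_ge x t q : 0 < t -> (g q < +oo)%E ->
  u0 (x - t * q) - t * G q <= u x t.
Proof.
move=> t0 gq; have [P1 _ P3] := hopf_lax_sup x t0.
by rewrite /hopf_lax t0 -lee_fin fineK// P1.
Qed.

Lemma hopf_lax_le x t c : 0 < t ->
  (forall q, (g q < +oo)%E -> u0 (x - t * q) - t * G q <= c) -> u x t <= c.
Proof.
move=> t0 cP; have [_ P2 P3] := hopf_lax_sup x t0.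
by rewrite /hopf_lax t0 -lee_fin fineK// P2.
Qed.

Lemma hopf_lax_initial x t : t <= 0 -> u x t = u0 x.
Proof. by move=> t0; rewrite /hopf_lax ltNge t0. Qed.

Lemma hopf_lax_mono_lip t : mono_lip L (u ^~ t).
Proof.
have [t0|t0] := leP t 0; first by move=> x y xy; rewrite !hopf_lax_initial//; exact: u0L.
move=> x y xy; apply/andP; split.
  rewrite subr_ge0; apply: hopf_lax_le => // q gq.
  apply: le_trans (hopf_lax_ge y t0 gq); rewrite lerD2r.
  by apply: (mono_lip_ndecr u0L); rewrite lerD2r.
rewrite lerBlDr; apply: hopf_lax_le => // q gq.
have := hopf_lax_ge x t0 gq.
have xy' : x - t * q <= y - t * q by rewrite lerD2r.
have /andP[_] := u0L xy'.
lra.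
Qed.

(** Velocity r for time t followed by q for time h averages to the velocity [z], and convexity of
    [g] makes the averaged cost no larger than the sum of the two costs. *)
Lemma hopf_lax_semigroup_ge x t h q : 0 <= t -> 0 < h -> (g q < +oo)%E ->
  u (x - h * q) t - h * G q <= u x (t + h).
Proof.
move=> t0 h0 gq; have [tE|t0'] := eqVneq t 0.
  by rewrite tE add0r (@hopf_lax_initial _ 0)//; exact: hopf_lax_ge.
have {t0'}t0 : 0 < t by rewrite lt_neqAle eq_sym t0' t0.
have th : 0 < t + h by exact: addr_gt0.
rewrite lerBlDr; apply: hopf_lax_le => // r gr.
have s0 : 0 < t / (t + h) by exact: divr_gt0.
have s1 : t / (t + h) < 1 by rewrite ltr_pdivrMr// mul1r ltrDl.
have [gz Gz] := shape_real_convex gr gq s0 s1.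
have := hopf_lax_ge x th gz.
set z := _ * r + _ in gz Gz *.
have zE : (t + h) * z = t * r + h * q.
  by rewrite /z; field; rewrite gt_eqF.
have : (t + h) * G z <= t * G r + h * G q.
  have -> : t * G r + h * G q =
      (t + h) * (t / (t + h) * G r + (1 - t / (t + h)) * G q).
    by field; rewrite gt_eqF.
  by rewrite ler_pM2l.
have -> : x - h * q - t * r = x - (t + h) * z by rewrite zE; ring.
lra.
Qed.

(** A straight path of velocity q has the same velocity before and after time t, so its cost splits
    exactly; convexity enters only in the reverse inequality. *)
Lemma hopf_lax_semigroup_le x t h c : 0 <= t -> 0 < h ->
  (forall q, (g q < +oo)%E -> u (x - h * q) t - h * G q <= c) -> u x (t + h) <= c.
Proof.
move=> t0 h0 cP; have [tE|t0'] := eqVneq t 0.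
  rewrite tE add0r; apply: hopf_lax_le => // q gq; have := cP q gq.
  by rewrite hopf_lax_initial ?tE.
have {t0'}t0 : 0 < t by rewrite lt_neqAle eq_sym t0' t0.
apply: hopf_lax_le => [|q gq]; first exact: addr_gt0.
have := hopf_lax_ge (x - h * q) t0 gq; have := cP q gq.
have -> : x - h * q - t * q = x - (t + h) * q by ring.
lra.
Qed.

(** The decrease in time is [hopf_lax_le0] combined with the semigroup property; the bound on the
    rate is the choice q = 0. Negative times are covered because [hopf_lax] is frozen at [u0]
    there. *)
Lemma hopf_lax_time_mono_lip x : mono_lip (G 0) (fun t => - u x t).
Proof.
have G0 := shape_real_ge0 0.
have H a h : 0 <= a -> 0 < h -> 0 <= u x a - u x (a + h) <= G 0 * h.
  move=> a0 h0; apply/andP; split.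
    rewrite subr_ge0; apply: hopf_lax_semigroup_le => // q gq.
    by apply: (@hopf_lax_le0 (u ^~ a)) => //; [exact: hopf_lax_mono_lip|exact: ltW].
  have := hopf_lax_semigroup_ge x a0 h0 (sb_at0 gP).
  rewrite mulr0 subr0; lra.
move=> a b ab; rewrite opprK addrC.
have [b0|b0] := leP b 0.
  rewrite !hopf_lax_initial//; last exact: le_trans ab b0.
  by rewrite subrr lexx mulr_ge0// subr_ge0.
have [a0|a0] := leP a 0.
  have -> : u x a = u x 0 by rewrite !hopf_lax_initial.
  have := H 0 b (lexx _) b0; rewrite add0r => /andP[-> h].
  by apply: (le_trans h); rewrite ler_wpM2l// lerDl oppr_ge0.
have [->|ab'] := eqVneq a b; first by rewrite !subrr mulr0 lexx.
have ba : 0 < b - a by rewrite subr_gt0 lt_neqAle ab' ab.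
have := H a (b - a) (ltW a0) ba.
by have -> : a + (b - a) = b by ring.
Qed.

Lemma hopf_lax_time_lip x s t : `|u x s - u x t| <= G 0 * `|s - t|.
Proof.
rewrite -normrN opprD opprK.
by have := mono_lip_lip s t (hopf_lax_time_mono_lip x); rewrite opprK.
Qed.

(** The first-order expansion of [u] in x is uniform only over bounded velocities, while the
    supremum runs over all of them; most of the proof confines it to a bounded range. *)
Lemma hopf_lax_right_derivative x t e : 0 <= t -> derivable (u ^~ t) x 1 -> 0 < e ->
  exists2 d, 0 < d & forall h, 0 < h -> h < d ->
    `|u x (t + h) - u x t + h * f (hopf_lax_density g u0 x t)| <= e * h.
Proof.
move=> t0 du; move: e.
suff H e : 0 < e -> exists2 d, 0 < d & forall h, 0 < h -> h < d ->
    `|u x (t + h) - u x t + h * f (hopf_lax_density g u0 x t)| <= 3 * e * h.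
  move=> e e0; have [d d0 dP] := H (e / 3) ltac:(lra).
  by exists d => // h h0 hd; have := dP h h0 hd; rewrite (_ : 3 * (e / 3) = e)//; field.
move=> e0.
have wL := hopf_lax_mono_lip t.
have /andP[p0 pL] : 0 <= hopf_lax_density g u0 x t <= L := mono_lip_derive1 x L0 wL.
set p := hopf_lax_density g u0 x t in p0 pL *.
have pK : (p%:E <= capacity R K)%E by apply: le_trans LK; rewrite lee_fin.
have inf_attained (D : set R) (k : R -> R) : D 0 -> (forall q, D q -> 0 <= k q) ->
    exists2 q0, D q0 & forall q, D q -> k q0 <= k q + e.
  move=> D0 kD; have kinf : has_inf [set k q | q in D].
    by split; [exists (k 0), 0|exists 0 => _ [q Dq <-]; exact: kD].
  have [_ [q0 Dq0 <-] q0e] := inf_adherent e0 kinf.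
  exists q0 => // q Dq; apply/ltW/(lt_le_trans q0e).
  by rewrite lerD2r; apply: ge_inf; [exact: kinf.2|exists q].
(* [q1] nearly attains [f p]; the speeds above [q2] are dominated by [q2] because
   [u] is nondecreasing, those below [q3] by [q3] because [u] is [L]-Lipschitz. *)
have [q1 gq1 q1P] := inf_attained [set q | (g q < +oo)%E] (fun q => G q + p * q)
  (sb_at0 gP) (fun q gq => shape_real_lower p0 pK gq).
have [q2 q20 q2P] := inf_attained [set q | 0 <= q] G (lexx _)
  (fun q _ => shape_real_ge0 q).
have [q3 [q30 gq3] q3P] := inf_attained [set q | q <= 0 /\ (g q < +oo)%E]
  (fun q => G q + L * q) (conj (lexx _) (sb_at0 gP))
  (fun q gq => shape_real_lower L0 LK gq.2).
have gq2 := shape_fin_ge0 q20.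
have {q1P}q1f : G q1 + p * q1 <= f p + e.
  rewrite -lerBlDr; apply: flux_ge => // q gq; rewrite lerBlDr; exact: q1P.
pose M := `|q1| + `|q2| + `|q3| + 1.
have M0 : 0 < M by rewrite ltr_wpDl// !addr_ge0.
(* [M] bounds the three velocities. An expansion error of [e / M] per unit of displacement amounts
   to at most [e * h] for displacements up to [h * M]. *)
have [d d0 dP] := derivable_expansion du (divr_gt0 e0 M0).
exists (d / M); first exact: divr_gt0.
move=> h h0 hd; have {}hd : h * M < d by rewrite -ltr_pdivlMr.
have expand q : `|q| <= M -> `|u (x - h * q) t - u x t + h * q * p| <= e * h.
  move=> qM; have := dP (- (h * q)).
  have hq : `|- (h * q)| <= h * M by rewrite normrN normrM gtr0_norm// ler_pM2l.
  move=> /(_ (le_lt_trans hq hd)).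
  rewrite mulNr opprK => /le_trans; apply.
  apply: (@le_trans _ _ (e / M * (h * M))); first by rewrite ler_pM2l// divr_gt0.
  by rewrite mulrCA mulrC divfK// gt_eqF.
have eh0 : 0 <= e * h by rewrite mulr_ge0// ltW.
have q1M : `|q1| <= M by rewrite /M; have := normr_ge0 q2; have := normr_ge0 q3; lra.
have q2M : `|q2| <= M by rewrite /M; have := normr_ge0 q1; have := normr_ge0 q3; lra.
have q3M : `|q3| <= M by rewrite /M; have := normr_ge0 q1; have := normr_ge0 q2; lra.
rewrite ler_norml; apply/andP; split.
  have := hopf_lax_semigroup_ge x t0 h0 gq1.
  have := expand _ q1M; rewrite ler_norml => /andP[h1 _].
  have : h * (G q1 + p * q1) <= h * (f p + e) by rewrite ler_pM2l.
  lra.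
suff : u x (t + h) <= u x t - h * f p + 3 * e * h by lra.
apply: hopf_lax_semigroup_le => // q gq.
have [qq2|q2q] := leP q q2; last first.
  have h1 : u (x - h * q) t <= u (x - h * q2) t.
    by apply: (mono_lip_ndecr wL); rewrite lerD2l lerN2 ler_pM2l// ltW.
  have := expand _ q2M; rewrite ler_norml => /andP[_ h2].
  have h3 : h * G q2 <= h * (G q + e).
    by rewrite ler_pM2l// q2P//=; apply: le_trans q20 (ltW q2q).
  have h4 : h * f p <= h * (G q2 + p * q2) by rewrite ler_pM2l// flux_le.
  lra.
have [q3q|qq3] := leP q3 q; last first.
  have qh : x - h * q3 <= x - h * q by rewrite lerD2l lerN2 ler_pM2l// ltW.
  have /andP[_ h1] := wL _ _ qh.
  have := expand _ q3M; rewrite ler_norml => /andP[_ h2].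
  have h3 : h * (G q3 + L * q3) <= h * (G q + L * q + e).
    by rewrite ler_pM2l// q3P//=; split => //; apply: le_trans (ltW qq3) q30.
  have h4 : h * f p <= h * (G q3 + p * q3) by rewrite ler_pM2l// flux_le.
  lra.
have qM : `|q| <= M.
  rewrite /M ler_norml; have := normr_ge0 q1; have := ler_norm q2.
  have := ler_norm (- q3); have := normr_ge0 q2; have := normr_ge0 q3.
  rewrite normrN; lra.
have := expand _ qM; rewrite ler_norml => /andP[_ h2].
have h4 : h * f p <= h * (G q + p * q) by rewrite ler_pM2l// flux_le.
lra.
Qed.

End hopf_lax_semigroup.

(** * Measurability and integration on the plane *)

Section plane_measurability.
Context {R : realType}.

Lemma cvg_invS0 : (n.+1%:R^-1 : R) @[n --> \oo] --> 0.
Proof. exact: cvg_harmonic. Qed.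

(** Rounding x down to a multiple of 1/(n+1) gives a function that depends only on t on each of
    countably many strips, hence is measurable; continuity in x gives the convergence. *)
Lemma measurable_separately_continuous (f : R -> R -> R) :
  (forall t, continuous (f ^~ t)) -> (forall x, continuous (f x)) ->
  measurable_fun [set: R * R] (fun z => f z.1 z.2).
Proof.
move=> cx ct.
pose fl (n : nat) (x : R) : R := (Num.floor (n.+1%:R * x))%:~R / n.+1%:R.
apply: (@measurable_fun_cvg _ _ _ _ (fun n z => f (fl n z.1) z.2)).
  move=> n _ Y mY; rewrite setTI.
  have -> : (fun z : R * R => f (fl n z.1) z.2) @^-1` Y = \bigcup_(k : int)
     ([set x : R | n.+1%:R * x \in `[k%:~R, (k + 1)%:~R[] `*` [set t | Y (f (k%:~R / n.+1%:R) t)]).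
    apply/seteqP; split => [[x t]/= Yz|[x t] [k _ [/=]]].
      by exists (Num.floor (n.+1%:R * x)) => //; split => //=; rewrite in_itv/= floor_itv.
    rewrite in_itv/= => kx; rewrite /fl.
    by rewrite (@floor_def _ _ k).
  apply: countable_bigcupT_measurable; first exact: countableP.
  move=> k; apply: measurableX.
    have mM : measurable_fun [set: R] (fun x : R => n.+1%:R * x).
      by apply: measurable_funM => //; exact: measurable_cst.
    have := mM measurableT `[k%:~R, (k + 1)%:~R[%classic (measurable_itv _).
    by rewrite setTI.
  have := continuous_measurable_fun (ct (k%:~R / n.+1%:R)) measurableT mY.
  by rewrite setTI.
move=> [x t] _ /=; apply: (@continuous_cvg _ _ _ _ _ (fl ^~ x) (f ^~ t)); first exact: cx.
apply/cvgrPdist_le => e e0.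
have /cvgrPdist_le/(_ e e0) := cvg_invS0.
apply: filterS => n; rewrite sub0r normrN => ne; apply: le_trans ne.
rewrite [leRHS]ger0_norm ?invr_ge0//; have /andP[h1 h2] := floor_itv (n.+1%:R * x).
have n0 : 0 < n.+1%:R :> R by [].
have h3 : fl n x * n.+1%:R = (Num.floor (n.+1%:R * x))%:~R by rewrite /fl divfK// gt_eqF.
rewrite intrD -h3 in h2; rewrite -h3 in h1.
rewrite ger0_norm ?subr_ge0.
  rewrite -(ler_pM2r n0) mulrBl mulVf ?gt_eqF//; lra.
by rewrite -(ler_pM2r n0); lra.
Qed.

(** Restricting the Cauchy criterion to rational increments leaves countably many conditions, which
    is what makes the set of differentiability points measurable. *)
Lemma derivable_rat_cauchy (w : R -> R) (x : R) : continuous w ->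
  derivable w x 1 <-> forall k : nat, exists n : nat, forall p q : rat,
    0 < `|ratr p : R| < n.+1%:R^-1 -> 0 < `|ratr q : R| < n.+1%:R^-1 ->
    `|(w (x + ratr p) - w x) / ratr p - (w (x + ratr q) - w x) / ratr q| <= k.+1%:R^-1.
Proof.
move=> cw; split=> [dw k|H].
  have k0 : 0 < k.+1%:R^-1 / 2 :> R by rewrite divr_gt0// invr_gt0.
  have [d d0 dP] := derivable_expansion dw k0.
  have /cvgrPdist_lt/(_ d d0)[n _ /(_ n (leqnn _))/=] := cvg_invS0.
  rewrite sub0r normrN ger0_norm ?invr_ge0// => nd.
  exists n.
  have D (p : R) : 0 < `|p| < n.+1%:R^-1 ->
      `|(w (x + p) - w x) / p - derive1 w x| <= k.+1%:R^-1 / 2.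
    move=> /andP[p0 pn]; have := dP _ (lt_trans pn nd).
    have p0' : p != 0 by rewrite -normr_gt0.
    have -> : w (x + p) - w x - p * derive1 w x =
       p * ((w (x + p) - w x) / p - derive1 w x) by field.
    by rewrite normrM [leRHS]mulrC ler_pM2l.
  move=> p q pn qn; rewrite (splitr k.+1%:R^-1).
  apply: le_trans (ler_distD (derive1 w x) _ _) _.
  by apply: lerD; [exact: D|rewrite distrC; exact: D].
pose Q h := (w (x + h) - w x) / h.
have HQ e : 0 < e -> exists n : nat, forall (h : R) (q : rat), 0 < `|h| < n.+1%:R^-1 ->
    0 < `|ratr q : R| < n.+1%:R^-1 -> `|Q h - Q (ratr q)| <= e.
  move=> e0; have /cvgrPdist_lt/(_ e e0)[k _ /(_ k (leqnn _))/=] := cvg_invS0.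
  rewrite sub0r normrN ger0_norm ?invr_ge0// => ke.
  have [n nP] := H k; exists n => h q /andP[h0 hn] qn.
  rewrite leNgt; apply/negP => eQ.
  have h0' : h != 0 by rewrite -normr_gt0.
  (* A violation at a real increment h persists near h by continuity of [Q], hence occurs at a
     rational increment, where the hypothesis forbids it. *)
  have cQ : {for h, continuous (fun p => `|Q p - Q (ratr q)|)}.
    apply: cvg_norm; apply: cvgB; last exact: cvg_cst.
    apply: cvgM; last exact: cvgV.
    apply: cvgB; last exact: cvg_cst.
    apply: (@continuous_cvg _ _ _ _ _ (fun p => x + p) w); first exact: cw.
    by apply: cvgD; [exact: cvg_cst|exact: cvg_id].
  have /nbhs_ballP[r /= r0 rP] : \forall p \near h,
      0 < `|p| < n.+1%:R^-1 /\ e < `|Q p - Q (ratr q)|.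
    near=> p; split.
      apply/andP; split; near: p.
        by apply: (cvgr_gt `|h|) => //; exact: (cvg_norm cvg_id).
      by apply: (cvgr_lt `|h|) => //; exact: (cvg_norm cvg_id).
    by near: p; exact: (cvgr_gt _ cQ).
  have [p] := @rat_in_itvoo R h (h + r) ltac:(lra).
  rewrite in_itv/= => /andP[hp pr].
  have [|pn eQp] := rP (ratr p); first by rewrite /ball/= ltr_norml; apply/andP; split; lra.
  have := nP p q pn qn; rewrite leNgt => /negP; apply.
  exact: lt_trans ke eQp.
apply/cvg_ex.
suff : cvg (Q h @[h --> 0^']).
  move=> /cvg_ex[l Ql]; exists l; move: Ql.
  rewrite (_ : Q = fun h : R => h^-1 *: ((w \o shift x) (h *: 1) - w x))//.
  by apply/funext => h; rewrite /Q/= scaler1 /GRing.scale/= mulrC (addrC h).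
apply/cauchy_cvgP; apply: cauchy_exP => e e0.
have [n nP] := HQ (e / 2) ltac:(lra).
have n0 : 0 < n.+1%:R^-1 :> R by rewrite invr_gt0.
have [q] := rat_in_itvoo n0; rewrite in_itv/= => /andP[q0 qn].
exists (Q (ratr q)).
exists n.+1%:R^-1 => //= h; rewrite /= sub0r normrN => hn h0.
rewrite /ball/= distrC; apply: (@le_lt_trans _ _ (e / 2)); last lra.
apply: nP; first by rewrite normr_gt0 h0.
by rewrite gtr0_norm// q0.
Unshelve. all: by end_near. Qed.

Variable u : R -> R -> R.
Hypothesis cx : forall t, continuous (u ^~ t).
Hypothesis mu_ : measurable_fun [set: R * R] (fun z => u z.1 z.2).

Lemma measurable_xshift (h : R) : measurable_fun [set: R * R] (fun z => u (z.1 + h) z.2).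
Proof.
have mp : measurable_fun [set: R * R] (fun z : R * R => (z.1 + h, z.2)).
  apply: measurable_fun_pair; last exact: measurable_snd.
  by apply: measurable_funD; [exact: measurable_fst|exact: measurable_cst].
exact: (measurableT_comp mu_ mp).
Qed.

Lemma measurable_derivable :
  measurable [set z : R * R | derivable (u ^~ z.2) z.1 1].
Proof.
pose Q (p : rat) (z : R * R) := (u (z.1 + ratr p) z.2 - u z.1 z.2) / ratr p.
have mQ p : measurable_fun [set: R * R] (Q p).
  by apply: measurable_funM => //; apply: measurable_funB => //; exact: measurable_xshift.
rewrite (_ : [set z | _] = \bigcap_(k : nat) \bigcup_(n : nat) ~`
    \bigcup_(p : rat) \bigcup_(q : rat) [set z |
    [&& 0 < `|ratr p : R| < n.+1%:R^-1, 0 < `|ratr q : R| < n.+1%:R^-1 &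
       k.+1%:R^-1 < `|Q p z - Q q z|]]).
  apply: bigcapT_measurable => k; apply: bigcupT_measurable => n.
  apply: measurableC; apply: bigcupT_measurable_rat => p.
  apply: bigcupT_measurable_rat => q.
  have [pq|pq] := boolP ((0 < `|ratr p : R| < n.+1%:R^-1) && (0 < `|ratr q : R| < n.+1%:R^-1)).
    have := @measurable_fun_ltr _ _ _ _ (cst k.+1%:R^-1) (fun z => `|Q p z - Q q z|)
      (measurable_cst _) (measurableT_comp (@normr_measurable _ _) (measurable_funB (mQ p) (mQ q))).
    have m1 : measurable [set true] by [].
    move=> /(_ measurableT [set true] m1); rewrite setTI.
    congr measurable; apply/seteqP; split => z /=; rewrite andbA pq//=.
  rewrite (_ : [set z | _] = set0)//; apply/seteqP; split => z //=.
  by rewrite andbA (negbTE pq).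
apply/seteqP; split => z /=.
  move=> /(derivable_rat_cauchy _ (@cx _)) H k _; have [n nP] := H k.
  exists n => // -[p _ [q _ /= /and3P[pn qn]]].
  by rewrite ltNge; apply/negP; rewrite negbK; exact: nP.
move=> H; apply/(derivable_rat_cauchy _ (@cx _)) => k; have [n _ nP] := H k I.
exists n => p q pn qn; rewrite leNgt; apply/negP => pq; apply: nP.
by exists p => //; exists q => //=; rewrite pn qn.
Qed.

(** The indicator of [D] makes the quotients converge everywhere: off [D] both they and, by
    hypothesis, the derivative are 0. *)
Lemma measurable_derive1 : (forall z, ~ derivable (u ^~ z.2) z.1 1 ->
    derive1 (u ^~ z.2) z.1 = 0) ->
  measurable_fun [set: R * R] (fun z => derive1 (u ^~ z.2) z.1).
Proof.
move=> d0.
pose D := [set z : R * R | derivable (u ^~ z.2) z.1 1].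
pose h (n : nat) (z : R * R) := n.+1%:R * (u (z.1 + n.+1%:R^-1) z.2 - u z.1 z.2) * \1_D z.
apply: (@measurable_fun_cvg _ _ _ _ h).
  move=> n; apply: measurable_funM.
    by apply: measurable_funM => //; apply: measurable_funB => //; exact: measurable_xshift.
  by apply: measurable_indic; exact: measurable_derivable.
move=> z _; apply/cvgrPdist_le => e e0; rewrite /h indicE.
have [Dz|Dz] := pselect (D z); last first.
  by apply: nearW => n; rewrite d0// memNset// mulr0 subrr normr0 ltW.
rewrite mem_set//; have [d d1 dP] := derivable_expansion Dz e0.
have /cvgrPdist_lt/(_ d d1) := cvg_invS0.
apply: filterS => n; rewrite sub0r normrN mulr1 => /dP.
have n0 : 0 < n.+1%:R :> R by [].
rewrite (@ger0_norm _ n.+1%:R^-1) ?invr_ge0// => hn.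
rewrite distrC -(ler_pM2r (_ : 0 < n.+1%:R^-1)) ?invr_gt0//.
apply: le_trans hn.
rewrite -[X in _ * X <= _]gtr0_norm ?invr_gt0// -normrM.
by rewrite mulrBl mulrAC mulfV ?gt_eqF// mul1r (mulrC _ n.+1%:R^-1).
Qed.

End plane_measurability.

Section plane_integration.
Context {R : realType}.
Local Notation mu := (@lebesgue_measure R).
Local Notation mu2 := (mu \x mu)%E.

Lemma ae_prod_ysection (P : R * R -> Prop) : measurable [set z | P z] ->
  (forall t, {ae mu, forall x, P (x, t)}) -> {ae mu2, forall z, P z}.
Proof.
move=> mP Pt; set N := ~` [set z | P z].
have mN : measurable N by exact: measurableC.
exists N; split => //.
rewrite -[N]setIT -integral_indic//.
rewrite fubini_tonelli2//; last first.
  by apply/measurable_EFinP; exact: measurable_indic.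
rewrite -[RHS](@integral0 _ _ _ mu setT); apply: eq_integral => t _.
rewrite /fubini_G -[RHS](@integral0 _ _ _ mu setT); apply: ae_eq_integral => //.
  apply/measurable_EFinP.
  have m1 : measurable_fun [set: R * R] (\1_N : R * R -> R) by exact: measurable_indic.
  exact: (measurable_fun_pair1 t m1).
apply: aeS (Pt t) => x Px _; rewrite indicE memNset//.
Qed.

Lemma ae_prod_xsection (P : R * R -> Prop) : {ae mu2, forall z, P z} ->
  {ae mu, forall x, {ae mu, forall t, P (x, t)}}.
Proof.
move=> [N [mN N0 PN]].
have mX := measurable_fun_xsection mu mN.
have /(ae_eq_integral_abs _ measurableT mX) :
    (\int[mu]_(x in setT) `|(mu \o xsection N) x| = 0)%E.
  rewrite -[RHS]N0 /product_measure1; apply: eq_integral => x _.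
  by rewrite gee0_abs.
apply: aeS => x /(_ I) /= Nx.
exists (xsection N x); split => //; first exact: measurable_xsection.
by move=> t /= Pxt; rewrite /xsection/= inE; exact: PN.
Qed.

(** Translation invariance of the measure follows from its uniqueness, checked on half-open
    intervals. The split into positive and negative parts admits functions that are not
    integrable. *)
Lemma integral_shift (f : R -> \bar R) (a : R) : measurable_fun [set: R] f ->
  (\int[mu]_x f (x + a)%R = \int[mu]_x f x)%E.
Proof.
move=> mf.
have ms : measurable_fun [set: measurableTypeR R]
    (fun x : measurableTypeR R => (x + a : measurableTypeR R)).
  by apply: measurable_funD; [exact: measurable_id|exact: measurable_cst].
pose phi : {mfun measurableTypeR R >-> measurableTypeR R} :=
  HB.pack (fun x : measurableTypeR R => (x + a : measurableTypeR R))
    (isMeasurableFun.Build _ _ _ _ _ ms).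
have muE A : measurable (A : set (measurableTypeR R)) -> pushforward mu phi A = mu A.
  move=> mA; apply/esym.
  apply: (@lebesgue_measure_unique _ (pushforward mu phi)) => //.
  move=> _ [[x y] _ <-]/=; rewrite /pushforward/=.
  have -> : (fun z : R => z + a) @^-1` `]x, y] = `]x - a, y - a]%classic.
    by apply/seteqP; split => z /=; rewrite !in_itv/= ltrBlDr lerBrDr.
  by rewrite !lebesgue_measure_itv/= !lte_fin ltrD2r -!EFinB opprB addrA subrK.
have H (k : R -> \bar R) : measurable_fun [set: R] k -> (forall x, 0 <= k x)%E ->
    (\int[mu]_x k (x + a)%R = \int[mu]_x k x)%E.
  move=> mk k0.
  transitivity (\int[pushforward mu phi]_x k x)%E.
    by rewrite (ge0_integral_pushforward ms mu measurableT mk)//; move=> x _.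
  by apply: eq_measure_integral => A mA _; exact: muE.
rewrite integralE [RHS]integralE; congr (_ - _)%E.
  rewrite -(H (f^\+)%E (measurable_funepos mf) (funepos_ge0 f)).
  by apply: eq_integral => x _; rewrite !funeposE.
rewrite -(H (f^\-)%E (measurable_funeneg mf) (funeneg_ge0 f)).
by apply: eq_integral => x _; rewrite !funenegE.
Qed.

Definition box (A : R) : set (R * R) := `[- A, A]%classic `*` `[- A, A]%classic.

Lemma measurable_box A : measurable (box A).
Proof. by apply: measurableX; exact: measurable_itv. Qed.

Lemma box_integrable (k : R * R -> R) (A C : R) : measurable_fun [set: R * R] k ->
  (forall z, `|k z| <= C) -> (forall z, ~ box A z -> k z = 0) ->
  mu2.-integrable [set: R * R] (EFin \o k).
Proof.
move=> mk kC kA.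
have -> : EFin \o k = (EFin \o k) \_ (box A).
  apply/funext => z; rewrite patchE; case: ifPn => //; rewrite notin_setE => /kA /= ->.
  by [].
refine (iffLR (integrable_mkcond (mu := mu2) _ (measurable_box A)) _).
apply: measurable_bounded_integrable.
- exact: measurable_box.
- have E : mu2 (box A) = (mu [set` `[(- A)%R, A]] * mu [set` `[(- A)%R, A]])%E :=
    product_measure1E mu mu (measurable_itv _) (measurable_itv _).
  have h : (mu2 (box A) < +oo)%E.
    rewrite E !lebesgue_measure_itv/=.
    by case: ifP => _; rewrite ?mule0// -!EFinD -EFinM ltry.
  exact: h.
- exact: measurable_funS mk.
- by exists C; split; [exact: num_real|move=> M CM z _ /=; exact: le_trans (kC z) (ltW CM)].
Qed.

Lemma box_dominated_cvg (k_ : nat -> R * R -> R) (k : R * R -> R) (A C : R) :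
  (forall n, measurable_fun [set: R * R] (k_ n)) -> measurable_fun [set: R * R] k ->
  (forall n z, `|k_ n z| <= C) -> (forall n z, ~ box A z -> k_ n z = 0) ->
  {ae mu2, forall z, k_ n z @[n --> \oo] --> k z} ->
  (\int[mu2]_z (k_ n z)%:E @[n --> \oo] --> \int[mu2]_z (k z)%:E)%E.
Proof.
move=> mk_ mk kC kA kk.
have C0 : 0 <= C by exact: le_trans (normr_ge0 _) (kC 0%N (0, 0)).
pose G z := C * \1_(box A) z : R.
have Gint : mu2.-integrable [set: R * R] (EFin \o G).
  apply: (@box_integrable _ A C).
  - apply: measurable_funM; first exact: measurable_cst.
    by apply: measurable_indic; exact: measurable_box.
  - move=> z; rewrite /G indicE; case: (_ \in _); rewrite ?mulr1 ?mulr0 ?normr0//.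
    by rewrite ger0_norm.
  - by move=> z zA; rewrite /G indicE memNset// mulr0.
have [] := @dominated_convergence _ _ _ mu2 setT measurableT
  (fun n z => (k_ n z)%:E) (fun z => (k z)%:E) (EFin \o G).
- by move=> n; apply/measurable_EFinP; exact: mk_.
- by apply/measurable_EFinP; exact: mk.
- by apply: aeS kk => z kz _; apply: cvg_EFin; [exact: nearW|exact: kz].
- exact: Gint.
- apply: aeW => z n _; rewrite /= lee_fin /G indicE.
  have [zA|zA] := pselect (box A z); first by rewrite mem_set// mulr1.
  by rewrite kA// normr0 mulr_ge0.
by move=> _ _.
Qed.

Lemma box_integral_shift (k : R * R -> R) (A C a b : R) : measurable_fun [set: R * R] k ->
  (forall z, `|k z| <= C) -> (forall z, ~ box A z -> k z = 0) ->
  (\int[mu2]_z (k (z.1 + a, z.2 + b)%R)%:E = \int[mu2]_z (k z)%:E)%E.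
Proof.
move=> mk kC kA.
have kint := box_integrable mk kC kA.
have mp : measurable_fun [set: R * R] (fun z : R * R => (z.1 + a, z.2 + b)).
  apply: measurable_fun_pair.
    by apply: measurable_funD; [exact: measurable_fst|exact: measurable_cst].
  by apply: measurable_funD; [exact: measurable_snd|exact: measurable_cst].
have mk' : measurable_fun [set: R * R] (fun z : R * R => k (z.1 + a, z.2 + b)).
  exact: (measurableT_comp mk mp).
have kint' : mu2.-integrable [set: R * R] (fun z => (k (z.1 + a, z.2 + b))%:E).
  apply: (@box_integrable _ (A + `|a| + `|b|) C) => // z zA; apply: kA => -[h1 h2]; apply: zA.
  move: h1 h2; rewrite /= !in_itv/= => /andP[h1 h2] /andP[h3 h4].
  have := ler_norm a; have := ler_norm (- a); have := ler_norm b; have := ler_norm (- b).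
  rewrite !normrN => *.
  by split; rewrite /= in_itv/=; apply/andP; split; lra.
rewrite -(integral12_prod_meas1 kint') -(integral12_prod_meas1 kint) /fubini_F/=.
rewrite -(@integral_shift (fun x => \int[mu]_t (k (x, t))%:E)%E a); last exact: (measurable_fubini_F kint).
apply: eq_integral => x _ /=.
rewrite (@integral_shift (fun t => (k (x + a, t))%:E) b)//.
apply/measurable_EFinP.
exact: (measurable_fun_pair2 (x + a) mk).
Qed.

End plane_integration.

(** * Test functions *)

Section test_functions.
Context {R : realType}.

Lemma derive1_near0 (w : R -> R) (x : R) : (\forall y \near x, w y = 0) ->
  derive1 w x = 0.
Proof.
move=> w0; rewrite derive1E (near_eq_derive (f := w) (g := cst 0))//.
exact: derive_cst.
Qed.

Lemma derivable_lip (w : R -> R) (C x y : R) : (forall z, derivable w z 1) ->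
  (forall z, `|derive1 w z| <= C) -> `|w x - w y| <= C * `|x - y|.
Proof.
move=> dw wC.
have H a b : a < b -> `|w b - w a| <= C * `|b - a|.
  move=> ab; have [z||c _ ->] := @MVT _ w (derive1 w) a b ab.
  - by move=> _; apply: DeriveDef; [exact: dw|rewrite derive1E].
  - by apply: derivable_within_continuous => z _; exact: dw.
  by rewrite normrM ler_wpM2r.
have [xy|yx|->] := ltgtP x y; last by rewrite !subrr normr0 mulr0.
  by rewrite distrC (distrC x); exact: H.
exact: H.
Qed.

Record test_bounds (phi : R -> R -> R) (A C : R) : Prop := {
  tb_A : 0 < A ;
  tb_C : 0 <= C ;
  tb_phi0 : forall x t, ~ box A (x, t) -> phi x t = 0 ;
  tb_dx0 : forall x t, ~ box A (x, t) -> derive1 (phi ^~ t) x = 0 ;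
  tb_dt0 : forall x t, ~ box A (x, t) -> derive1 (phi x) t = 0 ;
  tb_phi : forall x t, `|phi x t| <= C ;
  tb_dx : forall x t, `|derive1 (phi ^~ t) x| <= C ;
  tb_dt : forall x t, `|derive1 (phi x) t| <= C ;
  tb_lipx : forall x y t, `|phi x t - phi y t| <= C * `|x - y| ;
  tb_lipt : forall x s t, `|phi x s - phi x t| <= C * `|s - t| }.

Lemma boxP (A x t : R) : box A (x, t) <-> `|x| <= A /\ `|t| <= A.
Proof. by rewrite /box/= !in_itv/= !ler_norml. Qed.

Lemma continuous_box_bounded (k : R * R -> R) (A : R) : continuous k ->
  (forall z, ~ box A z -> k z = 0) -> exists C, forall z, `|k z| <= C.
Proof.
move=> ck k0.
have cb : compact (box A) by apply: compact_setX; exact: segment_compact.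
have : compact (k @` box A).
  by apply: continuous_compact => //; exact: continuous_subspaceT.
move=> /compact_bounded[M [_ MP]]; exists (`|M| + 1) => z.
have [zA|zA] := pselect (box A z); last by rewrite k0// normr0 addr_ge0.
apply: MP; last by exists z.
by rewrite (le_lt_trans (ler_norm _))// ltrDl.
Qed.

Lemma test_function_bounds (phi : R -> R -> R) : test_function phi ->
  exists A C, test_bounds phi A C.
Proof.
move=> [dphi cdx cdt cphi].
have [A A0 phi0] : exists2 A, 0 < A & forall x t, ~ box A (x, t) -> phi x t = 0.
  have [M [_ MP]] := compact_bounded cphi.
  exists (`|M| + 1); first by rewrite ltr_wpDl.
  move=> x t; apply: contra_notP => /eqP phi0; apply/boxP.
  have : `|(x, t)| <= `|M| + 1.
    apply: MP; first by rewrite (le_lt_trans (ler_norm _))// ltrDl.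
    exact: (@subset_closure _ [set z : R * R | phi z.1 z.2 != 0] (x, t)).
  by rewrite prod_normE/= ge_max => /andP[].
have nearx x t : ~ box A (x, t) -> \forall y \near x, phi y t = 0.
  move=> /boxP xA; have [tA|tA] := leP `|t| A; last first.
    by near=> y; apply: phi0 => /boxP[_]; rewrite leNgt tA.
  have Ax : A < `|x| by rewrite ltNge; apply/negP => xA'; apply: xA.
  near=> y; apply: phi0 => /boxP[+ _]; apply/negP; rewrite -ltNge.
  by near: y; apply: (cvgr_gt `|x|) => //; exact: (cvg_norm cvg_id).
have neart x t : ~ box A (x, t) -> \forall s \near t, phi x s = 0.
  move=> /boxP xA; have [tA|tA] := leP `|x| A; last first.
    by near=> y; apply: phi0 => /boxP[+ _]; rewrite leNgt tA.
  have Ax : A < `|t| by rewrite ltNge; apply/negP => xA'; apply: xA.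
  near=> y; apply: phi0 => /boxP[_]; apply/negP; rewrite -ltNge.
  by near: y; apply: (cvgr_gt `|t|) => //; exact: (cvg_norm cvg_id).
have dx0 x t : ~ box A (x, t) -> derive1 (phi ^~ t) x = 0.
  by move=> xA; apply: derive1_near0; exact: nearx.
have dt0 x t : ~ box A (x, t) -> derive1 (phi x) t = 0.
  by move=> xA; apply: derive1_near0; exact: neart.
have [C1 C1P] := continuous_box_bounded cdx (fun z => dx0 z.1 z.2).
have [C2 C2P] := continuous_box_bounded cdt (fun z => dt0 z.1 z.2).
pose C := Num.max C1 C2.
have dxC x t : `|derive1 (phi ^~ t) x| <= C.
  by rewrite (le_trans (C1P (x, t)))// le_max lexx.
have dtC x t : `|derive1 (phi x) t| <= C.
  by rewrite (le_trans (C2P (x, t)))// le_max lexx orbT.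
have C0 : 0 <= C by exact: le_trans (normr_ge0 _) (dxC 0 0).
have lipx x y t : `|phi x t - phi y t| <= C * `|x - y|.
  by apply: (@derivable_lip (phi ^~ t)) => // z; exact: (dphi z t).1.
have lipt x s t : `|phi x s - phi x t| <= C * `|s - t|.
  by apply: derivable_lip => // z; exact: (dphi x z).2.
(* A point of the box is at distance at most [2 * A + 1] from x = [A + 1], where [phi] vanishes; a
   factor of at least 1 also preserves the bounds on the derivatives. *)
have K1 : 1 <= 2 * A + 2 by lra.
have CK : C <= C * (2 * A + 2) by rewrite ler_peMr.
exists A, (C * (2 * A + 2)); split => //.
- by rewrite mulr_ge0//; lra.
- move=> x t; have [/boxP[xA tA]|xA] := pselect (box A (x, t)); last first.
    by rewrite phi0// normr0 (le_trans C0).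
  have := lipx x (A + 1) t; rewrite (phi0 (A + 1)); last first.
    by move=> /boxP[]; rewrite ger0_norm; lra.
  rewrite subr0 => /le_trans; apply; rewrite ler_wpM2l//.
  by move: xA; rewrite !ler_norml => /andP[h1 h2]; apply/andP; split; lra.
- by move=> x t; exact: le_trans CK.
- by move=> x t; exact: le_trans CK.
- by move=> x y t; apply: le_trans (lipx x y t) _; exact: ler_wpM2r.
- by move=> x y t; apply: le_trans (lipt x y t) _; exact: ler_wpM2r.
Unshelve. all: by end_near. Qed.

Lemma continuous_pairl (x : R) : continuous (fun t : R => (x, t)).
Proof.
move=> t U [[P Q] /= [Px Qt] PQU]; apply: filterS Qt => y Py; apply: PQU.
by split => //=; exact: nbhs_singleton Px.
Qed.

Lemma continuous_pairr (t : R) : continuous (fun x : R => (x, t)).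
Proof.
move=> x U [[P Q] /= [Px Qt] PQU]; apply: filterS Px => y Py; apply: PQU.
by split => //=; exact: nbhs_singleton Qt.
Qed.

Lemma test_function_continuous_dx (phi : R -> R -> R) : test_function phi ->
  (forall t, continuous (derive1 (phi ^~ t))) /\
  (forall x, continuous (fun t => derive1 (phi ^~ t) x)).
Proof.
move=> [_ cdx _ _]; split => [t x|x t].
  exact: (@continuous_comp _ _ _ (fun x : R => (x, t)) _ x (@continuous_pairr t x) (cdx _)).
exact: (@continuous_comp _ _ _ (fun s : R => (x, s)) _ t (@continuous_pairl x t) (cdx _)).
Qed.

Lemma test_function_continuous_dt (phi : R -> R -> R) : test_function phi ->
  (forall t, continuous (fun x => derive1 (phi x) t)) /\
  (forall x, continuous (derive1 (phi x))).
Proof.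
move=> [_ _ cdt _]; split => [t x|x t].
  exact: (@continuous_comp _ _ _ (fun x : R => (x, t)) _ x (@continuous_pairr t x) (cdt _)).
exact: (@continuous_comp _ _ _ (fun s : R => (x, s)) _ t (@continuous_pairl x t) (cdt _)).
Qed.

Lemma test_function_measurable (phi : R -> R -> R) : test_function phi ->
  [/\ measurable_fun [set: R * R] (fun z => phi z.1 z.2),
      measurable_fun [set: R * R] (fun z => derive1 (phi ^~ z.2) z.1) &
      measurable_fun [set: R * R] (fun z => derive1 (phi z.1) z.2)].
Proof.
move=> tphi; have [A [C AC]] := test_function_bounds tphi.
have [cx1 cx2] := test_function_continuous_dx tphi.
have [ct1 ct2] := test_function_continuous_dt tphi.
split.
- apply: measurable_separately_continuous => t.
    by apply: (@lip_continuous _ C) => x y; exact: (tb_lipx AC).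
  by apply: (@lip_continuous _ C) => x y; exact: (tb_lipt AC).
- exact: (@measurable_separately_continuous _ (fun x t => derive1 (phi ^~ t) x)).
- exact: (@measurable_separately_continuous _ (fun x t => derive1 (phi x) t)).
Qed.

Lemma backward_quotient_cvg (w : R -> R) (x : R) : derivable w x 1 ->
  n.+1%:R * (w x - w (x - n.+1%:R^-1)) @[n --> \oo] --> derive1 w x.
Proof.
move=> dw; apply/cvgrPdist_le => e e0; have [d d1 dP] := derivable_expansion dw e0.
have /cvgrPdist_lt/(_ d d1) := @cvg_invS0 R.
apply: filterS => n; rewrite sub0r => h; have {h} := dP _ h.
have n0 : 0 < n.+1%:R :> R by [].
rewrite normrN (@ger0_norm _ n.+1%:R^-1) ?invr_ge0// => hn.
rewrite -(ler_pM2r (_ : 0 < n.+1%:R^-1)) ?invr_gt0//.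
apply: le_trans hn.
rewrite -[X in _ * X <= _]gtr0_norm ?invr_gt0// -normrM.
rewrite le_eqVlt; apply/orP; left; apply/eqP; congr `|_|; field.
by rewrite gt_eqF.
Qed.

Lemma forward_quotient_cvg (w : R -> R) (x : R) : derivable w x 1 ->
  n.+1%:R * (w (x + n.+1%:R^-1) - w x) @[n --> \oo] --> derive1 w x.
Proof.
move=> dw; apply/cvgrPdist_le => e e0; have [d d1 dP] := derivable_expansion dw e0.
have /cvgrPdist_lt/(_ d d1) := @cvg_invS0 R.
apply: filterS => n; rewrite sub0r normrN => h; have {h} := dP _ h.
have n0 : 0 < n.+1%:R :> R by [].
rewrite (@ger0_norm _ n.+1%:R^-1) ?invr_ge0// => hn.
rewrite distrC -(ler_pM2r (_ : 0 < n.+1%:R^-1)) ?invr_gt0//.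
apply: le_trans hn.
rewrite -[X in _ * X <= _]gtr0_norm ?invr_gt0// -normrM.
by rewrite mulrBl mulrAC mulfV ?gt_eqF// mul1r (mulrC _ n.+1%:R^-1).
Qed.

End test_functions.

(** * The weak equation for the Hopf-Lax density *)

Section real_integrable.
Context d (T : measurableType d) (R : realType) (nu : {measure set T -> \bar R}).
Variables (D : set T) (mD : measurable D).
Implicit Types k : T -> R.

Lemma integrable_realD k1 k2 : nu.-integrable D (EFin \o k1) ->
  nu.-integrable D (EFin \o k2) -> nu.-integrable D (EFin \o (fun z => k1 z + k2 z)).
Proof. by move=> i1 i2; have := integrableD mD i1 i2; apply: eq_integrable. Qed.

Lemma integrable_realB k1 k2 : nu.-integrable D (EFin \o k1) ->
  nu.-integrable D (EFin \o k2) -> nu.-integrable D (EFin \o (fun z => k1 z - k2 z)).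
Proof. by move=> i1 i2; have := integrableB mD i1 i2; apply: eq_integrable. Qed.

Lemma integrable_realZ k (c : R) : nu.-integrable D (EFin \o k) ->
  nu.-integrable D (EFin \o (fun z => c * k z)).
Proof. by move=> i1; have := integrableZl mD c i1; apply: eq_integrable. Qed.

Lemma integral_real_EFin k : nu.-integrable D (EFin \o k) ->
  (\int[nu]_(z in D) (k z)%:E)%E = (\int[nu]_(z in D) k z)%:E.
Proof. by move=> ik; rewrite /Rintegral fineK//; exact: integrable_fin_num. Qed.

End real_integrable.

(** * Exchanging the two difference quotients *)

Section plane_identity.
Context {R : realType}.
Local Notation mu := (@lebesgue_measure R).
Local Notation mu2 := (mu \x mu)%E.
Variables (u r m phi : R -> R -> R) (L C : R).
Hypothesis ux : forall x y t, `|u x t - u y t| <= L * `|x - y|.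
Hypothesis ut : forall x s t, `|u x s - u x t| <= C * `|s - t|.
Hypothesis mr : measurable_fun [set: R * R] (fun z => r z.1 z.2).
Hypothesis mm : measurable_fun [set: R * R] (fun z => m z.1 z.2).
Hypothesis ur : {ae mu2, forall z, n.+1%:R * (u (z.1 + n.+1%:R^-1) z.2 - u z.1 z.2)
  @[n --> \oo] --> r z.1 z.2}.
Hypothesis um : {ae mu2, forall z, n.+1%:R * (u z.1 (z.2 + n.+1%:R^-1) - u z.1 z.2)
  @[n --> \oo] --> m z.1 z.2}.
Hypothesis tphi : test_function phi.

Lemma lip_plane_measurable : measurable_fun [set: R * R] (fun z => u z.1 z.2).
Proof.
apply: measurable_separately_continuous => t.
  by apply: (@lip_continuous _ L) => x y; exact: ux.
by apply: (@lip_continuous _ C) => x y; exact: ut.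
Qed.

Lemma measurable_plane_shift (k : R -> R -> R) (a b : R) :
  measurable_fun [set: R * R] (fun z => k z.1 z.2) ->
  measurable_fun [set: R * R] (fun z => k (z.1 + a) (z.2 + b)).
Proof.
move=> mk; have mp : measurable_fun [set: R * R] (fun z : R * R => (z.1 + a, z.2 + b)).
  apply: measurable_fun_pair.
    by apply: measurable_funD; [exact: measurable_fst|exact: measurable_cst].
  by apply: measurable_funD; [exact: measurable_snd|exact: measurable_cst].
exact: (measurableT_comp mk mp).
Qed.

(** Either double difference quotient expands into four such products, whose integrals depend only
    on the relative shifts [a - c] and [b - d]. *)
Let K a b c d (z : R * R) := u (z.1 + a) (z.2 + b) * phi (z.1 + c) (z.2 + d).

Lemma lip_test_bounds a b c d : exists B D,
  [/\ measurable_fun [set: R * R] (K a b c d), (forall z, `|K a b c d z| <= D) &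
   (forall z, ~ box B z -> K a b c d z = 0)].
Proof.
have [A [M AM]] := test_function_bounds tphi.
have L0 : 0 <= L by have := ux 0 1 0; rewrite sub0r normrN normr1 mulr1; exact: le_trans.
have C0 : 0 <= C by have := ut 0 0 1; rewrite sub0r normrN normr1 mulr1; exact: le_trans.
pose B := A + `|c| + `|d|.
pose D := `|u 0 0| + L * (B + `|a|) + C * (B + `|b|).
have D0 : 0 <= D.
  by rewrite /D /B !addr_ge0// ?mulr_ge0// ?addr_ge0// ltW// (tb_A AM).
have KB z : ~ box B z -> K a b c d z = 0.
  move: z => [x t] xtB; rewrite /K/= (tb_phi0 AM) ?mulr0//.
  move=> /boxP[h1 h2]; apply: xtB; apply/boxP; split.
    rewrite -[x](addrK c) (le_trans (ler_normB _ _))// /B.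
    by have := normr_ge0 d; lra.
  rewrite -[t](addrK d) (le_trans (ler_normB _ _))// /B.
  by have := normr_ge0 c; lra.
exists B, (D * M); split => //.
- apply: measurable_funM.
    exact: (measurable_plane_shift a b lip_plane_measurable).
  by have [mphi _ _] := test_function_measurable tphi; exact: (measurable_plane_shift c d mphi).
- move=> [x t]; have [/boxP[xB tB]|/KB ->] := pselect (box B (x, t)); last first.
    by rewrite normr0 mulr_ge0// (tb_C AM).
  rewrite normrM ler_pM//; last exact: (tb_phi AM).
  have h1 := ux (x + a) 0 (t + b); have h2 := ut 0 (t + b) 0.
  rewrite !subr0 in h1 h2.
  have h3 := ler_normD x a; have h4 := ler_normD t b.
  have h5 : L * `|x + a| <= L * (B + `|a|) by rewrite ler_wpM2l//; lra.
  have h6 : C * `|t + b| <= C * (B + `|b|) by rewrite ler_wpM2l//; lra.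
  have h7 := ler_normD (u (x + a) (t + b) - u 0 (t + b)) (u 0 (t + b) - u 0 0).
  have h8 := ler_normD (u (x + a) (t + b) - u 0 (t + b) + (u 0 (t + b) - u 0 0)) (u 0 0).
  rewrite addrA !subrK in h8; rewrite addrA subrK in h7.
  rewrite /D/=; lra.
Qed.

Lemma lip_test_integrable a b c d : mu2.-integrable [set: R * R] (EFin \o K a b c d).
Proof. by have [B [D [h1 h2 h3]]] := lip_test_bounds a b c d; exact: box_integrable h1 h2 h3. Qed.

Lemma lip_test_shift a b c d e f :
  \int[mu2]_z K (a + e) (b + f) (c + e) (d + f) z = \int[mu2]_z K a b c d z.
Proof.
have [B [D [h1 h2 h3]]] := lip_test_bounds a b c d.
rewrite /Rintegral -(box_integral_shift e f h1 h2 h3); congr fine.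
apply: eq_integral => z _; congr EFin.
by rewrite /K/= -!addrA !(addrC e, addrC f).
Qed.

(** Forward quotients fall on [u] and backward ones on [phi], so translation invariance turns the
    x-quotient of [u] times the t-quotient of [phi] into the same expression with x and t exchanged.
    Only one-sided time quotients of [u] and first derivatives of [phi] enter. *)
Lemma plane_identity :
  (\int[mu2]_z (r z.1 z.2 * derive1 (phi z.1) z.2)%:E =
   \int[mu2]_z (m z.1 z.2 * derive1 (phi ^~ z.2) z.1)%:E)%E.
Proof.
have [A [M AM]] := test_function_bounds tphi.
have [mphi mdx mdt] := test_function_measurable tphi.
have [dphi _ _ _] := tphi.
have L0 : 0 <= L by have := ux 0 1 0; rewrite sub0r normrN normr1 mulr1; exact: le_trans.
have C0 : 0 <= C by have := ut 0 0 1; rewrite sub0r normrN normr1 mulr1; exact: le_trans.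
pose h n : R := n.+1%:R^-1.
have h0 n : 0 < h n by rewrite invr_gt0.
have h1 n : h n <= 1 by rewrite invf_le1// ler1n.
have N1 n : n.+1%:R * h n = 1 by rewrite mulfV.
have quot n (x c d : R) : `|x| <= c * `|d| -> `|d| = h n -> `|n.+1%:R * x| <= c.
  move=> xc dh; rewrite normrM ger0_norm//; apply: (@le_trans _ _ (n.+1%:R * (c * h n))).
    by rewrite ler_pM2l// -dh.
  by rewrite mulrCA N1 mulr1.
pose a n z := n.+1%:R * (u (z.1 + h n) z.2 - u z.1 z.2) *
  (n.+1%:R * (phi z.1 z.2 - phi z.1 (z.2 - h n))).
pose b n z := n.+1%:R * (u z.1 (z.2 + h n) - u z.1 z.2) *
  (n.+1%:R * (phi z.1 z.2 - phi (z.1 - h n) z.2)).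
have mu_ := lip_plane_measurable.
have aE n z : a n z = n.+1%:R ^+ 2 *
    (K (h n) 0 0 0 z - K (h n) 0 0 (- h n) z - K 0 0 0 0 z + K 0 0 0 (- h n) z).
  by rewrite /a /K !addr0; ring.
have bE n z : b n z = n.+1%:R ^+ 2 *
    (K 0 (h n) 0 0 z - K 0 (h n) (- h n) 0 z - K 0 0 0 0 z + K 0 0 (- h n) 0 z).
  by rewrite /b /K !addr0; ring.
have Kint := lip_test_integrable.
have sum4 (k1 k2 k3 k4 : R * R -> R) (c : R) :
    mu2.-integrable [set: R * R] (EFin \o k1) -> mu2.-integrable [set: R * R] (EFin \o k2) ->
    mu2.-integrable [set: R * R] (EFin \o k3) -> mu2.-integrable [set: R * R] (EFin \o k4) ->
    (\int[mu2]_z (c * (k1 z - k2 z - k3 z + k4 z))%:E)%E =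
    (c * (\int[mu2]_z k1 z - \int[mu2]_z k2 z - \int[mu2]_z k3 z + \int[mu2]_z k4 z))%:E.
  move=> i1 i2 i3 i4.
  have i12 := integrable_realB measurableT i1 i2.
  have i123 := integrable_realB measurableT i12 i3.
  have i1234 := integrable_realD measurableT i123 i4.
  rewrite (integral_real_EFin measurableT (integrable_realZ measurableT c i1234)).
  by rewrite RintegralZl// RintegralD// RintegralB// RintegralB.
have mK e f i j : measurable_fun [set: R * R] (K e f i j).
  by have [? [? []]] := lip_test_bounds e f i j.
have measurable_sum4 (k1 k2 k3 k4 : R * R -> R) (c : R) :
    measurable_fun setT k1 -> measurable_fun setT k2 -> measurable_fun setT k3 ->
    measurable_fun setT k4 -> measurable_fun setT (fun z => c * (k1 z - k2 z - k3 z + k4 z)).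
  move=> m1 m2 m3 m4; apply: measurable_funM; first exact: measurable_cst.
  by apply: measurable_funD => //; apply: measurable_funB => //; exact: measurable_funB.
have abE n : (\int[mu2]_z (a n z)%:E = \int[mu2]_z (b n z)%:E)%E.
  under eq_integral do rewrite aE; under [RHS]eq_integral do rewrite bE.
  rewrite !sum4//; congr (_ * _)%:E.
  have -> : \int[mu2]_z K (h n) 0 0 0 z = \int[mu2]_z K 0 0 (- h n) 0 z.
    by rewrite -(lip_test_shift _ _ _ _ (- h n) 0) !addr0 subrr add0r.
  have -> : \int[mu2]_z K (h n) 0 0 (- h n) z = \int[mu2]_z K 0 (h n) (- h n) 0 z.
    by rewrite -(lip_test_shift _ _ _ _ (- h n) (h n)) subrr !add0r addNr.
  have -> : \int[mu2]_z K 0 0 0 (- h n) z = \int[mu2]_z K 0 (h n) 0 0 z.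
    by rewrite -(lip_test_shift _ _ _ _ 0 (h n)) !addr0 !add0r addNr.
  ring.
have aint : (\int[mu2]_z (a n z)%:E @[n --> \oo] -->
    \int[mu2]_z (r z.1 z.2 * derive1 (phi z.1) z.2)%:E)%E.
  apply: (@box_dominated_cvg _ _ _ (A + 1) (L * M)).
  - by move=> n; rewrite (funext (aE n)); exact: measurable_sum4.
  - exact: measurable_funM.
  - move=> n [x t]; rewrite /a/= normrM; apply: ler_pM => //.
      by apply: (quot _ _ _ _ (ux _ _ _)); rewrite addrAC subrr add0r gtr0_norm.
    by apply: (quot _ _ _ _ (tb_lipt AM _ _ _)); rewrite opprB addrC subrK gtr0_norm.
  - move=> n [x t] /boxP xA; rewrite /a/= !(tb_phi0 AM) ?subrr ?mulr0//.
      move=> /boxP[e f]; apply: xA; split; first by lra.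
      have := ler_normD (t - h n) (h n); rewrite subrK (gtr0_norm (h0 n)); have := h1 n; lra.
    by move=> /boxP[e f]; apply: xA; split; lra.
  - apply: aeS ur => -[x t]/= rz; apply: cvgM => //.
    exact: (backward_quotient_cvg ((dphi _ _).2)).
have bint : (\int[mu2]_z (b n z)%:E @[n --> \oo] -->
    \int[mu2]_z (m z.1 z.2 * derive1 (phi ^~ z.2) z.1)%:E)%E.
  apply: (@box_dominated_cvg _ _ _ (A + 1) (C * M)).
  - by move=> n; rewrite (funext (bE n)); exact: measurable_sum4.
  - exact: measurable_funM.
  - move=> n [x t]; rewrite /b/= normrM; apply: ler_pM => //.
      by apply: (quot _ _ _ _ (ut _ _ _)); rewrite addrAC subrr add0r gtr0_norm.
    by apply: (quot _ _ _ _ (tb_lipx AM _ _ _)); rewrite opprB addrC subrK gtr0_norm.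
  - move=> n [x t] /boxP xA; rewrite /b/= !(tb_phi0 AM) ?subrr ?mulr0//.
      move=> /boxP[e f]; apply: xA; split; last by lra.
      have := ler_normD (x - h n) (h n); rewrite subrK (gtr0_norm (h0 n)); have := h1 n; lra.
    by move=> /boxP[e f]; apply: xA; split; lra.
  - apply: aeS um => -[x t]/= rz; apply: cvgM => //.
    exact: (backward_quotient_cvg (w := phi ^~ t) ((dphi _ _).1)).
have abE' : (fun n => \int[mu2]_z (a n z)%:E)%E = (fun n => \int[mu2]_z (b n z)%:E)%E.
  by apply/funext.
rewrite abE' in aint.
exact: (cvg_unique (@ereal_hausdorff R) aint bint).
Qed.

End plane_identity.

Section initial_height.
Context {R : realType}.
Local Notation mu := (@lebesgue_measure R).
Variables (rho0 u0 : R -> R) (L : R).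
Hypothesis L0 : 0 <= L.
Hypothesis mrho0 : measurable_fun [set: R] rho0.
Hypothesis rho0L : forall x, 0 <= rho0 x <= L.
Hypothesis u0E : forall a b : R, a < b ->
  (u0 b - u0 a)%:E = (\int[mu]_(x in `[a, b]) (rho0 x)%:E)%E.

Lemma height_mono_lip : mono_lip L u0.
Proof.
move=> x y; rewrite le_eqVlt => /predU1P[->|xy]; first by rewrite !subrr mulr0 lexx.
apply/andP; split.
  rewrite -lee_fin u0E//; apply: integral_ge0 => z _.
  by rewrite lee_fin; have /andP[] := rho0L z.
rewrite -lee_fin u0E//; apply: (@le_trans _ _ (\int[mu]_(z in `[x, y]) (cst L%:E z))%E).
  apply: ge0_le_integral => //.
  - by move=> z _; rewrite lee_fin; have /andP[] := rho0L z.
  - by apply/measurable_EFinP; exact: (measurable_funS _ _ mrho0).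
  - by move=> z _; rewrite lee_fin; have /andP[] := rho0L z.
by rewrite integral_cst//= lebesgue_measure_itv/= lte_fin xy -EFinD -EFinM.
Qed.

Lemma bounded_itv_integrable (k : R -> R) (C : R) (I : interval R) :
  measurable_fun [set: R] k -> (forall x, `|k x| <= C) -> (mu [set` I] < +oo)%E ->
  mu.-integrable [set` I] (EFin \o k).
Proof.
move=> mk kC I0; apply: measurable_bounded_integrable => //.
- exact: (measurable_funS _ _ mk).
- by exists C; split; [exact: num_real|move=> M CM z _ /=; exact: le_trans (kC z) (ltW CM)].
Qed.

Lemma bounded_locally_integrable (k : R -> R) (C : R) :
  measurable_fun [set: R] k -> (forall x, `|k x| <= C) -> locally_integrable [set: R] k.
Proof.
move=> mk kC; split => //; first exact: openT.
move=> A _ cA; have C0 : 0 <= C := le_trans (normr_ge0 _) (kC 0).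
apply: (@le_lt_trans _ _ (\int[mu]_(x in A) (cst C%:E x))%E).
  apply: ge0_le_integral => //.
  - exact: compact_measurable.
  - apply/measurable_EFinP; apply: measurableT_comp => //.
    exact: (measurable_funS _ _ mk).
  - by move=> x _; rewrite lee_fin.
rewrite integral_cst//=; last exact: compact_measurable.
by rewrite lte_mul_pinfty//; exact: compact_finite_measure.
Qed.

Lemma height_derive1 : {ae mu, forall x, derive1 u0 x = rho0 x}.
Proof.
have rhoC x : `|rho0 x| <= L by rewrite ger0_norm; have /andP[] := rho0L x.
have /ae_foralln : forall n : nat, {ae mu, forall x, - n.+1%:R < x -> derive1 u0 x = rho0 x}.
  move=> n; have rint y : mu.-integrable [set` Interval (BLeft (- n.+1%:R)) (BRight y)] (EFin \o rho0).
    apply: (bounded_itv_integrable mrho0 rhoC).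
    by rewrite lebesgue_measure_itv/= -EFinD; case: ifP => _; rewrite ltry.
  have := FTC1 rint (bounded_locally_integrable mrho0 rhoC).
  apply: aeS => x /= + nx; rewrite lte_fin nx => /(_ isT)[dF F'].
  set F := (fun y => _) in dF F'.
  rewrite -F' derive1E derive1E; pose c := u0 (- n.+1%:R).
  have Fu : {near x, (fun y => F y + c) =1 u0}.
    near=> y; have ny : - n.+1%:R < y by near: y; exact: lt_nbhsr.
    by rewrite /F /Rintegral -u0E//= subrK.
  by rewrite -(near_eq_derive _ Fu)// (deriveD dF (derivable_cst _ _ _)) derive_cst addr0.
apply: aeS => x /(_ (Num.bound `|x|)); apply.
have := archi_boundP (normr_ge0 x); rewrite ltr_norml -natr1; lra.
Unshelve. all: by end_near. Qed.

End initial_height.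

(** * Measurability of the flux *)

Section flux_measurability.
Context {R : realType} (K : option nat) (g : R -> \bar R).
Hypothesis gP : shape_bounds K g.
Local Notation f := (flux g).

(** A sublevel set of the infimum is a countable union over rational velocities: a real witness q
    can be moved right to a rational, since [g] does not increase and the linear term grows by less
    than the slack left below c. *)
Lemma measurable_flux d (T : measurableType d) (k : T -> R) :
  measurable_fun [set: T] k ->
  (forall z, 0 <= k z /\ ((k z)%:E <= capacity R K)%E) ->
  measurable_fun [set: T] (fun z => f (k z)).
Proof.
move=> mk kK.
have H c : measurable [set z | f (k z) < c].
  rewrite (_ : [set z | _] = \bigcup_(r : rat)
      [set z | (g (ratr r) < +oo)%E /\ fine (g (ratr r)) + ratr r * k z < c]).
    apply: bigcupT_measurable_rat => r.
    have [gr|gr] := pselect (g (ratr r) < +oo)%E; last first.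
      by rewrite (_ : [set z | _] = set0)//; apply/seteqP; split => z //= -[].
    have m1 : measurable_fun [set: T] (fun z => fine (g (ratr r)) + ratr r * k z).
      by apply: measurable_funD => //; apply: measurable_funM.
    have := m1 measurableT `]-oo, c[%classic (measurable_itv _).
    rewrite setTI; congr measurable; apply/seteqP; split => z /=; rewrite in_itv//=.
    by move=> [].
  apply/seteqP; split => z /=; last first.
    move=> [r _ /= [gr]]; apply: le_lt_trans.
    by have [h1 h2] := kK z; rewrite mulrC; exact: (flux_le gP).
  have [k0 kC] := kK z; move=> fc.
  have [q gq qc] : exists2 q, (g q < +oo)%E & fine (g q) + k z * q < c.
    apply: contrapT => nq; move: fc; rewrite ltNge => /negP; apply.
    apply: (flux_ge gP) => // q gq; rewrite leNgt; apply/negP => qc; apply: nq.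
    by exists q.
  (* The slack is divided by [k z + 1], so that [k z * e] stays strictly below it. *)
  pose e := (c - (fine (g q) + k z * q)) / (k z + 1).
  have k1 : 0 < k z + 1 by rewrite ltr_wpDl.
  have e0 : 0 < e by rewrite divr_gt0// subr_gt0.
  have [r] := @rat_in_itvoo R q (q + e) ltac:(by rewrite ltrDl).
  rewrite in_itv/= => /andP[qr rqe]; exists r => //.
  split; first by apply: le_lt_trans gq; apply: (sb_noninc gP); exact: ltW.
  have := shape_real_noninc gP (ltW qr) gq.
  have : k z * ratr r <= k z * (q + e) by rewrite ler_wpM2l// ltW.
  have : (k z + 1) * e = c - (fine (g q) + k z * q) by rewrite mulrC divfK// gt_eqF.
  rewrite mulrDr mulrDl mul1r (mulrC (ratr r)); lra.
apply: (measurability (@RGenInftyO.G R)).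
  exact: RGenInftyO.measurableE.
by move=> _ [_ [c ->] <-]; rewrite setTI; have := H c; congr measurable; apply/seteqP; split => z /=; rewrite in_itv.
Qed.

End flux_measurability.

Section density_weak_solution.
Context {R : realType} (K : option nat) (g : R -> \bar R) (rho0 u0 : R -> R) (L : R).
Local Notation mu := (@lebesgue_measure R).
Local Notation mu2 := (mu \x mu)%E.
Hypothesis gP : shape_bounds K g.
Hypothesis L0 : 0 <= L.
Hypothesis LK : (L%:E <= capacity R K)%E.
Hypothesis mrho0 : measurable_fun [set: R] rho0.
Hypothesis rho0L : forall x, 0 <= rho0 x <= L.
Hypothesis u0E : forall a b : R, a < b ->
  (u0 b - u0 a)%:E = (\int[mu]_(x in `[a, b]) (rho0 x)%:E)%E.
Local Notation u := (hopf_lax g u0).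
Local Notation rho := (hopf_lax_density g u0).
Local Notation f := (flux g).
Local Notation G0 := (fine (g 0%R)).

Let u0L : mono_lip L u0 := height_mono_lip mrho0 rho0L u0E.

Lemma density_range x t : 0 <= rho x t <= L.
Proof. exact: (mono_lip_derive1 x L0 (hopf_lax_mono_lip gP L0 LK u0L t)). Qed.

Lemma density_capacity x t : 0 <= rho x t /\ ((rho x t)%:E <= capacity R K)%E.
Proof.
have /andP[r0 rL] := density_range x t; split => //.
by apply: le_trans LK; rewrite lee_fin.
Qed.

Lemma hopf_lax_xlip x y t : `|u x t - u y t| <= L * `|x - y|.
Proof. exact: (mono_lip_lip _ _ (hopf_lax_mono_lip gP L0 LK u0L t)). Qed.

Lemma hopf_lax_measurable : measurable_fun [set: R * R] (fun z => u z.1 z.2).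
Proof.
exact: (lip_plane_measurable hopf_lax_xlip (hopf_lax_time_lip gP L0 LK u0L)).
Qed.

Lemma density_measurable : measurable_fun [set: R * R] (fun z => rho z.1 z.2).
Proof.
apply: measurable_derive1.
- by move=> t; exact: mono_lip_continuous (hopf_lax_mono_lip gP L0 LK u0L t).
- exact: hopf_lax_measurable.
- by move=> z; exact: derive1_not_derivable.
Qed.

Lemma density_flux_measurable : measurable_fun [set: R * R] (fun z => f (rho z.1 z.2)).
Proof.
exact: (measurable_flux gP density_measurable (fun z => density_capacity z.1 z.2)).
Qed.

Lemma density_flux_range x t : 0 <= f (rho x t) <= G0.
Proof.
have [r0 rK] := density_capacity x t.
by rewrite (flux_ge0 gP)// (flux_bound gP).
Qed.

Lemma hopf_lax_derivable_ae : {ae mu2, forall z, derivable (u ^~ z.2) z.1 1}.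
Proof.
apply: ae_prod_ysection.
  apply: measurable_derivable; last exact: hopf_lax_measurable.
  by move=> t; exact: mono_lip_continuous (hopf_lax_mono_lip gP L0 LK u0L t).
by move=> t; exact: (mono_lip_derivable_ae (hopf_lax_mono_lip gP L0 LK u0L t)).
Qed.

Lemma hopf_lax_time_quotient x t : 0 <= t -> derivable (u ^~ t) x 1 ->
  n.+1%:R * (u x (t + n.+1%:R^-1) - u x t) @[n --> \oo] --> - f (rho x t).
Proof.
move=> t0 du; apply/cvgrPdist_le => e e0.
have [d d0 dP] := hopf_lax_right_derivative gP L0 LK u0L t0 du e0.
have /cvgrPdist_lt/(_ d d0) := @cvg_invS0 R.
apply: filterS => n; rewrite sub0r normrN.
have n0 : 0 < n.+1%:R^-1 :> R by rewrite invr_gt0.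
rewrite gtr0_norm// => /(dP _ n0) h.
rewrite -(ler_pM2r n0); apply: le_trans h.
rewrite -[X in _ * X <= _]gtr0_norm// -normrM -normrN.
by rewrite le_eqVlt; apply/orP; left; apply/eqP; congr `|_|; field; rewrite gt_eqF.
Qed.

(** For almost every x the height is differentiable in x at almost every time. Where the Lipschitz
    function [- u x] has a two-sided time derivative, this must equal its right derivative
    [f (rho x s)]. *)
Lemma density_flux_integral t : 0 <= t ->
  {ae mu, forall x, (\int[mu]_(s in `]0%R, t]) (f (rho x s))%:E = (u0 x - u x t)%:E)%E}.
Proof.
move=> t0; apply: aeS (ae_prod_xsection hopf_lax_derivable_ae) => x dx.
pose m s := f (rho x s).
have mm : measurable_fun [set: R] m.
  exact: (measurable_fun_pair2 x density_flux_measurable).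
rewrite (mono_lip_FTC (hopf_lax_time_mono_lip gP L0 LK u0L x) t0 mm).
  by rewrite (@hopf_lax_initial _ _ _ x 0)// opprK addrC.
apply: aeS dx => s /= du /andP[s0 st] dF.
have h1 := forward_quotient_cvg dF.
have h2 : (fun n => - (n.+1%:R * (u x (s + n.+1%:R^-1) - u x s))) @ \oo --> - - f (rho x s).
  by apply: cvgN; exact: (hopf_lax_time_quotient (ltW s0) du).
rewrite opprK in h2; apply: (cvg_unique (@Rhausdorff R) h2).
rewrite (_ : (fun n => - _) = fun n => n.+1%:R * (- u x (s + n.+1%:R^-1) - - u x s))//.
by apply/funext => n; ring.
Qed.

(** The right time derivative of [u] on the whole plane, [u] being frozen at [u0] for negative
    times. *)
Let m x t := if 0 <= t then - f (rho x t) else 0.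

Lemma time_slope_measurable : measurable_fun [set: R * R] (fun z => m z.1 z.2).
Proof.
rewrite (_ : (fun z => _) = (fun z : R * R => - f (rho z.1 z.2) *
    \1_(snd @^-1` `[0%R, +oo[%classic) z)).
  apply: measurable_funM.
    by apply: measurableT_comp => //; exact: density_flux_measurable.
  apply: measurable_indic; rewrite -[X in measurable X]setTI.
  exact: measurable_snd.
apply/funext => -[x t]; rewrite /m indicE/=; case: ifPn => t0.
  by rewrite mem_set ?mulr1//= in_itv/= t0.
by rewrite memNset ?mulr0//= in_itv/= (negbTE t0).
Qed.

Lemma density_plane_identity phi : test_function phi ->
  (\int[mu2]_z (rho z.1 z.2 * derive1 (phi z.1) z.2)%:E =
   \int[mu2]_z (m z.1 z.2 * derive1 (phi ^~ z.2) z.1)%:E)%E.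
Proof.
move=> tphi; apply: (plane_identity hopf_lax_xlip (hopf_lax_time_lip gP L0 LK u0L)) => //.
- exact: density_measurable.
- exact: time_slope_measurable.
- apply: aeS hopf_lax_derivable_ae => -[x t]/= du.
  exact: (forward_quotient_cvg (w := u ^~ t)).
- apply: aeS hopf_lax_derivable_ae => -[x t]/= du; rewrite /m.
  case: ifPn => [t0|]; first exact: hopf_lax_time_quotient.
  rewrite -ltNge => t0; apply: cvg_near_cst.
  have tN : 0 < - t by rewrite oppr_gt0.
  have /cvgrPdist_lt/(_ _ tN) := @cvg_invS0 R.
  apply: filterS => n; rewrite sub0r normrN gtr0_norm ?invr_gt0// => nt.
  rewrite !hopf_lax_initial ?subrr ?mulr0//; first exact: ltW.
  by rewrite -lerBrDl sub0r ltW.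
Qed.

Lemma test_function_FTC phi (x c A M : R) : test_function phi -> test_bounds phi A M ->
  (\int[mu]_(t in `[(- A - 1)%R, 0%R]) (c * derive1 (phi x) t)%:E = (c * phi x 0)%:E)%E.
Proof.
move=> tphi AM; have [dphi _ _ _] := tphi; have A0 := tb_A AM.
have dF (t : R) : derivable (fun t => c * phi x t) t 1.
  by apply: derivableM; [exact: derivable_cst|exact: (dphi x t).2].
have cF : continuous (fun t => c * phi x t).
  move=> t; apply: differentiable_continuous; exact/derivable1_diffP.
rewrite (@continuous_FTC2 _ _ (fun t => c * phi x t)).
- rewrite (tb_phi0 AM (t := - A - 1)) ?mulr0 ?sube0//.
  by move=> /boxP[_]; rewrite ler_norml; lra.
- lra.
- apply: continuous_subspaceT => t; apply: cvgM; first exact: cvg_cst.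
  exact: (test_function_continuous_dt tphi).2.
- split; first by move=> t _; exact: dF.
  + by apply: cvg_at_right_filter; exact: cF.
  + by apply: cvg_at_left_filter; exact: cF.
- move=> t _; rewrite derive1E (deriveM (derivable_cst _ _ _)); last exact: (dphi x t).2.
  by rewrite derive_cst scaler0 addr0 derive1E.
Qed.

Lemma initial_slopeE : derive1 u0 = rho ^~ 0.
Proof.
apply/funext => x; rewrite /hopf_lax_density; congr derive1.
by apply/funext => y; rewrite hopf_lax_initial.
Qed.

Lemma initial_slope_measurable : measurable_fun [set: R] (derive1 u0).
Proof. rewrite initial_slopeE; exact: (measurable_fun_pair1 (0 : R) density_measurable). Qed.

(** For t <= 0 the density [derive1 u0] does not depend on time and equals [rho0] almost everywhere.
    Only [phi_t] is integrated in time, from below the support of [phi] up to 0, and this produces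
    the initial term. *)
Lemma negative_time_integral phi : test_function phi ->
  (\int[mu]_(t in `]-oo, 0%R]) \int[mu]_x (derive1 u0 x * derive1 (phi x) t)%:E =
   \int[mu]_x (rho0 x * phi x 0)%:E)%E.
Proof.
move=> tphi; have [A [M AM]] := test_function_bounds tphi.
have [mphi mdx mdt] := test_function_measurable tphi.
have A0 := tb_A AM.
pose k (z : R * R) := rho0 z.1 * derive1 (phi z.1) z.2 * \1_(`[- A - 1, 0]%classic) z.2.
have kint : mu2.-integrable [set: R * R] (EFin \o k).
  apply: (@box_integrable _ _ A (L * M)).
  - apply: measurable_funM.
      apply: measurable_funM => //.
      exact: (measurableT_comp mrho0 (measurable_fst)).
    apply: (measurableT_comp _ (measurable_snd)).
    by apply: measurable_indic; exact: measurable_itv.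
  - move=> [x t]; rewrite /k/= normrM.
    have i1 : `|\1_(`[- A - 1, 0]%classic) t : R| <= 1.
      by rewrite indicE; case: (_ \in _); rewrite ?normr1 ?normr0.
    rewrite -[leRHS]mulr1; apply: ler_pM => //; rewrite normrM; apply: ler_pM => //.
      by have /andP[h1 h2] := rho0L x; rewrite ger0_norm.
    exact: (tb_dt AM).
  - by move=> [x t] xtA; rewrite /k/= (tb_dt0 AM)// mulr0 mul0r.
have mr0 := initial_slope_measurable.
have [ct1 ct2] := test_function_continuous_dt tphi.
transitivity (\int[mu]_t \int[mu]_x (k (x, t))%:E)%E.
  rewrite integral_mkcond; apply: eq_integral => t _; rewrite patchE.
  case: ifPn; rewrite ?inE ?notin_setE /= in_itv/= => t0.
    apply: ae_eq_integral => //.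
    - apply/measurable_EFinP; apply: measurable_funM => //.
      by apply: continuous_measurable_fun; exact: ct1.
    - exact: (measurable_fun_pair1 (t : R) (measurable_int _ kint)).
    apply: aeS (height_derive1 mrho0 rho0L u0E) => x -> _; congr EFin; rewrite /k/=.
    have [tA|tA] := leP (- A - 1) t.
      by rewrite indicE mem_set ?mulr1//= in_itv/= tA.
    rewrite (tb_dt0 AM) ?mulr0 ?mul0r// => /boxP[_]; rewrite ler_norml; lra.
  rewrite (_ : point = 0%E)// -[LHS](@integral0 _ _ _ mu setT); apply: eq_integral => x _.
  rewrite /k/= indicE memNset ?mulr0//= in_itv/= => /andP[_].
  exact: t0.
rewrite -(Fubini kint); apply: eq_integral => x _.
rewrite -(test_function_FTC x (rho0 x) tphi AM) [RHS]integral_mkcond.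
apply: eq_integral => t _; rewrite patchE /k/= indicE.
by case: ifP => tI; rewrite ?mulr1 ?mulr0.
Qed.

Lemma density_weak_identity phi : test_function phi ->
  ((\int[mu]_(t in `]0%R, +oo[) \int[mu]_x
       (rho x t * derive1 (phi x) t + f (rho x t) * derive1 (phi ^~ t) x)%:E)
     + \int[mu]_x (rho0 x * phi x 0)%:E = 0)%E.
Proof.
move=> tphi; have [A [M AM]] := test_function_bounds tphi.
have [mphi mdx mdt] := test_function_measurable tphi.
have mG x t : `|m x t| <= G0.
  have /andP[f0 fG] := density_flux_range x t.
  rewrite /m; case: ifP => _; first by rewrite normrN ger0_norm.
  by rewrite normr0 (le_trans f0).
pose a (z : R * R) := rho z.1 z.2 * derive1 (phi z.1) z.2.
pose b (z : R * R) := m z.1 z.2 * derive1 (phi ^~ z.2) z.1.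
have mm : measurable_fun [set: R * R] (fun z => m z.1 z.2) by exact: time_slope_measurable.
have ia : mu2.-integrable [set: R * R] (EFin \o a).
  apply: (@box_integrable _ _ A (L * M)).
  - by apply: measurable_funM => //; exact: density_measurable.
  - move=> z; rewrite /a normrM; apply: ler_pM => //; last exact: (tb_dt AM).
    by have /andP[h1 h2] := density_range z.1 z.2; rewrite ger0_norm.
  - by move=> [x t] xA; rewrite /a/= (tb_dt0 AM)// mulr0.
have ib : mu2.-integrable [set: R * R] (EFin \o b).
  apply: (@box_integrable _ _ A (G0 * M)).
  - exact: measurable_funM.
  - move=> z; rewrite /b normrM; apply: ler_pM => //; exact: (tb_dx AM).
  - by move=> [x t] xA; rewrite /b/= (tb_dx0 AM)// mulr0.
have ik := integrable_realB measurableT ia ib.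
have k0 : (\int[mu2]_z (a z - b z)%:E = 0)%E.
  rewrite (integral_real_EFin measurableT ik) RintegralB//.
  by rewrite /Rintegral (density_plane_identity tphi) subrr.
have := integral21_prod_meas1 ik; rewrite k0.
set I := fubini_G _ _ => I0.
have mI : measurable_fun [set: R] I := measurable_fubini_G ik.
(* The integral over the plane is 0. Its upper half is the required space-time term, so the lower
   half has to be identified with the initial term. *)
have UT : [set: R] = `]0, +oo[%classic `|` `]-oo, 0]%classic.
  apply/seteqP; split => t //= _; rewrite !in_itv/= andbT.
  by have [h|h] := leP t 0; [right|left].
have I0' : (\int[mu]_(t in `]0%R, +oo[ `|` `]-oo, 0%R]) I t = 0)%E by rewrite -UT.
rewrite integral_setU// in I0'; last 2 first.
  by rewrite -UT.
  apply/disj_set2P; apply/seteqP; split => t //=; rewrite !in_itv/= andbT.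
  by move=> [h1 h2]; move: h1; rewrite ltNge h2.
rewrite -[RHS]I0'; congr (_ + _)%E.
  apply: eq_integral => t; rewrite inE/= in_itv/= andbT => t0.
  apply: eq_integral => x _; rewrite /a /b/= /m (ltW t0); congr EFin; ring.
pose c (z : R * R) := derive1 u0 z.1 * derive1 (phi z.1) z.2.
have ic : mu2.-integrable [set: R * R] (EFin \o c).
  apply: (@box_integrable _ _ A (L * M)).
  - apply: measurable_funM => //.
    exact: (measurableT_comp initial_slope_measurable (measurable_fst)).
  - move=> z; rewrite /c normrM; apply: ler_pM => //; last exact: (tb_dt AM).
    rewrite initial_slopeE.
    by have /andP[h1 h2] := density_range z.1 0; rewrite ger0_norm.
  - by move=> [x t] xA; rewrite /c/= (tb_dt0 AM)// mulr0.
rewrite -negative_time_integral//; apply: ae_eq_integral => //.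
- exact: (measurable_funS _ _ (measurable_fubini_G ic)).
- exact: (measurable_funS _ _ mI).
(* At t = 0 the slope [m] is [- f (rho x 0)] instead of 0, so this single time is discarded as a
   null set. *)
have : {ae mu, forall t : R, t != 0}.
  exists [set 0]; split => //; first exact: lebesgue_measure_set1.
  by move=> t /= /negP; rewrite negbK => /eqP.
apply: aeS => t t0; rewrite /= in_itv/= => tle0.
have {t0 tle0}t0 : t < 0 by rewrite lt_neqAle t0.
apply: eq_integral => x _; rewrite /a /b/= /m (lt_geF t0) mul0r subr0.
congr (_ * _)%:E; rewrite /hopf_lax_density; congr derive1.
by apply/funext => y; rewrite hopf_lax_initial// ltW.
Qed.

Lemma density_is_weak_solution : weak_solution K f rho0 rho.
Proof.
split.
- exact: (measurable_funS _ _ density_measurable).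
- by move=> x t _; exact: density_capacity.
- move=> x t _; exists L; split; first exact: num_real.
  move=> M LM; near=> z.
  by have /andP[r0 rL] := density_range z.1 z.2; rewrite /= ger0_norm// (le_trans rL)// ltW.
- exact: density_weak_identity.
Unshelve. all: by end_near. Qed.

End density_weak_solution.

(** * Bump functions *)

Section bumps.
Context {R : realType}.
Implicit Types (w : R -> R) (a b d x y : R).

Lemma quadratic_is_derive w x (l C : R) :
  (forall k, `|w (x + k) - w x - k * l| <= C * k ^+ 2) -> is_derive x 1 w l.
Proof.
move=> wC.
have C0 : 0 <= C by have := wC 1; rewrite expr1n mulr1; exact: le_trans.
have cv : (fun h : R => h^-1 *: ((w \o shift x) (h *: 1) - w x)) @ 0^' --> l.
  apply/cvgrPdist_le => e e0.
  exists (e / (C + 1)) => /=; first by rewrite divr_gt0// ltr_wpDl.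
  move=> k; rewrite /= sub0r normrN => kd k0; rewrite scaler1 /GRing.scale/=.
  have -> : l - k^-1 * (w (k + x) - w x) = - k^-1 * (w (x + k) - w x - k * l).
    by rewrite (addrC k); field.
  rewrite normrM normrN normfV ler_pdivrMl ?normr_gt0//.
  apply: le_trans (wC k) _; rewrite -[k ^+ 2]ger0_norm ?sqr_ge0// expr2 normrM mulrCA.
  rewrite ler_wpM2l//.
  have : (C + 1) * `|k| <= e by rewrite mulrC -ler_pdivlMr ?ltr_wpDl// ltW.
  by have := normr_ge0 k; lra.
apply: DeriveDef; first by apply/cvg_ex; exists l.
by apply/cvg_lim => //; exact: Rhausdorff.
Qed.

Definition pos_part x := Num.max x 0.

Lemma pos_part_lip x y : `|pos_part x - pos_part y| <= 1 * `|x - y|.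
Proof.
rewrite /pos_part mul1r; have [x0|x0] := leP x 0; have [y0|y0] := leP y 0.
- by rewrite subrr normr0.
- rewrite sub0r normrN gtr0_norm// distrC (le_trans _ (ler_norm _))//; lra.
- by rewrite subr0 gtr0_norm// (le_trans _ (ler_norm _))//; lra.
- by [].
Qed.

(** A remainder of at most k^2 in all four sign cases yields the derivative at the corner 0 along
    with all other points. *)
Lemma is_derive_pos_part_sqr x :
  is_derive x 1 (fun x => pos_part x ^+ 2 / 2) (pos_part x).
Proof.
apply: (@quadratic_is_derive _ _ _ 1) => k; rewrite mul1r ler_norml /pos_part.
have [x0|x0] := leP x 0; have [xk|xk] := leP (x + k) 0; apply/andP; split.
- by rewrite expr0n/=; have := sqr_ge0 k; lra.
- by rewrite expr0n/=; have := sqr_ge0 k; lra.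
- by rewrite expr0n/=; have := sqr_ge0 k; have := sqr_ge0 (x + k); lra.
- by rewrite expr0n/=; nra.
- by rewrite expr0n/=; nra.
- by rewrite expr0n/=; nra.
- by nra.
- by nra.
Qed.

(** For d > 0, [ramp d] climbs linearly from 0 to 1 on [0, d]; [trap a b d] is a trapezoid supported
    in [a, b + d] and equal to 1 on [a + d, b]; [smooth_step d] is a C^1 step on [0, 2 d]. The
    suffix [_prim] marks the primitive that vanishes on the far left. *)
Definition ramp d y := d^-1 * (pos_part y - pos_part (y - d)).
Definition ramp_prim d y := d^-1 * (pos_part y ^+ 2 / 2 - pos_part (y - d) ^+ 2 / 2).
Definition trap a b d x := ramp d (x - a) - ramp d (x - b).
Definition trap_prim a b d x := ramp_prim d (x - a) - ramp_prim d (x - b).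
Definition smooth_step d y := d^-1 * (ramp_prim d y - ramp_prim d (y - d)).

Lemma continuous_pos_part : continuous pos_part.
Proof. by apply: lip_continuous => x y; exact: pos_part_lip. Qed.

Lemma pos_part_le0 x : x <= 0 -> pos_part x = 0.
Proof. by move=> x0; rewrite /pos_part max_r. Qed.

Lemma pos_part_ge0 x : 0 <= x -> pos_part x = x.
Proof. by move=> x0; rewrite /pos_part max_l. Qed.

Lemma pos_part_mono : {homo pos_part : x y / x <= y}.
Proof. by move=> x y xy; rewrite /pos_part le_max2. Qed.

Lemma ramp0 d y : 0 < d -> y <= 0 -> ramp d y = 0.
Proof. by move=> d0 y0; rewrite /ramp !pos_part_le0 ?subrr ?mulr0//; lra. Qed.

Lemma ramp1 d y : 0 < d -> d <= y -> ramp d y = 1.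
Proof.
move=> d0 dy; rewrite /ramp !pos_part_ge0; [|lra|lra].
by rewrite opprB addrCA subrr addr0 mulVf// gt_eqF.
Qed.

Lemma ramp_ge0 d y : 0 < d -> 0 <= ramp d y.
Proof.
move=> d0; rewrite /ramp mulr_ge0 ?invr_ge0 ?(ltW d0)// subr_ge0.
by apply: pos_part_mono; lra.
Qed.

Lemma ramp_le1 d y : 0 < d -> ramp d y <= 1.
Proof.
move=> d0; rewrite /ramp ler_pdivrMl// mulr1.
have := pos_part_lip y (y - d); have -> : y - (y - d) = d by ring.
by rewrite mul1r (gtr0_norm d0); apply: le_trans; exact: ler_norm.
Qed.

Lemma ramp_mono d : 0 < d -> {homo ramp d : x y / x <= y}.
Proof.
move=> d0 x y xy.
have [y0|y0] := leP y 0; first by rewrite !ramp0//; exact: le_trans y0.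
have [x0|x0] := leP x 0; first by rewrite (ramp0 d0 x0) ramp_ge0.
have [yd|yd] := leP d y; first by rewrite (ramp1 d0 yd) ramp_le1.
rewrite /ramp ler_pM2l ?invr_gt0// (pos_part_ge0 (ltW x0)) (pos_part_ge0 (ltW y0)).
by rewrite !pos_part_le0; lra.
Qed.

Lemma continuous_ramp d : continuous (ramp d).
Proof.
move=> y; apply: cvgM; first exact: cvg_cst.
apply: cvgB; first exact: continuous_pos_part.
apply: (@continuous_cvg _ _ _ _ _ (fun y => y - d) pos_part); first exact: continuous_pos_part.
by apply: cvgB; [exact: cvg_id|exact: cvg_cst].
Qed.

Lemma continuous_translate w a : continuous w -> continuous (fun x => w (x - a)).
Proof.
move=> cw x; apply: (@continuous_cvg _ _ _ _ _ (fun y => y - a) w); first exact: cw.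
by apply: cvgB; [exact: cvg_id|exact: cvg_cst].
Qed.

Lemma is_derive_translate w (w' : R -> R) a x : (forall x, is_derive x 1 w (w' x)) ->
  is_derive x 1 (fun x => w (x - a)) (w' (x - a)).
Proof.
move=> dw; have h : is_derive x 1 (fun x : R => x - a) 1.
  by rewrite -[X in is_derive _ _ _ X]subr0; exact: is_deriveB.
have := @is_derive1_comp _ w (fun x => x - a) x _ _ (dw (x - a)) h.
by rewrite mulr1.
Qed.

Lemma is_derive_ramp_prim d y : is_derive y 1 (ramp_prim d) (ramp d y).
Proof.
have h1 := is_derive_pos_part_sqr y.
have h2 := is_derive_translate d y is_derive_pos_part_sqr.
exact: (is_deriveZ d^-1 (is_deriveB h1 h2)).
Qed.

Lemma ramp_prim0 d y : 0 < d -> y <= 0 -> ramp_prim d y = 0.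
Proof.
by move=> d0 y0; rewrite /ramp_prim !pos_part_le0 ?expr0n/= ?mul0r ?subrr ?mulr0//; lra.
Qed.

Lemma ramp_primE d y : 0 < d -> d <= y -> ramp_prim d y = y - d / 2.
Proof.
move=> d0 dy; rewrite /ramp_prim !pos_part_ge0; [|lra|lra].
by field; rewrite gt_eqF.
Qed.

Lemma ramp_prim_lip d x y : 0 < d -> `|ramp_prim d x - ramp_prim d y| <= 1 * `|x - y|.
Proof.
move=> d0; apply: derivable_lip => z; first by have [] := is_derive_ramp_prim d z.
have h := is_derive_ramp_prim d z; rewrite derive1E derive_val.
by rewrite ger0_norm ?ramp_ge0// ramp_le1.
Qed.

Lemma is_derive_trap_prim a b d x : is_derive x 1 (trap_prim a b d) (trap a b d x).
Proof.
exact: (is_deriveB (is_derive_translate a x (is_derive_ramp_prim d))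
  (is_derive_translate b x (is_derive_ramp_prim d))).
Qed.

Lemma continuous_trap a b d : continuous (trap a b d).
Proof.
by move=> x; apply: cvgB; exact: continuous_translate (@continuous_ramp d) _.
Qed.

Lemma trap_ge0 a b d x : 0 < d -> a <= b -> 0 <= trap a b d x.
Proof. by move=> d0 ab; rewrite subr_ge0; apply: ramp_mono => //; lra. Qed.

Lemma trap_le1 a b d x : 0 < d -> trap a b d x <= 1.
Proof.
by move=> d0; have := ramp_le1 (x - a) d0; have := ramp_ge0 (x - b) d0; rewrite /trap; lra.
Qed.

Lemma trap_left a b d x : 0 < d -> a <= b -> x <= a -> trap a b d x = 0.
Proof. by move=> d0 ab xa; rewrite /trap !ramp0 ?subrr//; lra. Qed.

Lemma trap_right a b d x : 0 < d -> a <= b -> b + d <= x -> trap a b d x = 0.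
Proof. by move=> d0 ab bx; rewrite /trap !ramp1 ?subrr//; lra. Qed.

Lemma trap_mid a b d x : 0 < d -> a + d <= x -> x <= b -> trap a b d x = 1.
Proof. by move=> d0 ax xb; rewrite /trap ramp1 ?ramp0 ?subr0//; lra. Qed.

Lemma trap_prim_left a b d x : 0 < d -> a <= b -> x <= a -> trap_prim a b d x = 0.
Proof. by move=> d0 ab xa; rewrite /trap_prim !ramp_prim0 ?subrr//; lra. Qed.

Lemma trap_prim_right a b d x : 0 < d -> a <= b -> b + d <= x ->
  trap_prim a b d x = b - a.
Proof. by move=> d0 ab bx; rewrite /trap_prim !ramp_primE; lra. Qed.

Lemma is_derive_smooth_step d y :
  is_derive y 1 (smooth_step d) (d^-1 * (ramp d y - ramp d (y - d))).
Proof.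
have h2 := is_derive_translate d y (is_derive_ramp_prim d).
exact: (is_deriveZ d^-1 (is_deriveB (is_derive_ramp_prim d y) h2)).
Qed.

Lemma smooth_step0 d y : 0 < d -> y <= 0 -> smooth_step d y = 0.
Proof. by move=> d0 y0; rewrite /smooth_step !ramp_prim0 ?subrr ?mulr0//; lra. Qed.

Lemma smooth_step1 d y : 0 < d -> 2 * d <= y -> smooth_step d y = 1.
Proof.
move=> d0 dy; rewrite /smooth_step !ramp_primE; [|lra|lra|lra|lra].
by field; rewrite gt_eqF.
Qed.

Lemma smooth_step_norm d y : 0 < d -> `|smooth_step d y| <= 1.
Proof.
move=> d0; rewrite /smooth_step normrM gtr0_norm ?invr_gt0// ler_pdivrMl// mulr1.
have := ramp_prim_lip y (y - d) d0; have -> : y - (y - d) = d by ring.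
by rewrite mul1r (gtr0_norm d0).
Qed.

Lemma continuous_smooth_step_deriv d :
  continuous (fun y => d^-1 * (ramp d y - ramp d (y - d))).
Proof.
move=> y; apply: cvgM; first exact: cvg_cst.
by apply: cvgB; [exact: continuous_ramp|exact: continuous_translate (@continuous_ramp d) _].
Qed.

(** At a fixed x the sequence is eventually constant. The rise starts at a and the descent starts at
    b, so the limiting interval excludes a and includes b. *)
Lemma trap_cvg a b x : a <= b ->
  trap a b n.+1%:R^-1 x @[n --> \oo] --> (\1_(`]a, b]%classic) x : R).
Proof.
move=> ab; apply: cvg_near_cst.
have H (e : R) : 0 < e -> \forall n \near \oo, n.+1%:R^-1 < e.
  move=> e0; have /cvgrPdist_lt/(_ e e0) := @cvg_invS0 R.
  by apply: filterS => n; rewrite sub0r normrN ger0_norm.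
have n0 n : 0 < n.+1%:R^-1 :> R by rewrite invr_gt0.
have [xa|ax] := leP x a.
  apply: nearW => n; rewrite trap_left// indicE memNset//= in_itv/= => /andP[].
  by rewrite ltNge xa.
have [xb|bx] := leP x b.
  have xa0 : 0 < x - a by lra.
  apply: filterS (H _ xa0) => n; have := n0 n; move: (n.+1%:R^-1 : R) => e e0 nx.
  by rewrite trap_mid//; [rewrite indicE mem_set//= in_itv/= ax|lra].
have xb0 : 0 < x - b by lra.
apply: filterS (H _ xb0) => n; have := n0 n; move: (n.+1%:R^-1 : R) => e e0 nx.
rewrite trap_right//; last lra.
by rewrite indicE memNset//= in_itv/= => /andP[_]; rewrite leNgt bx.
Qed.

Lemma smooth_step_cvg y :
  smooth_step n.+1%:R^-1 y @[n --> \oo] --> (\1_(`]0, +oo[%classic) y : R).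
Proof.
apply: cvg_near_cst.
have n0 n : 0 < n.+1%:R^-1 :> R by rewrite invr_gt0.
have [y0|y0] := leP y 0.
  apply: nearW => n; rewrite smooth_step0// indicE memNset//= in_itv/= andbT.
  by apply/negP; rewrite -leNgt.
have y20 : 0 < y / 2 by lra.
have /cvgrPdist_lt/(_ _ y20) := @cvg_invS0 R.
apply: filterS => n; rewrite sub0r normrN ger0_norm ?invr_ge0//.
have := n0 n; move: (n.+1%:R^-1 : R) => e e0 ny; have ny2 : 2 * e <= y by lra.
rewrite smooth_step1//.
by rewrite indicE mem_set//= in_itv/= andbT.
Qed.

Lemma compact_support_box (phi : R -> R -> R) (A : R) :
  (forall x t, ~ box A (x, t) -> phi x t = 0) ->
  compact (closure [set z : R * R | phi z.1 z.2 != 0]).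
Proof.
move=> phi0; have cb : compact (box A) by apply: compact_setX; exact: segment_compact.
apply: (subclosed_compact (@closed_closure _ _) cb).
have clb : closed (box A) by apply: compact_closed => //; exact: norm_hausdorff.
rewrite [X in _ `<=` X](closure_id _).1//; apply: closureS => -[x t] /= h.
by apply: contrapT => /phi0 h'; rewrite h' eqxx in h.
Qed.

End bumps.

(** * Sheared and product test functions *)

Section test_function_constructions.
Context {R : realType}.
Implicit Types (H eta psi dpsi tau dtau : R -> R) (q A c d e s : R).

Lemma is_derive_derive1 H (x l : R) : is_derive x 1 H l -> derive1 H x = l.
Proof. by move=> h; rewrite derive1E derive_val. Qed.

Lemma is_derive_continuous H eta : (forall x : R, is_derive x 1 H (eta x)) -> continuous H.
Proof.
move=> dH x; apply: differentiable_continuous; apply/derivable1_diffP.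
by have [] := dH x.
Qed.

Lemma continuous_comp_fst eta : continuous eta -> continuous (fun z : R * R => eta z.1).
Proof.
by move=> ce z; apply: (@continuous_cvg _ _ _ _ _ fst eta); [exact: ce|exact: cvg_fst].
Qed.

Lemma continuous_comp_snd eta : continuous eta -> continuous (fun z : R * R => eta z.2).
Proof.
by move=> ce z; apply: (@continuous_cvg _ _ _ _ _ snd eta); [exact: ce|exact: cvg_snd].
Qed.

Lemma is_derive_shear H eta (a x : R) : (forall x : R, is_derive x 1 H (eta x)) ->
  is_derive x 1 (fun y => H (y + a) - H y) (eta (x + a) - eta x).
Proof.
move=> dH; have := is_derive_translate (- a) x dH.
rewrite opprK => h.
exact: (is_deriveB h (dH x)).
Qed.

Lemma is_derive_shear_time H eta tau dtau q (x s : R) :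
  (forall x : R, is_derive x 1 H (eta x)) -> (forall s : R, is_derive s 1 tau (dtau s)) ->
  is_derive s 1 (fun s => H (x + q * tau s) - H x) (eta (x + q * tau s) * (q * dtau s)).
Proof.
move=> dH dt.
have h1 : is_derive s 1 (fun s => x + q * tau s) (q * dtau s).
  rewrite -[X in is_derive _ _ _ X]add0r.
  exact: (is_deriveD (is_derive_cst x s 1) (is_deriveZ q (dt s))).
have h2 := @is_derive1_comp _ H (fun s => x + q * tau s) s _ _ (dH _) h1.
rewrite -[X in is_derive _ _ _ X]subr0.
exact: (is_deriveB h2 (is_derive_cst (H x) s 1)).
Qed.

(** A primitive [H] of a bump is constant far out but need not vanish there; subtracting the
    unshifted copy makes the support compact. *)
Lemma shear_test_function H eta tau dtau q A :
  (forall x : R, is_derive x 1 H (eta x)) -> continuous eta ->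
  (forall s : R, is_derive s 1 tau (dtau s)) -> continuous dtau ->
  (forall s, A < `|s| -> tau s = 0) ->
  (forall x s, A < `|x| -> H (x + q * tau s) = H x) ->
  test_function (fun x s => H (x + q * tau s) - H x).
Proof.
move=> dH ce dt ct tA HA.
have dx (x s : R) := is_derive_shear (q * tau s) x dH.
have ds (x s : R) := is_derive_shear_time q x s dH dt.
have ctau := is_derive_continuous dt.
have cs : continuous (fun z : R * R => eta (z.1 + q * tau z.2)).
  move=> z; apply: (@continuous_cvg _ _ _ _ _ (fun z => z.1 + q * tau z.2) eta); first exact: ce.
  apply: cvgD; first exact: cvg_fst.
  by apply: cvgM; [exact: cvg_cst|exact: continuous_comp_snd].
split.
- by move=> x s; split; [have [] := dx x s|have [] := ds x s].
- rewrite (_ : (fun z => _) = fun z : R * R => eta (z.1 + q * tau z.2) - eta z.1).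
    by move=> z; apply: cvgB; [exact: cs|exact: continuous_comp_fst].
  by apply/funext => z; exact: is_derive_derive1 (dx _ _).
- rewrite (_ : (fun z => _) = fun z : R * R => eta (z.1 + q * tau z.2) * (q * dtau z.2)).
    move=> z; apply: cvgM; first exact: cs.
    by apply: cvgM; [exact: cvg_cst|exact: continuous_comp_snd].
  by apply/funext => z; exact: is_derive_derive1 (ds _ _).
- apply: (@compact_support_box _ (fun x s => H (x + q * tau s) - H x) A) => x s /boxP xs.
  have [xA|xA] := ltP A `|x|; first by rewrite HA// subrr.
  rewrite tA ?mulr0 ?addr0 ?subrr// ltNge; apply/negP => sA; exact: xs.
Qed.

Lemma product_test_function psi dpsi tau dtau A :
  (forall x : R, is_derive x 1 psi (dpsi x)) -> continuous dpsi ->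
  (forall s : R, is_derive s 1 tau (dtau s)) -> continuous dtau ->
  (forall s, A < `|s| -> tau s = 0) -> (forall x, A < `|x| -> psi x = 0) ->
  test_function (fun x s => psi x * tau s).
Proof.
move=> dp cp dt ct tA pA.
have dx (x s : R) : is_derive x 1 (fun x => psi x * tau s) (dpsi x * tau s).
  rewrite [X in is_derive _ _ _ X]mulrC.
  under eq_fun do rewrite mulrC.
  exact: (is_deriveZ (tau s) (dp x)).
have ds (x s : R) : is_derive s 1 (fun s => psi x * tau s) (psi x * dtau s).
  exact: (is_deriveZ (psi x) (dt s)).
split.
- by move=> x s; split; [have [] := dx x s|have [] := ds x s].
- rewrite (_ : (fun z => _) = fun z : R * R => dpsi z.1 * tau z.2).
    move=> z; apply: cvgM; first exact: continuous_comp_fst.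
    by apply: continuous_comp_snd; exact: is_derive_continuous dt.
  by apply/funext => z; exact: is_derive_derive1 (dx _ _).
- rewrite (_ : (fun z => _) = fun z : R * R => psi z.1 * dtau z.2).
    move=> z; apply: cvgM; last exact: continuous_comp_snd.
    by apply: continuous_comp_fst; exact: is_derive_continuous dp.
  by apply/funext => z; exact: is_derive_derive1 (ds _ _).
- apply: (@compact_support_box _ (fun x s => psi x * tau s) A) => x s /boxP xs.
  have [xA|xA] := ltP A `|x|; first by rewrite pA// mul0r.
  rewrite tA ?mulr0// ltNge; apply/negP => sA; exact: xs.
Qed.

(* On [s >= 0] this is [e - c] minus the integral of [trap c e d] over [0, s];
   the second factor only makes the support compact. *)
Definition time_cutoff (c e d s : R) :=
  (e - c - trap_prim c e d s) * smooth_step (1 / 2) (s + 1).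

Definition time_cutoff_deriv (c e d s : R) :=
  (e - c - trap_prim c e d s) * ((1 / 2)^-1 * (ramp (1 / 2) (s + 1) - ramp (1 / 2) (s + 1 - 1 / 2)))
  + smooth_step (1 / 2) (s + 1) * - trap c e d s.

Lemma is_derive_time_cutoff c e d s :
  is_derive s 1 (time_cutoff c e d) (time_cutoff_deriv c e d s).
Proof.
have h1 : is_derive s 1 (fun s => e - c - trap_prim c e d s) (- trap c e d s).
  rewrite -[X in is_derive _ _ _ X]add0r.
  exact: (is_deriveB (is_derive_cst (e - c) s 1) (is_derive_trap_prim c e d s)).
have := @is_derive_translate _ (smooth_step (1 / 2)) _ (- 1) s (@is_derive_smooth_step _ (1 / 2)).
rewrite opprK => h2.
exact: (is_deriveM h1 h2).
Qed.

Lemma continuous_time_cutoff_deriv c e d : continuous (time_cutoff_deriv c e d).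
Proof.
have ctp := is_derive_continuous (@is_derive_trap_prim _ c e d).
have cst := is_derive_continuous (@is_derive_smooth_step R (1 / 2)).
have c1 := continuous_translate (a := - 1) (@continuous_smooth_step_deriv R (1 / 2)).
have c2 := continuous_translate (a := - 1) cst.
rewrite opprK in c1 c2.
move=> s; apply: cvgD.
  by apply: cvgM; [apply: cvgB; [exact: cvg_cst|exact: ctp]|exact: c1].
by apply: cvgM; [exact: c2|apply: cvgN; exact: continuous_trap].
Qed.

Lemma time_cutoffE c e d s : 0 <= s -> time_cutoff c e d s = e - c - trap_prim c e d s.
Proof. by move=> s0; rewrite /time_cutoff smooth_step1 ?mulr1//; lra. Qed.

Lemma time_cutoff_derivE c e d s : 0 <= s -> time_cutoff_deriv c e d s = - trap c e d s.
Proof.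
move=> s0; rewrite /time_cutoff_deriv smooth_step1; [|lra|lra].
by rewrite !ramp1 ?subrr ?mulr0 ?add0r ?mul1r//; lra.
Qed.

Lemma time_cutoff_right c e d s : 0 < d -> c <= e -> e + d <= s -> 0 <= s ->
  time_cutoff c e d s = 0.
Proof. by move=> d0 ce es s0; rewrite time_cutoffE// trap_prim_right// subrr. Qed.

Lemma time_cutoff_support c e d s : 0 < d -> 0 <= c -> c <= e -> e + d + 1 < `|s| ->
  time_cutoff c e d s = 0.
Proof.
move=> d0 c0 ce sA; have [s0|s0] := leP 0 s.
  by rewrite time_cutoff_right//; rewrite ger0_norm// in sA; lra.
rewrite ltr0_norm// in sA; rewrite /time_cutoff smooth_step0 ?mulr0//; lra.
Qed.

Lemma time_cutoff_norm c e d s : 0 < d -> c <= e -> `|time_cutoff c e d s| <= 2 * (e - c).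
Proof.
move=> d0 ce; rewrite /time_cutoff normrM.
have h : `|trap_prim c e d s| <= e - c.
  have := ramp_prim_lip (s - c) (s - e) d0.
  rewrite mul1r; have -> : s - c - (s - e) = e - c by ring.
  by rewrite (ger0_norm (x := e - c))// subr_ge0.
rewrite -[leRHS]mulr1; apply: ler_pM => //; last by apply: smooth_step_norm; lra.
rewrite (le_trans (ler_normB _ _))// ger0_norm ?subr_ge0//; lra.
Qed.

End test_function_constructions.

(** * Weak solutions as identities on the plane *)

Section weak_solution_plane.
Context {R : realType} (K : option nat) (g : R -> \bar R) (rho0 : R -> R).
Variable lambda : R -> R -> R.
Local Notation mu := (@lebesgue_measure R).
Local Notation mu2 := (mu \x mu)%E.
Hypothesis gP : shape_bounds K g.
Local Notation f := (flux g).
Local Notation G0 := (fine (g 0%R)).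
Hypothesis wl : weak_solution K f rho0 lambda.

Definition half_plane_extension (k : R -> R -> R) (z : R * R) :=
  if 0 < z.2 then k z.1 z.2 else 0.

Local Notation lam := (half_plane_extension lambda).
Local Notation flam := (half_plane_extension (fun x t => f (lambda x t))).

Lemma measurable_half_plane : measurable [set z : R * R | 0 < z.2].
Proof.
rewrite (_ : [set z | _] = [set: R * R] `&` snd @^-1` `]0, +oo[%classic).
  by apply: measurable_snd => //; exact: measurable_itv.
by rewrite setTI; apply/seteqP; split => z /=; rewrite in_itv/= andbT.
Qed.

Lemma capacity_ge0 : (0 <= capacity R K)%E.
Proof. by case: (K) => [k|] //=; rewrite lee_fin. Qed.

Lemma lam_range z : 0 <= lam z /\ ((lam z)%:E <= capacity R K)%E.
Proof.
rewrite /half_plane_extension; case: ifPn => [z0|_]; first exact: (weak_range wl).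
by split => //; exact: capacity_ge0.
Qed.

Lemma lam_measurable : measurable_fun [set: R * R] lam.
Proof.
have := weak_measurable wl; rewrite (measurable_restrictT _ measurable_half_plane).
congr measurable_fun; apply/funext => z; rewrite patchE /half_plane_extension.
by case: ifPn => z0; [rewrite inE in z0; rewrite z0|rewrite notin_setE in z0; move/negP/negbTE : z0 => /= ->].
Qed.

(** The indicator is there because [lam] is 0 for t <= 0 while [f 0] need not vanish. *)
Lemma flamE z : flam z = f (lam z) * \1_[set z : R * R | 0 < z.2] z.
Proof.
rewrite /half_plane_extension indicE; case: ifPn => z0; first by rewrite mem_set// mulr1.
by rewrite memNset ?mulr0//=; exact/negP.
Qed.

Lemma flam_measurable : measurable_fun [set: R * R] flam.
Proof.
rewrite (funext flamE).
apply: measurable_funM; first exact: (measurable_flux gP lam_measurable lam_range).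
by apply: measurable_indic; exact: measurable_half_plane.
Qed.

Lemma flux_range r : 0 <= r -> (r%:E <= capacity R K)%E -> 0 <= f r <= G0.
Proof. by move=> r0 rK; rewrite (flux_ge0 gP)// (flux_bound gP). Qed.

Lemma flam_range z : 0 <= flam z <= G0.
Proof.
have G0ge : 0 <= G0 by apply: fine_ge0; exact: (sb_ge0 gP).
rewrite /half_plane_extension; case: ifPn => z0; last by rewrite lexx.
by have [h1 h2] := weak_range wl z.1 z0; exact: flux_range.
Qed.

(** Local boundedness becomes uniform on a compact slab, which must start at a positive time since
    [lambda] may be unbounded as t tends to 0. *)
Lemma weak_bounded_slab (A c : R) : 0 < c ->
  exists C, 0 <= C /\ forall x t, `|x| <= A -> c <= t <= A -> `|lambda x t| <= C.
Proof.
move=> c0; pose S := `[- A, A]%classic `*` `[c, A]%classic.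
have cS : compact S by apply: compact_setX; exact: segment_compact.
have /compact_near_coveringP/(_ R (pinfty_nbhs R) (fun M z => `|lambda z.1 z.2| <= M) _) := cS.
case/(_ _) => [[x t]|M [Mr MP]].
  move=> -[/= _]; rewrite in_itv/= => /andP[ct _].
  have [M [Mr MP]] := weak_locally_bounded wl x (lt_le_trans c0 ct).
  near=> z i => /=.
  have iM : M + 1 <= i by near: i; apply: nbhs_pinfty_ge; rewrite num_real.
  apply: (@le_trans _ _ (M + 1)) => //.
  near: z; apply: MP; rewrite ltrDl//.
exists (`|M| + 1); split; first by rewrite addr_ge0.
move=> x t xA tA; apply: (MP (`|M| + 1) _ (x, t)); first by rewrite (le_lt_trans (ler_norm _))// ltrDl.
by split; rewrite /= in_itv//= -ler_norml.
Unshelve. all: by end_near. Qed.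

(** For 0 < t <= c, where [lambda] may be unbounded, [phi_t] vanishes, while [f (lambda)] is at most
    [G0] everywhere. The integrand is thus bounded with compact support, and Fubini turns the
    iterated integral into one over the plane. *)
Lemma weak_plane_identity phi A C c : test_function phi -> test_bounds phi A C -> 0 < c ->
  (forall x s, 0 < s <= c -> derive1 (phi x) s = 0) ->
  let k z := lam z * derive1 (phi z.1) z.2 + flam z * derive1 (phi ^~ z.2) z.1 in
  mu2.-integrable [set: R * R] (EFin \o k) /\
  (\int[mu2]_z (k z)%:E + \int[mu]_x (rho0 x * phi x 0)%:E = 0)%E.
Proof.
move=> tphi AC c0 phic k.
have [mphi mdx mdt] := test_function_measurable tphi.
have [B [B0 BP]] := @weak_bounded_slab A c c0.
have ik : mu2.-integrable [set: R * R] (EFin \o k).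
  apply: (@box_integrable _ _ A (B * C + G0 * C)).
  - by apply: measurable_funD; apply: measurable_funM => //; [exact: lam_measurable|exact: flam_measurable].
  - move=> z; rewrite /k (le_trans (ler_normD _ _))//; apply: lerD; last first.
      rewrite normrM; apply: ler_pM => //; last exact: (tb_dx AC).
      by have /andP[h1 h2] := flam_range z; rewrite ger0_norm.
    rewrite /half_plane_extension; case: ifPn => z0; last first.
      by rewrite mul0r normr0 mulr_ge0// (tb_C AC).
    have [zc|cz] := leP z.2 c.
      by rewrite phic ?z0// mulr0 normr0 mulr_ge0// (tb_C AC).
    have [/boxP[xA tA]|zA] := pselect (box A (z.1, z.2)); last first.
      by rewrite (tb_dt0 AC)// mulr0 normr0 mulr_ge0// (tb_C AC).
    rewrite normrM; apply: ler_pM => //; last exact: (tb_dt AC).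
    apply: BP => //; rewrite ltW//=; exact: le_trans (ler_norm _) tA.
  - by move=> [x t] zA; rewrite /k/= (tb_dt0 AC)// (tb_dx0 AC)// !mulr0 addr0.
split => //; rewrite -[RHS](weak_identity wl tphi); congr (_ + _)%E.
rewrite -(integral21_prod_meas1 ik) [RHS]integral_mkcond; apply: eq_integral => t _.
rewrite patchE /fubini_G/=; case: ifPn; rewrite ?inE ?notin_setE /= in_itv/= andbT => t0.
  by apply: eq_integral => x _; rewrite /k /half_plane_extension/= t0.
rewrite (_ : point = 0%E)// -[RHS](@integral0 _ _ _ mu setT); apply: eq_integral => x _.
by rewrite /k /half_plane_extension/=; case: ifPn => [/t0//|_]; rewrite !mul0r addr0.
Qed.

End weak_solution_plane.

(** * Integrals on the line *)

Section line_integrals.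
Context {R : realType}.
Local Notation mu := (@lebesgue_measure R).

Lemma line_integrable (k : R -> R) (A C : R) : measurable_fun [set: R] k ->
  (forall x, `|k x| <= C) -> (forall x, A < `|x| -> k x = 0) ->
  mu.-integrable [set: R] (EFin \o k).
Proof.
move=> mk kC kA.
have -> : EFin \o k = (EFin \o k) \_ `[- A, A]%classic.
  apply/funext => z; rewrite patchE; case: ifPn => //; rewrite notin_setE/= in_itv/= => h.
  by rewrite kA// ltNge; apply/negP; rewrite ler_norml.
refine (iffLR (integrable_mkcond (mu := mu) _ (measurable_itv _)) _).
apply: (bounded_itv_integrable mk kC).
by rewrite lebesgue_measure_itv/=; case: ifP => _; rewrite -?EFinD ltry.
Qed.

Lemma line_dominated_cvg (k_ : nat -> R -> R) (k : R -> R) (A C : R) :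
  (forall n, measurable_fun [set: R] (k_ n)) -> measurable_fun [set: R] k ->
  (forall n x, `|k_ n x| <= C) -> (forall n x, A < `|x| -> k_ n x = 0) ->
  (forall x, k_ n x @[n --> \oo] --> k x) ->
  (\int[mu]_x (k_ n x)%:E @[n --> \oo] --> \int[mu]_x (k x)%:E)%E.
Proof.
move=> mk_ mk kC kA kk.
have C0 : 0 <= C by exact: le_trans (normr_ge0 _) (kC 0%N 0).
pose G x := C * \1_(`[- A, A]%classic) x : R.
have Gint : mu.-integrable [set: R] (EFin \o G).
  apply: (@line_integrable _ A C).
  - by apply: measurable_funM; [exact: measurable_cst|exact: measurable_indic].
  - move=> z; rewrite /G indicE; case: (_ \in _); rewrite ?mulr1 ?mulr0 ?normr0//.
    by rewrite ger0_norm.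
  - move=> z zA; rewrite /G indicE memNset ?mulr0//= in_itv/=.
    by rewrite -ler_norml leNgt zA.
have [] := @dominated_convergence _ _ _ mu setT measurableT
  (fun n z => (k_ n z)%:E) (fun z => (k z)%:E) (EFin \o G).
- by move=> n; apply/measurable_EFinP; exact: mk_.
- by apply/measurable_EFinP; exact: mk.
- by apply: aeW => z _; apply: cvg_EFin; [exact: nearW|exact: kk].
- exact: Gint.
- apply: aeW => z n _; rewrite /= lee_fin /G indicE.
  have [zA|zA] := leP `|z| A.
    by rewrite mem_set ?mulr1//= in_itv/= -ler_norml.
  by rewrite kA// normr0 mulr_ge0.
by move=> _ _.
Qed.

Lemma bounded_integrable_itv (W : R -> R) (C a b : R) : measurable_fun [set: R] W ->
  (forall x, `|W x| <= C) -> mu.-integrable `]a, b] (EFin \o W).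
Proof.
move=> mW WC; apply: (bounded_itv_integrable mW WC).
by rewrite lebesgue_measure_itv/=; case: ifP => _; rewrite -?EFinD ltry.
Qed.

Lemma bounded_integral_norm (W : R -> R) (C a b : R) : measurable_fun [set: R] W ->
  (forall x, `|W x| <= C) -> a <= b -> `|\int[mu]_(x in `]a, b]) W x| <= C * (b - a).
Proof.
move=> mW WC ab; have C0 : 0 <= C := le_trans (normr_ge0 _) (WC 0).
have iW := bounded_integrable_itv a b mW WC.
apply: le_trans (le_normr_Rintegral _ iW) _ => //.
apply: (@le_trans _ _ (\int[mu]_(z in `]a, b]) cst C z)).
  apply: le_Rintegral => //; first exact: integrable_norm.
  by apply: (@bounded_integrable_itv _ C) => // x; rewrite ger0_norm.
rewrite Rintegral_cst//= lebesgue_measure_itv/= lte_fin.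
by move: ab; rewrite le_eqVlt => /predU1P[->|->]; rewrite ?ltxx ?subrr.
Qed.

Lemma bounded_integral_cat (W : R -> R) (C a b c : R) : measurable_fun [set: R] W ->
  (forall x, `|W x| <= C) -> a <= b -> b <= c -> \int[mu]_(x in `]a, c]) W x =
    \int[mu]_(x in `]a, b]) W x + \int[mu]_(x in `]b, c]) W x.
Proof.
move=> mW WC ab bc.
have := @Rintegral_itvB _ W (BRight a) (BRight c) b (bounded_integrable_itv a c mW WC).
by rewrite !bnd_simp => /(_ ab bc) <-; rewrite addrC subrK.
Qed.

(** The primitive of [W] is nondecreasing between rationals, hence by its Lipschitz bound between
    reals, and Lebesgue's theorem makes [W] almost everywhere a limit of its difference
    quotients. *)
Lemma ae_ge0_of_intervals (W : R -> R) (C : R) : measurable_fun [set: R] W ->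
  (forall x, `|W x| <= C) ->
  (forall p q : rat, p <= q -> 0 <= \int[mu]_(x in `]ratr p, ratr q]) W x) ->
  {ae mu, forall x, 0 <= W x}.
Proof.
move=> mW WC W0.
have C0 : 0 <= C := le_trans (normr_ge0 _) (WC 0).
have iW a b := bounded_integrable_itv a b mW WC.
have JC a b := @bounded_integral_norm W C a b mW WC.
have JD a b c := @bounded_integral_cat W C a b c mW WC.
have J0 x y : x <= y -> 0 <= \int[mu]_(z in `]x, y]) W z.
  move=> xy; apply/ler_addgt0Pl => e e0.
  (* The left endpoint moves by at most d and the right one by at most 2 d, at a total cost of at
     most [3 * C * d <= e]. Taking the right rational beyond [y + d] guarantees p <= q even if x =
     y. *)
  have d0 : 0 < e / (3 * (C + 1)) by rewrite divr_gt0// mulr_gt0// ltr_wpDl.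
  set d := e / (3 * (C + 1)) in d0.
  have Cd : C * d <= e / 3.
    have : (C + 1) * d = e / 3 by rewrite /d; field; rewrite gt_eqF// ltr_wpDl.
    by rewrite mulrDl mul1r; lra.
  have [p] := @rat_in_itvoo R x (x + d) ltac:(by rewrite ltrDl).
  rewrite in_itv/= => /andP[xp pxd].
  have [q] := @rat_in_itvoo R (y + d) (y + d + d) ltac:(by rewrite ltrDl).
  rewrite in_itv/= => /andP[yq qyd].
  have pq : p <= q by rewrite -(ler_rat R); lra.
  have xq : x <= ratr q by lra.
  have yq' : y <= ratr q by lra.
  have := JD x y (ratr q) xy yq'; have := W0 _ _ pq.
  rewrite (JD x (ratr p) (ratr q)); [|exact: ltW|by rewrite ler_rat].
  have := JC y (ratr q) yq'; have := JC x (ratr p) (ltW xp).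
  have : C * (ratr p - x) <= C * d by rewrite ler_wpM2l//; lra.
  have : C * (ratr q - y) <= C * (d + d) by rewrite ler_wpM2l//; lra.
  move: (\int[mu]_(z in `]x, ratr p]) W z) (\int[mu]_(z in `]ratr p, ratr q]) W z).
  move: (\int[mu]_(z in `]x, y]) W z) (\int[mu]_(z in `]y, ratr q]) W z) => i1 i2 i3 i4.
  rewrite !ler_norml => h1 h2 /andP[h3 h4] /andP[h5 h6] h7 h8.
  clear -Cd h1 h2 h3 h4 h5 h6 h7 h8; lra.
have locW := bounded_locally_integrable mW WC.
have /ae_foralln : forall n : nat, {ae mu, forall x, - n.+1%:R < x -> 0 <= W x}.
  move=> n; have iWn y : mu.-integrable [set` Interval (BRight (- n.+1%:R)) (BRight y)] (EFin \o W) by exact: iW.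
  have := FTC1 iWn locW; apply: aeS => x + nx => /(_ nx)[dF <-].
  have := forward_quotient_cvg dF.
  set F := (fun y => _) => h; rewrite -(cvg_lim (@Rhausdorff R) h).
  apply: limr_ge; first exact: (cvgP _ h).
  apply: nearW => k; rewrite mulr_ge0// /F.
  by rewrite (JD _ x) ?(ltW nx)// ?lerDl ?invr_ge0// addrAC subrr add0r J0// lerDl invr_ge0.
apply: aeS => x /(_ (Num.bound `|x|)); apply.
have := archi_boundP (normr_ge0 x); rewrite ltr_norml -natr1; lra.
Qed.

Lemma ae_eq0_of_intervals (W : R -> R) (C : R) : measurable_fun [set: R] W ->
  (forall x, `|W x| <= C) ->
  (forall p q : rat, p <= q -> \int[mu]_(x in `]ratr p, ratr q]) W x = 0) ->
  {ae mu, forall x, W x = 0}.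
Proof.
move=> mW WC W0.
have W1 : {ae mu, forall x, 0 <= W x}.
  by apply: (ae_ge0_of_intervals mW WC) => p q pq; rewrite W0.
have W2 : {ae mu, forall x, 0 <= -1 * W x}.
  apply: (@ae_ge0_of_intervals _ C) => [|x|p q pq].
  - exact: measurable_funM.
  - by rewrite mulN1r normrN.
  - rewrite RintegralZl// ?W0 ?mulr0//.
    exact: (bounded_integrable_itv _ _ mW WC).
by apply: aeS2 W1 W2 => x h1 h2; lra.
Qed.

End line_integrals.

(** * Integration by parts for the initial height *)

Section by_parts.
Context {R : realType}.
Local Notation mu := (@lebesgue_measure R).
Variables (rho0 u0 : R -> R) (L : R).
Hypothesis L0 : 0 <= L.
Hypothesis mrho0 : measurable_fun [set: R] rho0.
Hypothesis rho0L : forall x, 0 <= rho0 x <= L.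
Hypothesis u0E : forall a b : R, a < b ->
  (u0 b - u0 a)%:E = (\int[mu]_(x in `[a, b]) (rho0 x)%:E)%E.

Lemma height_by_parts (Phi dPhi : R -> R) (A M : R) :
  (forall x : R, is_derive x 1 Phi (dPhi x)) -> continuous dPhi ->
  (forall x, `|Phi x| <= M) -> (forall x, `|dPhi x| <= M) ->
  (forall x, A < `|x| -> Phi x = 0) -> (forall x, A < `|x| -> dPhi x = 0) ->
  mu.-integrable [set: R] (EFin \o (fun x => rho0 x * Phi x)) /\
  mu.-integrable [set: R] (EFin \o (fun x => u0 x * dPhi x)) /\
  \int[mu]_x (rho0 x * Phi x) = - \int[mu]_x (u0 x * dPhi x).
Proof.
move=> dP cdP PM dPM PA dPA.
have u0L := height_mono_lip mrho0 rho0L u0E.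
have cu0 := mono_lip_continuous u0L.
have cP := is_derive_continuous dP.
have M0 : 0 <= M := le_trans (normr_ge0 _) (PM 0).
pose U := `|u0 0| + L * `|A|.
have U0 : 0 <= U by rewrite addr_ge0// mulr_ge0.
have uU x : `|x| <= A -> `|u0 x| <= U.
  move=> xA; have := mono_lip_lip x 0 u0L; rewrite subr0 => h.
  rewrite -[u0 x](subrK (u0 0)) (le_trans (ler_normD _ _))// addrC lerD2l.
  by rewrite (le_trans h)// ler_wpM2l// (le_trans xA)// ler_norm.
have i1 : mu.-integrable [set: R] (EFin \o (fun x => rho0 x * Phi x)).
  apply: (@line_integrable _ _ A (L * M)).
  - by apply: measurable_funM => //; exact: continuous_measurable_fun.
  - by move=> x; rewrite normrM ler_pM// ger0_norm; have /andP[] := rho0L x.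
  - by move=> x xA; rewrite PA// mulr0.
have i2 : mu.-integrable [set: R] (EFin \o (fun x => u0 x * dPhi x)).
  apply: (@line_integrable _ _ A (U * M)).
  - by apply: measurable_funM => //; exact: continuous_measurable_fun.
  - move=> x; have [xA|xA] := leP `|x| A; first by rewrite normrM ler_pM// uU.
    by rewrite dPA// mulr0 normr0 mulr_ge0.
  - by move=> x xA; rewrite dPA// mulr0.
split => //; split => //; apply/eqP; rewrite -addr_eq0; apply/eqP.
rewrite -RintegralD//.
pose D := U * M + L * M.
have Plip x y : `|Phi x - Phi y| <= M * `|x - y|.
  by apply: derivable_lip => z; [have [] := dP z|rewrite (is_derive_derive1 (dP z))].
have D0 : 0 <= D by rewrite addr_ge0// mulr_ge0.
have lip1 x y : `|x| <= A -> `|u0 x * Phi x - u0 y * Phi y| <= D * `|x - y|.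
  move=> xA; have -> : u0 x * Phi x - u0 y * Phi y = u0 x * (Phi x - Phi y) + (u0 x - u0 y) * Phi y.
    by ring.
  apply: le_trans (ler_normD _ _) _; rewrite (mulrDl (U * M)); apply: lerD; rewrite normrM.
    by rewrite -mulrA; apply: ler_pM => //; exact: uU.
  by rewrite mulrAC; apply: ler_pM => //; exact: mono_lip_lip u0L.
have lip x y : `|u0 x * Phi x - u0 y * Phi y| <= D * `|x - y|.
  have [xA|xA] := leP `|x| A; first exact: lip1.
  have [yA|yA] := leP `|y| A; first by rewrite distrC (distrC x); exact: lip1.
  by rewrite !PA// !mulr0 subrr normr0 mulr_ge0.
(* The product of [u0] and [Phi] is [D]-Lipschitz but not monotone; adding [D * x] makes it
   monotone, so that [mono_lip_FTC] applies. The added term is subtracted at the end. *)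
pose F x := u0 x * Phi x + D * x.
have FL : mono_lip (2 * D) F.
  move=> x y xy; have := lip y x; rewrite (ger0_norm (x := y - x)) ?subr_ge0// ler_norml => /andP[h1 h2].
  rewrite /F; apply/andP; split; lra.
pose B := `|A| + 1.
have BA : A < B by rewrite /B; have := ler_norm A; lra.
have B0 : 0 < B by rewrite ltr_wpDl.
pose k x := rho0 x * Phi x + u0 x * dPhi x.
have mk : measurable_fun [set: R] k.
  apply: measurable_funD; apply: measurable_funM => //; exact: continuous_measurable_fun.
have BN : - B <= B by lra.
have ik : mu.-integrable [set: R] (EFin \o k) by exact: integrable_realD.
have ikB : mu.-integrable `]- B, B] (EFin \o k) by exact: integrableS ik.
have dF (x : R) : derivable u0 x 1 -> derive1 u0 x = rho0 x -> k x + D = derive1 F x.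
  move=> du u'; have hu : is_derive x 1 u0 (rho0 x) by apply: DeriveDef => //; rewrite -derive1E.
  have h3 := is_derive_derive1 (is_deriveD (is_deriveM hu (dP x)) (is_deriveZ D (is_derive_id x 1))).
  by rewrite [RHS]h3 /k /GRing.scale/=; ring.
have h : (\int[mu]_(x in `](- B)%R, B]) (k x + D)%:E = (F B - F (- B))%:E)%E.
  apply: (mono_lip_FTC FL BN (measurable_funD mk (measurable_cst _))).
  by apply: aeS2 (mono_lip_derivable_ae u0L) (height_derive1 mrho0 rho0L u0E) => x du u' _ _; exact: dF.
have kB : \int[mu]_x k x = \int[mu]_(x in `]- B, B]) k x.
  rewrite [RHS]Rintegral_mkcond; congr Rintegral; apply/funext => x; rewrite patchE.
  case: ifPn => //; rewrite notin_setE/= in_itv/= => xB.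
  have xA : A < `|x|.
    rewrite ltNge; apply/negP; rewrite ler_norml => /andP[xA1 xA2]; apply: xB.
    by apply/andP; split; lra.
  by rewrite /k PA// dPA// !mulr0 addr0.
rewrite [LHS]kB.
have iD : mu.-integrable `]- B, B] (EFin \o cst D).
  apply: (@bounded_itv_integrable _ _ `|D|) => //.
  by rewrite lebesgue_measure_itv/=; case: ifP => _; rewrite -?EFinD ltry.
have : \int[mu]_(x in `]- B, B]) (k x + D) = F B - F (- B) by rewrite /Rintegral h.
rewrite RintegralD// Rintegral_cst//= lebesgue_measure_itv/= lte_fin.
have -> : - B < B by lra.
have -> : F B = D * B by rewrite /F PA ?mulr0 ?add0r// gtr0_norm.
have -> : F (- B) = - (D * B) by rewrite /F PA ?mulr0 ?add0r ?mulrN// normrN gtr0_norm.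
by rewrite /=; lra.
Qed.

End by_parts.

(** * The current of a weak solution *)

Section real_fubini.
Context {R : realType}.
Local Notation mu := (@lebesgue_measure R).
Local Notation mu2 := (mu \x mu)%E.
Variables (k : R * R -> R) (A C : R).
Hypothesis mk : measurable_fun [set: R * R] k.
Hypothesis kC : forall z, `|k z| <= C.
Hypothesis kA : forall z, ~ box A z -> k z = 0.

Lemma box_xsection_integrable (x : R) : mu.-integrable [set: R] (EFin \o (fun t => k (x, t))).
Proof.
apply: (@line_integrable _ _ A C) => [|t|t tA]; first exact: (measurable_fun_pair2 x mk).
  exact: kC.
by apply: kA => /boxP[_]; rewrite leNgt tA.
Qed.

Lemma box_ysection_integrable (t : R) : mu.-integrable [set: R] (EFin \o (fun x => k (x, t))).
Proof.
apply: (@line_integrable _ _ A C) => [|x|x xA]; first exact: (measurable_fun_pair1 t mk).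
  exact: kC.
by apply: kA => /boxP[+ _]; rewrite leNgt xA.
Qed.

Lemma box_Rintegral12 : \int[mu2]_z k z = \int[mu]_x \int[mu]_t k (x, t).
Proof.
have ik := box_integrable mk kC kA.
have := integral12_prod_meas1 ik; rewrite {1 2}/Rintegral => <-; congr fine.
apply: eq_integral => x _; rewrite /fubini_F.
exact: (integral_real_EFin measurableT (box_xsection_integrable x)).
Qed.

Lemma box_Rintegral21 : \int[mu2]_z k z = \int[mu]_t \int[mu]_x k (x, t).
Proof.
have ik := box_integrable mk kC kA.
have := integral21_prod_meas1 ik; rewrite {1 2}/Rintegral => <-; congr fine.
apply: eq_integral => t _; rewrite /fubini_G.
exact: (integral_real_EFin measurableT (box_ysection_integrable t)).
Qed.

End real_fubini.

Section bump_facts.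
Context {R : realType}.
Local Notation mu := (@lebesgue_measure R).

Lemma trap_far (a b d x : R) : 0 < d -> a <= b -> `|a| + `|b| + d < `|x| -> trap a b d x = 0.
Proof.
move=> d0 ab xA.
have [x0|x0] := leP 0 x.
  rewrite trap_right//; apply: le_trans (ltW (lt_le_trans xA _)); last by rewrite ger0_norm.
  by rewrite lerD2r (le_trans (ler_norm b))// lerDr.
rewrite trap_left//; rewrite (ltr0_norm x0) in xA; have := ler_norm (- a).
by rewrite normrN; have := normr_ge0 b; lra.
Qed.

Lemma trap_prim_far (a b d x h : R) : 0 < d -> a <= b ->
  `|a| + `|b| + d + `|h| < `|x| -> trap_prim a b d (x + h) = trap_prim a b d x.
Proof.
move=> d0 ab xA.
have b1 := ler_norm b; have a1 := ler_norm (- a); have h1 := ler_norm (- h); have h2 := ler_norm h.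
rewrite !normrN in a1 h1; have h3 := normr_ge0 h; have a0 := normr_ge0 a; have b0 := normr_ge0 b.
have [x0|x0] := leP 0 x.
  by rewrite (ger0_norm x0) in xA; rewrite !(trap_prim_right d0 ab)//; lra.
by rewrite (ltr0_norm x0) in xA; rewrite !(trap_prim_left d0 ab)//; lra.
Qed.

Lemma indicator_integrable (a b : R) :
  mu.-integrable [set: R] (EFin \o (fun x => \1_(`]a, b]%classic) x : R)).
Proof.
apply: (@line_integrable _ _ (`|a| + `|b|) 1).
- exact: measurable_indic.
- by move=> x; rewrite indicE; case: (_ \in _); rewrite ?normr1 ?normr0.
- move=> x xA; rewrite indicE memNset//= in_itv/= => /andP[ax xb].
  move: xA; apply/negP; rewrite -leNgt ler_norml.
  have := ler_norm (- a); have := ler_norm b; rewrite normrN.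
  have := normr_ge0 a; have := normr_ge0 b; lra.
Qed.

Lemma indicator_integral (a b : R) : a <= b -> \int[mu]_x (\1_(`]a, b]%classic) x : R) = b - a.
Proof.
move=> ab; rewrite /Rintegral integral_indic//= setIT.
have -> : mu `]a, b]%classic = if a < b then (b - a)%:E else 0%E by rewrite lebesgue_measure_itv/= lte_fin.
by move: ab; rewrite le_eqVlt => /predU1P[->|->]; rewrite ?ltxx ?subrr.
Qed.

Lemma indicator_range (c c' s : R) : 0 <= (\1_(`]c, c']%classic) s : R) <= 1.
Proof. by rewrite indicE; case: (_ \in _); rewrite lexx ler01. Qed.

Lemma indicator_in (c c' s : R) : c < s -> s <= c' -> (\1_(`]c, c']%classic) s : R) = 1.
Proof. by move=> h1 h2; rewrite indicE mem_set//= in_itv/= h1. Qed.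

Lemma indicator_left (c c' s : R) : s <= c -> (\1_(`]c, c']%classic) s : R) = 0.
Proof. by move=> h; rewrite indicE memNset//= in_itv/= ltNge h. Qed.

Lemma indicator_right (c c' s : R) : c' < s -> (\1_(`]c, c']%classic) s : R) = 0.
Proof. by move=> h; rewrite indicE memNset//= in_itv/= => /andP[_]; rewrite leNgt h. Qed.

End bump_facts.

(** * The current bound for one velocity *)

Section current_inequality.
Context {R : realType} (K : option nat) (g : R -> \bar R) (rho0 u0 : R -> R) (L : R).
Variable lambda : R -> R -> R.
Local Notation mu := (@lebesgue_measure R).
Local Notation mu2 := (mu \x mu)%E.
Hypothesis gP : shape_bounds K g.
Hypothesis L0 : 0 <= L.
Hypothesis mrho0 : measurable_fun [set: R] rho0.
Hypothesis rho0L : forall x, 0 <= rho0 x <= L.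
Hypothesis u0E : forall a b : R, a < b ->
  (u0 b - u0 a)%:E = (\int[mu]_(x in `[a, b]) (rho0 x)%:E)%E.
Local Notation f := (flux g).
Local Notation G := (fun q => fine (g q)).
Local Notation G0 := (fine (g 0%R)).
Hypothesis wl : weak_solution K f rho0 lambda.
Local Notation lam := (half_plane_extension lambda).
Local Notation flam := (half_plane_extension (fun x t => f (lambda x t))).

Let u0L : mono_lip L u0 := height_mono_lip mrho0 rho0L u0E.
Let cu0 : continuous u0 := mono_lip_continuous u0L.
Let G0_ge0 : 0 <= G0 := shape_real_ge0 gP 0.

Definition current (t x : R) := \int[mu]_(s in `]0, t]) f (lambda x s).

Lemma current_restrict t x s : (fun s => f (lambda x s)) \_ `]0, t]%classic s =
  flam (x, s) * \1_(`]0, t]%classic) s.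
Proof.
rewrite patchE indicE /half_plane_extension/=; case: ifPn => [|st]; last by rewrite mulr0.
by rewrite inE/= in_itv/= => /andP[-> _]; rewrite mulr1.
Qed.

Lemma currentE t x : current t x = \int[mu]_s (flam (x, s) * \1_(`]0, t]%classic) s).
Proof.
rewrite /current Rintegral_mkcond; congr Rintegral; apply/funext => s.
exact: current_restrict.
Qed.

Lemma current_integrable t x :
  mu.-integrable [set: R] (EFin \o (fun s => flam (x, s) * \1_(`]0, t]%classic) s)).
Proof.
apply: (@line_integrable _ _ `|t| G0).
- apply: measurable_funM; last exact: measurable_indic.
  exact: (measurable_fun_pair2 x (flam_measurable gP wl)).
- move=> s; rewrite normrM -[leRHS]mulr1; apply: ler_pM => //.
    by have /andP[h1 h2] := flam_range gP wl (x, s); rewrite ger0_norm.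
  by rewrite indicE; case: (_ \in _); rewrite ?normr1 ?normr0.
- move=> s ts; rewrite indicE memNset ?mulr0//= in_itv/= => /andP[s0 st].
  by move: ts; rewrite ltNge gtr0_norm// (le_trans st) ?ler_norm.
Qed.

Lemma current_range t x : 0 <= t -> 0 <= current t x <= t * G0.
Proof.
move=> t0; rewrite currentE; apply/andP; split.
  apply: Rintegral_ge0 => s _; apply: mulr_ge0; last by rewrite indicE.
  by have /andP[] := flam_range gP wl (x, s).
have i1 := integrable_realZ measurableT G0 (indicator_integrable 0 t).
apply: (@le_trans _ _ (\int[mu]_s (G0 * \1_(`]0, t]%classic) s))).
  apply: le_Rintegral => //; first exact: current_integrable.
  move=> s _; rewrite ler_wpM2r//.
  by have /andP[] := flam_range gP wl (x, s).
rewrite RintegralZl//; last exact: indicator_integrable.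
by rewrite indicator_integral// subr0 mulrC.
Qed.

Lemma current_measurable t : measurable_fun [set: R] (current t).
Proof.
rewrite (_ : current t = fine \o (fun x => \int[mu]_s (flam (x, s) * \1_(`]0, t]%classic) s)%:E)%E).
  apply: measurableT_comp => //.
  have h : measurable_fun [set: R * R] (fun z : R * R => (flam z * \1_(`]0%R, t]%classic) z.2)%:E).
    apply/measurable_EFinP; apply: measurable_funM; first exact: (flam_measurable gP wl).
    by apply: (measurableT_comp _ measurable_snd); exact: measurable_indic.
  have := @measurable_fun_fubini_tonelli_F _ _ _ _ R mu _ h.
  apply => z; rewrite lee_fin; apply: mulr_ge0; last by rewrite indicE.
  by have /andP[] := flam_range gP wl z.
by apply/funext => x; rewrite currentE.
Qed.


Section bump.
Variables (q t a b d e : R).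
Hypothesis gq : (g q < +oo)%E.
Hypothesis ab : a <= b.
Hypothesis d0 : 0 < d.
Hypothesis e0 : 0 < e.
Hypothesis et : 4 * e <= t.
Local Notation H := (trap_prim a b d).
Local Notation eta := (trap a b d).
(** [tau] equals t - 2 e on [0, e] and 0 from time t on, with slope -1 on [2 e, t - e]; the flat
    start keeps [phi_t] zero on ]0, e]. *)
Local Notation tau := (time_cutoff e (t - e) e).
Local Notation dtau := (time_cutoff_deriv e (t - e) e).
Local Notation A := (`|a| + `|b| + d + `|q| * (2 * t) + t + 1).
Local Notation one c c' s := (\1_(`]c, c']%classic) s : R).

Lemma test_time_gt0 : 0 < t.
Proof. by apply: lt_le_trans et; rewrite mulr_gt0. Qed.

Let t0 := test_time_gt0.

Local Ltac blra :=
  pose proof e0; pose proof et; pose proof ab; pose proof d0; pose proof t0; lra.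


Lemma bump_far_ge0 : 0 <= `|a| + `|b| + d + `|q| * (2 * t).
Proof. by rewrite !addr_ge0// ?mulr_ge0//; blra. Qed.

Lemma bump_norm x : `|eta x| <= 1.
Proof. by rewrite ger0_norm ?trap_le1// trap_ge0. Qed.

Lemma cutoff_norm s : `|q * tau s| <= `|q| * (2 * t).
Proof.
rewrite normrM ler_wpM2l//; have ee : e <= t - e by blra.
by apply: le_trans (time_cutoff_norm s e0 ee) _; blra.
Qed.

Lemma cutoff_far s : A < `|s| -> tau s = 0.
Proof.
have : 0 <= `|a| + `|b| + d + `|q| * (2 * t) := bump_far_ge0.
move: (`|a| + _ + _ + _) => B B0 sA.
by apply: time_cutoff_support => //; blra.
Qed.

Lemma bump_prim_far x h : `|h| <= `|q| * (2 * t) -> A < `|x| -> H (x + h) = H x.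
Proof. by move=> hq xA; apply: trap_prim_far => //; blra. Qed.

Lemma bump_far x h : `|h| <= `|q| * (2 * t) -> A < `|x| -> eta (x + h) = 0.
Proof.
move=> hq xA; apply: trap_far => //; have := ler_normB (x + h) h.
rewrite addrK; blra.
Qed.

Lemma bump_far0 x : A < `|x| -> eta x = 0.
Proof. by move=> /(@bump_far _ 0); rewrite normr0 addr0; apply; rewrite mulr_ge0//; blra. Qed.

Lemma measurable_bump : measurable_fun [set: R] eta.
Proof. by apply: continuous_measurable_fun; exact: continuous_trap. Qed.

Lemma bump_integrable (w : R -> R) (C : R) : measurable_fun [set: R] w ->
  (forall x, `|x| <= A -> `|w x| <= C) ->
  mu.-integrable [set: R] (EFin \o (fun x => eta x * w x)).
Proof.
move=> mw wC; apply: (@line_integrable _ _ A C) => [|x|x xA].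
- by apply: measurable_funM => //; exact: measurable_bump.
- have [xA|xA] := leP `|x| A.
    by rewrite normrM -[leRHS]mul1r ler_pM ?bump_norm ?wC.
  rewrite bump_far0// mul0r normr0 (le_trans _ (wC 0 _))// normr0.
  by have := bump_far_ge0; blra.
- by rewrite bump_far0// mul0r.
Qed.

(** A majorant of [th * G q + (1 - th) * G0], where [th] is minus the slope of [tau]. The second
    part is present only while [th] can differ from 1: on ]0, 2 e] and ]t - e, t], of total length 3
    e. *)
Definition current_weight s :=
  G q * one 0 t s + G0 * (one 0 (2 * e) s + one (t - e) t s).

Let Gq0 : 0 <= G q := shape_real_ge0 gP q.

Lemma current_weight_range s : 0 <= current_weight s <= G q + G0 * 2.
Proof.
have /andP[h1 h2] := indicator_range 0 t s.
have /andP[h3 h4] := indicator_range 0 (2 * e) s.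
have /andP[h5 h6] := indicator_range (t - e) t s.
rewrite /current_weight; apply/andP; split; first by rewrite addr_ge0 ?mulr_ge0// addr_ge0.
by apply: lerD; [rewrite ler_piMr|rewrite ler_wpM2l//; blra].
Qed.

Lemma current_weight_far s : s <= 0 \/ t < s -> current_weight s = 0.
Proof.
move=> [s0|ts]; first by rewrite /current_weight !indicator_left ?addr0 ?mulr0 ?addr0//; blra.
by rewrite /current_weight !indicator_right ?addr0 ?mulr0 ?addr0//; blra.
Qed.

Lemma current_weight_integrable : mu.-integrable [set: R] (EFin \o current_weight).
Proof.
have io := @indicator_integrable R.
have i12 := integrable_realD measurableT (io 0 (2 * e)) (io (t - e) t).
exact: (integrable_realD measurableT (integrable_realZ measurableT _ (io 0 t))
  (integrable_realZ measurableT _ i12)).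
Qed.

Lemma current_weight_integral : \int[mu]_s current_weight s = t * G q + 3 * e * G0.
Proof.
have io := @indicator_integrable R.
have i12 := integrable_realD measurableT (io 0 (2 * e)) (io (t - e) t).
rewrite /current_weight RintegralD//; last 2 first.
- exact: (integrable_realZ measurableT _ (io 0 t)).
- exact: (integrable_realZ measurableT _ i12).
rewrite (RintegralZl _ _ i12)// (RintegralZl _ _ (io 0 t))//.
rewrite (RintegralD _ (io 0 (2 * e)) (io (t - e) t))//.
by rewrite !indicator_integral; blra.
Qed.

Lemma current_weight_ge s (th := trap e (t - e) e s) : 0 < s <= t ->
  th * G q + (1 - th) * G0 <= current_weight s.
Proof.
move=> /andP[s0 st].
have th0 : 0 <= th by apply: trap_ge0 => //; blra.
have th1 : th <= 1 by exact: trap_le1.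
have h1 : th * G q <= G q by rewrite ler_piMl.
have h2 : (1 - th) * G0 <= G0 by rewrite ler_piMl//; blra.
have /andP[h3 h4] := indicator_range 0 (2 * e) s.
have /andP[h5 h6] := indicator_range (t - e) t s.
rewrite /current_weight (indicator_in (c' := t))// mulr1 mulrDr.
have j1 : 0 <= G0 * one 0 (2 * e) s by rewrite mulr_ge0.
have j2 : 0 <= G0 * one (t - e) t s by rewrite mulr_ge0.
have [s2|s2] := leP s (2 * e).
  by rewrite (indicator_in (c' := 2 * e))// mulr1; blra.
have [s3|s3] := leP s (t - e).
  by rewrite /th trap_mid// ?subrr ?mul0r ?mul1r; blra.
by rewrite (indicator_in (c := t - e))// mulr1; blra.
Qed.

(** With [th] for [- dtau s], the terms carrying [eta (x + q * tau s)] multiply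
    [f - q * th * lambda], a convex combination of [f - q * lambda <= G q] and [f <= G0]. The
    remaining term in [eta x] becomes the current after integration. *)
Lemma shear_pointwise x s (dt := eta (x + q * tau s) * (q * dtau s))
    (dx := eta (x + q * tau s) - eta x) :
  lam (x, s) * dt + flam (x, s) * dx <=
  eta (x + q * tau s) * current_weight s - flam (x, s) * one 0 t s * eta x.
Proof.
rewrite /dt /dx; have [s0|s0] := leP s 0.
  rewrite /half_plane_extension/= ltNge s0/= !mul0r current_weight_far ?mulr0 ?subrr ?addr0//.
  by left.
have [st|ts] := leP s t; last first.
  have -> : tau s = 0 by apply: time_cutoff_right; blra.
  have -> : dtau s = 0 by rewrite time_cutoff_derivE ?trap_right ?oppr0//; blra.
  rewrite current_weight_far; last by right.
  by rewrite indicator_right// !mulr0 mul0r addr0 subrr !mulr0 addr0 subrr.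
rewrite (indicator_in (c' := t))// mulr1 /half_plane_extension/= s0.
have [l0 lK] := weak_range wl x s0.
have flq := flux_le gP l0 lK gq; have flG := flux_bound gP l0 lK.
rewrite time_cutoff_derivE; last exact: ltW.
have := @current_weight_ge s; rewrite s0 st => /(_ isT).
set th := trap e (t - e) e s => ccge.
have th0 : 0 <= th by apply: trap_ge0 => //; blra.
have th1 : th <= 1 by exact: trap_le1.
move: th ccge th0 th1 => th ccge th0 th1.
have h1 : th * f (lambda x s) <= th * (G q + lambda x s * q) by rewrite ler_wpM2l.
have h2 : (1 - th) * f (lambda x s) <= (1 - th) * G0 by rewrite ler_wpM2l// subr_ge0.
have key : f (lambda x s) - q * th * lambda x s <= current_weight s.
  apply: le_trans ccge; move: h1 h2; rewrite mulrDr !mulrBl !mul1r.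
  have -> : th * (lambda x s * q) = q * th * lambda x s by ring.
  by blra.
have := ler_wpM2l (trap_ge0 (x + q * tau s) d0 ab) key.
rewrite -subr_ge0 => h; rewrite -subr_ge0; apply: le_trans h _.
by rewrite le_eqVlt; apply/orP; left; apply/eqP; ring.
Qed.

Let etaw (z : R * R) := eta (z.1 + q * tau z.2) * current_weight z.2.
Let etaf (z : R * R) := flam z * one 0 t z.2 * eta z.1.

Lemma continuous_cutoff : continuous tau.
Proof. exact: (is_derive_continuous (@is_derive_time_cutoff R e (t - e) e)). Qed.

Lemma outside_box z : ~ box A z -> A < `|z.1| \/ (z.2 <= 0 \/ t < z.2).
Proof.
case: z => x s /boxP h /=; have [xA|xA] := leP `|x| A; last by left.
have sA : A < `|s| by rewrite ltNge; apply/negP => sA; apply: h.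
right; have [s0|s0] := leP s 0; [by left|right].
by move: sA; rewrite (gtr0_norm s0); have := bump_far_ge0; blra.
Qed.

Lemma measurable_etaw : measurable_fun [set: R * R] etaw.
Proof.
apply: measurable_funM.
  apply: (measurableT_comp measurable_bump); apply: measurable_funD; first exact: measurable_fst.
  apply: measurable_funM => //; apply: measurableT_comp => //.
  by apply: continuous_measurable_fun; exact: continuous_cutoff.
apply: (measurableT_comp _ measurable_snd).
by apply/measurable_EFinP; exact: measurable_int current_weight_integrable.
Qed.

Lemma etaw_bounded z : `|etaw z| <= 1 * (G q + G0 * 2).
Proof.
rewrite normrM; apply: ler_pM => //; first exact: bump_norm.
by have /andP[h1 h2] := current_weight_range z.2; rewrite ger0_norm.
Qed.

Lemma etaw_box z : ~ box A z -> etaw z = 0.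
Proof.
move=> /outside_box[h|h]; rewrite /etaw; last by rewrite current_weight_far// mulr0.
by rewrite bump_far ?mul0r//; exact: cutoff_norm.
Qed.

Lemma measurable_etaf : measurable_fun [set: R * R] etaf.
Proof.
apply: measurable_funM; last exact: (measurableT_comp measurable_bump measurable_fst).
apply: measurable_funM; first exact: (flam_measurable gP wl).
by apply: (measurableT_comp _ measurable_snd); exact: measurable_indic.
Qed.

Lemma etaf_bounded z : `|etaf z| <= G0 * 1 * 1.
Proof.
rewrite /etaf !normrM; have /andP[h1 h2] := flam_range gP wl z.
have /andP[h3 h4] := indicator_range 0 t z.2.
apply: ler_pM => //; last exact: bump_norm.
by apply: ler_pM => //; rewrite ger0_norm.
Qed.

Lemma etaf_box z : ~ box A z -> etaf z = 0.
Proof.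
rewrite /etaf => /outside_box[h|[h|h]]; first by rewrite bump_far0 ?mulr0.
  by rewrite indicator_left ?mulr0 ?mul0r.
by rewrite indicator_right ?mulr0 ?mul0r.
Qed.

Lemma bump_shift_integral h : \int[mu]_x eta (x + h) = \int[mu]_x eta x.
Proof.
rewrite /Rintegral; congr fine; rewrite (integral_shift (f := EFin \o eta))//.
by apply/measurable_EFinP; exact: measurable_bump.
Qed.

(** Integrating in x first removes the time-dependent shift [q * tau s] by translation
    invariance. *)
Lemma etaw_integral :
  \int[mu2]_z etaw z = (\int[mu]_x eta x) * (t * G q + 3 * e * G0).
Proof.
rewrite (box_Rintegral21 measurable_etaw etaw_bounded etaw_box) /etaw/=.
rewrite -current_weight_integral -RintegralZl//; last exact: current_weight_integrable.
apply: eq_Rintegral => s _; under eq_Rintegral do rewrite mulrC.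
rewrite RintegralZl//; first by rewrite bump_shift_integral mulrC.
apply: (@line_integrable _ _ A 1) => [|x|x xA].
- apply: (measurableT_comp measurable_bump).
  by apply: measurable_funD => //; exact: measurable_id.
- exact: bump_norm.
- by apply: bump_far => //; exact: cutoff_norm.
Qed.

Lemma etaf_integral : \int[mu2]_z etaf z = \int[mu]_x (eta x * current t x).
Proof.
rewrite (box_Rintegral12 measurable_etaf etaf_bounded etaf_box) /etaf/=.
apply: eq_Rintegral => x _; under eq_Rintegral do rewrite mulrC.
by rewrite RintegralZl// ?currentE//; exact: current_integrable.
Qed.

Lemma height_shift_norm h x : `|x| <= A -> `|u0 (x - h)| <= `|u0 0| + L * (A + `|h|).
Proof.
move=> xA; have := mono_lip_lip (x - h) 0 u0L; rewrite subr0 => h1.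
have : L * `|x - h| <= L * (A + `|h|).
  by rewrite ler_wpM2l// (le_trans (ler_normB _ _))// lerD2r.
have := ler_normD (u0 (x - h) - u0 0) (u0 0); rewrite subrK; blra.
Qed.

Lemma bump_height_integrable h :
  mu.-integrable [set: R] (EFin \o (fun x => eta x * u0 (x - h))).
Proof.
apply: bump_integrable => [|x]; last exact: height_shift_norm.
apply: measurableT_comp; first exact: continuous_measurable_fun.
by apply: measurable_funB => //; exact: measurable_id.
Qed.

Lemma bump_current_integrable :
  mu.-integrable [set: R] (EFin \o (fun x => eta x * current t x)).
Proof.
apply: (@bump_integrable _ (t * G0)) => [|x _]; first exact: current_measurable.
by have /andP[h1 h2] := current_range x (ltW t0); rewrite ger0_norm.
Qed.

(** Integration by parts puts the derivative on [Phi], and a translation then moves the shift h from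
    [eta] to [u0]. *)
Lemma height_shear h (Phi := fun x => H (x + h) - H x) : `|h| <= `|q| * (2 * t) ->
  mu.-integrable [set: R] (EFin \o (fun x => rho0 x * Phi x)) /\
  \int[mu]_x (rho0 x * Phi x) =
    \int[mu]_x (eta x * u0 x) - \int[mu]_x (eta x * u0 (x - h)).
Proof.
move=> hq; pose dPhi x := eta (x + h) - eta x.
have dH : forall x : R, is_derive x 1 H (eta x) by exact: is_derive_trap_prim.
have ceta : continuous eta by exact: continuous_trap.
have dP : forall x : R, is_derive x 1 Phi (dPhi x) by move=> x; exact: is_derive_shear.
have cetah : continuous (fun x => eta (x + h)).
  by have := continuous_translate (a := - h) ceta; rewrite opprK.
have cdP : continuous dPhi by move=> x; apply: cvgB; [exact: cetah|exact: ceta].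
have PM x : `|Phi x| <= `|h| + 2.
  have := @derivable_lip R H 1 (x + h) x; have -> : x + h - x = h by ring.
  rewrite mul1r => Hl.
  rewrite (le_trans (Hl _ _)) ?lerDl//.
  by move=> z; rewrite (is_derive_derive1 (dH z)) bump_norm.
have dPM x : `|dPhi x| <= `|h| + 2.
  apply: le_trans (ler_normB _ _) _; have := bump_norm (x + h); have := bump_norm x.
  have := normr_ge0 h; blra.
have PA x : A < `|x| -> Phi x = 0 by move=> xA; rewrite /Phi bump_prim_far ?subrr.
have dPA x : A < `|x| -> dPhi x = 0.
  by move=> xA; rewrite /dPhi bump_far// bump_far0// subrr.
have [irP [iuP ->]] := height_by_parts L0 mrho0 rho0L u0E dP cdP PM dPM PA dPA.
split => //.
have iuP2 : mu.-integrable [set: R] (EFin \o (fun x => u0 x * eta x)).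
  by have := bump_height_integrable 0; apply: eq_integrable => // x _ /=; rewrite subr0 mulrC.
have iuP1 : mu.-integrable [set: R] (EFin \o (fun x => u0 x * eta (x + h))).
  have := integrable_realD measurableT iuP iuP2; apply: eq_integrable => // x _ /=.
  by rewrite /dPhi mulrBr subrK.
rewrite /dPhi; under eq_Rintegral do rewrite mulrBr.
rewrite RintegralB// opprB; congr (_ - _).
  by apply: eq_Rintegral => x _; rewrite mulrC.
have := @integral_shift R (EFin \o (fun x => eta x * u0 (x - h))) h.
rewrite /Rintegral /= => <-; last exact: measurable_int (bump_height_integrable h).
by congr fine; apply: eq_integral => x _; rewrite addrK mulrC.
Qed.

Lemma current_shear_inequality :
  \int[mu]_x (eta x * u0 (x - q * (t - 2 * e))) - \int[mu]_x (eta x * u0 x) <=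
  (\int[mu]_x eta x) * (t * G q + 3 * e * G0) - \int[mu]_x (eta x * current t x).
Proof.
have dH : forall x : R, is_derive x 1 H (eta x) by exact: is_derive_trap_prim.
have ceta : continuous eta by exact: continuous_trap.
have dt : forall s : R, is_derive s 1 tau (dtau s) by exact: is_derive_time_cutoff.
have cdt : continuous dtau by exact: continuous_time_cutoff_deriv.
have tphi := shear_test_function dH ceta dt cdt cutoff_far
  (fun x s => @bump_prim_far x (q * tau s) (cutoff_norm s)).
set phi := (fun x s : R => H (x + q * tau s) - H x) in tphi.
have phix x s : derive1 (phi ^~ s) x = eta (x + q * tau s) - eta x.
  exact: is_derive_derive1 (is_derive_shear (q * tau s) x dH).
have phit x s : derive1 (phi x) s = eta (x + q * tau s) * (q * dtau s).
  exact: is_derive_derive1 (is_derive_shear_time q x s dH dt).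
have [A' [C AC]] := test_function_bounds tphi.
have early x s : 0 < s <= e -> derive1 (phi x) s = 0.
  move=> /andP[s0 se]; rewrite phit time_cutoff_derivE; last exact: ltW.
  have -> : trap e (t - e) e s = 0 by apply: trap_left => //; blra.
  by rewrite oppr0 !mulr0.
have [] := weak_plane_identity gP wl tphi AC e0 early.
set k := (fun z : R * R => _) => ik Ik.
have i2 := box_integrable measurable_etaw etaw_bounded etaw_box.
have i3 := box_integrable measurable_etaf etaf_bounded etaf_box.
have : \int[mu2]_z k z <= \int[mu2]_z etaw z - \int[mu2]_z etaf z.
  rewrite -RintegralB//; apply: le_Rintegral => //; first exact: integrable_realB.
  by move=> [x s] _; rewrite /k /= phit phix; exact: shear_pointwise.
have tau0 : q * tau 0 = q * (t - 2 * e).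
  rewrite time_cutoffE// trap_prim_left//; [by ring|blra|blra].
have hq : `|q * (t - 2 * e)| <= `|q| * (2 * t) by rewrite -tau0 cutoff_norm.
have [irP IP] := height_shear hq.
have IPhi : (\int[mu]_x (rho0 x * phi x 0)%:E)%E =
    (\int[mu]_x (rho0 x * (H (x + q * (t - 2 * e)) - H x)))%:E.
  rewrite -(integral_real_EFin measurableT irP); apply: eq_integral => x _.
  by rewrite /phi /= tau0.
have -> : \int[mu2]_z k z = - \int[mu]_x (rho0 x * (H (x + q * (t - 2 * e)) - H x)).
  move: Ik; rewrite IPhi (integral_real_EFin measurableT ik) -EFinD => -[] /eqP.
  by rewrite addr_eq0 => /eqP.
by rewrite IP etaw_integral etaf_integral opprB.
Qed.

(** Replacing the shift [q * (t - 2 * e)] by [q * t] costs at most [2 * e * |q| * L]; the part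
    [3 * e * G0] comes from the two ends of the cutoff. Both vanish with e. *)
Lemma current_bump_inequality :
  0 <= \int[mu]_x (eta x * (t * G q + u0 x - u0 (x - q * t) - current t x +
    e * (3 * G0 + 2 * `|q| * L))).
Proof.
pose c := t * G q + 3 * e * G0.
have ieta : mu.-integrable [set: R] (EFin \o eta).
  exact: (line_integrable measurable_bump bump_norm bump_far0).
have ic := integrable_realZ measurableT c ieta.
have iu := bump_height_integrable.
have iu0 : mu.-integrable [set: R] (EFin \o (fun x => eta x * u0 x)).
  by have := iu 0; apply: eq_integrable => // x _ /=; rewrite subr0.
have iA := bump_current_integrable.
have j1 := integrable_realD measurableT ic iu0.
have j2 := integrable_realB measurableT j1 (iu (q * (t - 2 * e))).
have j3 := integrable_realB measurableT j2 iA.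
apply: (@le_trans _ _ (\int[mu]_x (c * eta x + eta x * u0 x - eta x * u0 (x - q * (t - 2 * e))
    - eta x * current t x))).
  rewrite RintegralB// RintegralB// RintegralD// RintegralZl//.
  by have := current_shear_inequality; rewrite /c; blra.
have j4 := iu (q * t); have j5 := integrable_realZ measurableT (t * G q + e * (3 * G0 + 2 * `|q| * L)) ieta.
apply: le_Rintegral => //.
  have := integrable_realB measurableT (integrable_realB measurableT (integrable_realD measurableT j5 iu0) j4) iA.
  by apply: eq_integrable => // x _ /=; congr EFin; ring.
move=> x _.
have := mono_lip_lip (x - q * t) (x - q * (t - 2 * e)) u0L.
have -> : x - q * t - (x - q * (t - 2 * e)) = - (q * (2 * e)) by ring.
rewrite normrN normrM (gtr0_norm (x := 2 * e)) ?mulr_gt0// ler_norml => /andP[_ h].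
have := ler_wpM2l (trap_ge0 x d0 ab) h; rewrite mulrBr /c => h'.
rewrite -subr_ge0; move: h'; rewrite -subr_ge0 => h'; apply: le_trans h' _.
by rewrite le_eqVlt; apply/orP; left; apply/eqP; ring.
Qed.

End bump.

End current_inequality.

Section countable_ae.
Context d (T : measurableType d) (R : realType) (nu : {measure set T -> \bar R}).

Lemma ae_forall_countable (I : countType) (P : I -> T -> Prop) :
  (forall i, {ae nu, forall x, P i x}) -> {ae nu, forall x, forall i, P i x}.
Proof.
move=> Pae; have /ae_foralln : forall n : nat,
    {ae nu, forall x, if @choice.unpickle I n is Some i then P i x else True}.
  by move=> n; case: (@choice.unpickle I n) => [i|]; [exact: Pae|exact: aeW].
by apply: aeS => x Px i; have := Px (choice.pickle i); rewrite choice.pickleK.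
Qed.

End countable_ae.

Section plane_ae.
Context {R : realType}.
Local Notation mu := (@lebesgue_measure R).
Local Notation mu2 := (mu \x mu)%E.

Lemma ae_prod_of_xsections (P : R * R -> Prop) : measurable [set z | P z] ->
  {ae mu, forall x, {ae mu, forall t, P (x, t)}} -> {ae mu2, forall z, P z}.
Proof.
move=> mP Px; set N := ~` [set z | P z].
have mN : measurable N by exact: measurableC.
exists N; split => //; rewrite -[RHS](@integral0 _ _ _ mu setT).
apply: ae_eq_integral => //; first exact: (measurable_fun_xsection mu mN).
apply: aeS Px => x [M [mM M0 PM]] _ /=; apply/eqP; rewrite -measure_le0 -M0.
apply: le_measure; rewrite ?inE//; first exact: measurable_xsection.
by move=> t; rewrite /xsection/= inE => /PM.
Qed.

Lemma ae_prod_eq0 (k : R * R -> R) : measurable_fun [set: R * R] k ->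
  {ae mu, forall x, {ae mu, forall t, k (x, t) = 0}} -> {ae mu2, forall z, k z = 0}.
Proof.
move=> mk; apply: ae_prod_of_xsections.
have := mk measurableT [set 0] (measurable_set1 _).
by rewrite setTI.
Qed.

Lemma ae_exists_itv (P : R -> Prop) (a b : R) : a < b -> {ae mu, forall t, P t} ->
  exists t, a < t < b /\ P t.
Proof.
move=> ab [N [mN N0 PN]]; apply: contrapT => h.
have : (mu `]a, b[%classic <= mu N)%E.
  apply: le_measure; rewrite ?inE// => t /= tab; apply: PN => /= Pt.
  by apply: h; exists t; rewrite in_itv/= in tab.
rewrite N0 lebesgue_measure_itv/= lte_fin ab -EFinD lee_fin.
by rewrite leNgt subr_gt0 ab.
Qed.

Lemma ge0_of_invS (w c : R) : (forall n : nat, 0 <= w + c * n.+1%:R^-1) -> 0 <= w.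
Proof.
move=> h; have cv : (fun n : nat => w + c * n.+1%:R^-1) @ \oo --> w.
  rewrite -[X in _ --> X]addr0 -(mulr0 c); apply: cvgD; first exact: cvg_cst.
  by apply: cvgM; [exact: cvg_cst|exact: cvg_invS0].
rewrite -(cvg_lim (@Rhausdorff R) cv); apply: limr_ge; first exact: (cvgP _ cv).
exact: nearW.
Qed.

Lemma ae_ge0_of_bumps (W : R -> R) (C : R) : measurable_fun [set: R] W ->
  (forall x, `|W x| <= C) ->
  (forall a b d : R, a <= b -> 0 < d -> 0 <= \int[mu]_x (trap a b d x * W x)) ->
  {ae mu, forall x, 0 <= W x}.
Proof.
move=> mW WC W0; apply: (ae_ge0_of_intervals mW WC) => p q pq.
set a := ratr p; set b := ratr q; have ab : a <= b by rewrite ler_rat.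
have n0 n : 0 < n.+1%:R^-1 :> R by rewrite invr_gt0.
have n1 n : n.+1%:R^-1 <= 1 :> R by rewrite invf_le1// ler1n.
pose A := `|a| + `|b| + 1.
have C0 : 0 <= C := le_trans (normr_ge0 _) (WC 0).
have mt n : measurable_fun [set: R] (fun x => trap a b n.+1%:R^-1 x * W x).
  by apply: measurable_funM => //; apply: continuous_measurable_fun; exact: continuous_trap.
have tC n x : `|trap a b n.+1%:R^-1 x * W x| <= C.
  rewrite normrM -[leRHS]mul1r; apply: ler_pM => //.
  by rewrite ger0_norm ?trap_le1// trap_ge0.
have tA n x : A < `|x| -> trap a b n.+1%:R^-1 x * W x = 0.
  move=> xA; rewrite trap_far ?mul0r//; apply: le_lt_trans xA.
  by rewrite lerD2l.
have ti n := line_integrable (mt n) (tC n) (tA n).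
have cvx (x : R) : trap a b n.+1%:R^-1 x * W x @[n --> \oo] -->
    ((\1_(`]a, b]%classic) : R -> R) \* W) x.
  by apply: cvgM; [exact: trap_cvg|exact: cvg_cst].
have cv := line_dominated_cvg mt
  (measurable_funM (measurable_indic (measurable_itv `]a, b])) mW) tC tA cvx.
rewrite /Rintegral integral_mkcond; apply: fine_ge0.
have -> : (\int[mu]_x ((fun x => (W x)%:E) \_ `]a, b]) x =
    \int[mu]_x ((\1_(`]a, b]%classic) \* W) x)%:E)%E.
  apply: eq_integral => x _; rewrite patchE /= indicE.
  by case: ifPn => _; rewrite ?mul1r ?mul0r.
rewrite -(cvg_lim (@ereal_hausdorff R) cv); apply: lime_ge; first exact: (cvgP _ cv).
apply: nearW => n; rewrite (integral_real_EFin measurableT (ti n)) lee_fin; exact: W0.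
Qed.

End plane_ae.

(** * Optimizing over the velocity *)

Section maximal_current.
Context {R : realType} (K : option nat) (g : R -> \bar R) (rho0 u0 : R -> R) (L : R).
Variable lambda : R -> R -> R.
Local Notation mu := (@lebesgue_measure R).
Local Notation mu2 := (mu \x mu)%E.
Hypothesis gP : shape_bounds K g.
Hypothesis L0 : 0 <= L.
Hypothesis LK : (L%:E <= capacity R K)%E.
Hypothesis mrho0 : measurable_fun [set: R] rho0.
Hypothesis rho0L : forall x, 0 <= rho0 x <= L.
Hypothesis u0E : forall a b : R, a < b ->
  (u0 b - u0 a)%:E = (\int[mu]_(x in `[a, b]) (rho0 x)%:E)%E.
Local Notation f := (flux g).
Local Notation u := (hopf_lax g u0).
Local Notation rho := (hopf_lax_density g u0).
Local Notation G := (fun q => fine (g q)).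
Local Notation G0 := (fine (g 0%R)).
Hypothesis wl : weak_solution K f rho0 lambda.

Let u0L : mono_lip L u0 := height_mono_lip mrho0 rho0L u0E.

Lemma current_le_velocity (q t : R) : (g q < +oo)%E -> 0 < t ->
  {ae mu, forall x, current g lambda t x <= t * G q + u0 x - u0 (x - q * t)}.
Proof.
move=> gq t0; pose A x := current g lambda t x.
have mA : measurable_fun [set: R] A := current_measurable gP wl t.
have A0 x : 0 <= A x <= t * G0 := current_range gP wl x (ltW t0).
have Gq0 := shape_real_ge0 gP q; have G00 := shape_real_ge0 gP 0.
pose W x := t * G q + u0 x - u0 (x - q * t) - A x.
have cu0 := mono_lip_continuous u0L.
have mW : measurable_fun [set: R] W.
  apply: measurable_funB => //; apply: measurable_funB.
    by apply: measurable_funD => //; exact: continuous_measurable_fun.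
  apply: measurableT_comp; first exact: continuous_measurable_fun.
  by apply: measurable_funB => //; exact: measurable_id.
have WC x : `|W x| <= t * G q + L * `|q * t| + t * G0.
  have := mono_lip_lip x (x - q * t) u0L; have /andP[h1 h2] := A0 x.
  rewrite opprB addrCA subrr addr0 => h3.
  have h4 : 0 <= t * G q by rewrite mulr_ge0// ltW.
  move: h3; rewrite /W !ler_norml => /andP[h5 h6]; apply/andP; split; lra.
pose c := t / 4 * (3 * G0 + 2 * `|q| * L).
have /ae_foralln : forall n : nat, {ae mu, forall x, 0 <= W x + c * n.+1%:R^-1}.
  move=> n; have n0 : 0 < n.+1%:R^-1 :> R by rewrite invr_gt0.
  have n1 : n.+1%:R^-1 <= 1 :> R by rewrite invf_le1// ler1n.
  apply: (@ae_ge0_of_bumps _ _ (t * G q + L * `|q * t| + t * G0 + `|c * n.+1%:R^-1|)).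
  - exact: measurable_funD.
  - by move=> x; rewrite (le_trans (ler_normD _ _))// lerD2r.
  (* The factor [t / 4] ensures [4 * e <= t] for every n. The null set may depend on e, so e runs
     through a sequence only. *)
  move=> a b d ab d0; pose e := t / 4 * n.+1%:R^-1.
  have e0 : 0 < e by rewrite mulr_gt0// divr_gt0.
  have et : 4 * e <= t.
    have : t * n.+1%:R^-1 <= t * 1 by rewrite ler_wpM2l// ltW.
    by rewrite /e; move: (n.+1%:R^-1 : R) => z; lra.
  have -> : c * n.+1%:R^-1 = e * (3 * G0 + 2 * `|q| * L) by rewrite /c /e; ring.
  exact: (current_bump_inequality gP L0 mrho0 rho0L u0E wl gq ab d0 e0 et).
apply: aeS => x /ge0_of_invS; rewrite /W /A subr_ge0; exact.
Qed.

(** The null set of the bound for one velocity depends on q, so the bound is collected over rational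
    velocities. An arbitrary q is approximated from the right: [g] does not increase, and moving the
    argument of [u0] by at most [t * d] costs at most e. *)
Lemma current_le_height (t : R) : 0 < t ->
  {ae mu, forall x, current g lambda t x <= u0 x - u x t}.
Proof.
move=> t0; have : {ae mu, forall x, forall r : rat, (g (ratr r) < +oo)%E ->
    current g lambda t x <= t * G (ratr r) + u0 x - u0 (x - ratr r * t)}.
  apply: ae_forall_countable => r; have [gr|gr] := pselect (g (ratr r) < +oo)%E.
    by apply: aeS (current_le_velocity gr t0).
  by apply: aeW => x /gr.
apply: aeS => x Ax; rewrite lerBrDr addrC -lerBrDr.
apply: (hopf_lax_le gP L0 LK u0L) => // q gq.
apply/ler_addgt0Pl => e e0.
pose d := e / (L * t + 1).
have Lt : 0 <= L * t by rewrite mulr_ge0// ltW.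
have d0 : 0 < d by rewrite divr_gt0// ltr_wpDl.
have [r] := @rat_in_itvoo R q (q + d) ltac:(by rewrite ltrDl).
rewrite in_itv/= => /andP[qr rqd].
have gr : (g (ratr r) < +oo)%E by apply: le_lt_trans gq; apply: (sb_noninc gP); exact: ltW.
have h1 := Ax r gr; have h2 := shape_real_noninc gP (ltW qr) gq.
have h3 := mono_lip_lip (x - t * q) (x - ratr r * t) u0L.
have h4 : `|x - t * q - (x - ratr r * t)| <= t * d.
  have -> : x - t * q - (x - ratr r * t) = t * (ratr r - q) by ring.
  rewrite normrM (gtr0_norm t0) ler_wpM2l//; first exact: ltW.
  by rewrite ger0_norm ?subr_ge0 ?(ltW qr)//; lra.
have h5 : L * `|x - t * q - (x - ratr r * t)| <= e.
  apply: (@le_trans _ _ (L * (t * d))); first by rewrite ler_wpM2l.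
  have : (L * t + 1) * d = e by rewrite mulrC divfK// gt_eqF// ltr_wpDl.
  by rewrite mulrA mulrDl mul1r; lra.
have h6 : t * G (ratr r) <= t * G q by rewrite ler_wpM2l// ltW.
have := le_trans (ler_norm _) (le_trans h3 h5); lra.
Qed.

Lemma current_EFin t x :
  (\int[mu]_(s in `]0%R, t]) (f (lambda x s))%:E)%E = (current g lambda t x)%:E.
Proof.
rewrite currentE -(integral_real_EFin measurableT (current_integrable gP wl t x)).
rewrite [LHS]integral_mkcond; apply: eq_integral => s _.
by have := current_restrict g lambda t x s; rewrite !patchE; case: ifP => _ <-.
Qed.

Lemma current_maximal (t : R) : 0 < t -> {ae mu, forall x,
  (\int[mu]_(s in `]0%R, t]) (f (lambda x s))%:E <=
   \int[mu]_(s in `]0%R, t]) (f (rho x s))%:E)%E}.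
Proof.
move=> t0; apply: aeS2 (current_le_height t0)
  (density_flux_integral gP L0 LK mrho0 rho0L u0E (ltW t0)) => x lex ->.
by rewrite current_EFin lee_fin.
Qed.

End maximal_current.

(** * Uniqueness *)

Section smooth_bumps.
Context {R : realType}.
Implicit Types (a b d x : R).

(** A test function has to be C^1 in x, hence [smooth_step]; in time a trapezoid suffices, because
    up to sign it is the derivative of [time_cutoff] for s >= 0. *)
Definition smooth_bump a b d x := smooth_step d (x - a) - smooth_step d (x - b).
Definition smooth_bump_deriv a b d x :=
  d^-1 * (ramp d (x - a) - ramp d (x - a - d)) -
  d^-1 * (ramp d (x - b) - ramp d (x - b - d)).

Lemma is_derive_smooth_bump a b d x :
  is_derive x 1 (smooth_bump a b d) (smooth_bump_deriv a b d x).
Proof.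
have h := @is_derive_smooth_step R d.
exact: (is_deriveB (is_derive_translate a x h) (is_derive_translate b x h)).
Qed.

Lemma continuous_smooth_bump_deriv a b d : continuous (smooth_bump_deriv a b d).
Proof.
have h := @continuous_smooth_step_deriv R d.
move=> x; apply: cvgB.
  exact: (continuous_translate (a := a) h).
exact: (continuous_translate (a := b) h).
Qed.

Lemma smooth_bump_norm a b d x : 0 < d -> `|smooth_bump a b d x| <= 2.
Proof.
move=> d0; apply: le_trans (ler_normB _ _) _.
have := smooth_step_norm (x - a) d0; have := smooth_step_norm (x - b) d0; lra.
Qed.

Lemma smooth_bump_far a b d x : 0 < d -> `|a| + `|b| + 2 * d < `|x| -> smooth_bump a b d x = 0.
Proof.
move=> d0 xA; rewrite /smooth_bump.
have b1 := ler_norm b; have a1 := ler_norm (- a); rewrite normrN in a1.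
have b2 := ler_norm (- b); rewrite normrN in b2; have a2 := ler_norm a.
have b0 := normr_ge0 b; have a0 := normr_ge0 a.
have [x0|x0] := leP 0 x.
  by rewrite (ger0_norm x0) in xA; rewrite !(smooth_step1 d0) ?subrr//; lra.
by rewrite (ltr0_norm x0) in xA; rewrite !(smooth_step0 d0) ?subrr//; lra.
Qed.

Lemma smooth_bump_cvg a b x : a <= b ->
  smooth_bump a b n.+1%:R^-1 x @[n --> \oo] --> (\1_(`]a, b]%classic) x : R).
Proof.
move=> ab; have -> : (\1_(`]a, b]%classic) x : R) =
    \1_(`]0, +oo[%classic) (x - a) - \1_(`]0, +oo[%classic) (x - b).
  have [xa|ax] := leP x a.
    rewrite !indicE !memNset ?subrr//= in_itv/= ?andbT.
    - by rewrite subr_gt0 => /lt_geF; rewrite (le_trans xa).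
    - by rewrite subr_gt0 => /lt_geF; rewrite xa.
    - by move=> /andP[/lt_geF]; rewrite xa.
  rewrite !indicE (mem_set (A := `]0, +oo[%classic) (u := x - a)); last by rewrite /= in_itv/= andbT subr_gt0.
  have [xb|bx] := leP x b.
    rewrite mem_set ?memNset ?subr0//= in_itv/= ?andbT ?ax//.
    by rewrite subr_gt0 ltNge xb.
  rewrite memNset ?mem_set ?subrr//= in_itv/= ?andbT ?subr_gt0//.
  by move=> /andP[_]; rewrite leNgt bx.
by apply: cvgB; exact: smooth_step_cvg.
Qed.

End smooth_bumps.

Section primitive_uniqueness.
Context {R : realType}.
Local Notation mu := (@lebesgue_measure R).

(** The primitive is Lipschitz, so if it vanishes at almost every t it vanishes at every t > 0, and
    then the integrals over all rational intervals vanish. *)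
Lemma ae_eq0_of_primitive (h : R -> R) (C : R) : measurable_fun [set: R] h ->
  (forall s, `|h s| <= C) -> (forall s, s <= 0 -> h s = 0) ->
  {ae mu, forall t, 0 < t -> \int[mu]_(s in `]0, t]) h s = 0} ->
  {ae mu, forall s, h s = 0}.
Proof.
move=> mh hC h0 Fae.
have C0 : 0 <= C := le_trans (normr_ge0 _) (hC 0).
have F0 t : 0 < t -> \int[mu]_(s in `]0, t]) h s = 0.
  move=> t0; apply/eqP; rewrite -normr_eq0 eq_le normr_ge0 andbT.
  apply/ler_addgt0Pl => e e0; rewrite addr0.
  pose d := e / (C + 1); have d0 : 0 < d by rewrite divr_gt0// ltr_wpDl.
  have td : t < t + d by rewrite ltrDl.
  have [t' [/andP[tt' t'd] Ft']] := ae_exists_itv td Fae.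
  have := bounded_integral_cat mh hC (ltW t0) (ltW tt').
  rewrite Ft'; last exact: lt_trans tt'.
  move=> /esym/eqP; rewrite addr_eq0 => /eqP ->; rewrite normrN.
  apply: le_trans (bounded_integral_norm mh hC (ltW tt')) _.
  apply: (@le_trans _ _ (C * d)); first by rewrite ler_wpM2l//; lra.
  have : (C + 1) * d = e by rewrite mulrC divfK// gt_eqF// ltr_wpDl.
  by rewrite mulrDl mul1r; lra.
have neg a b : b <= 0 -> \int[mu]_(s in `]a, b]) h s = 0.
  move=> b0; rewrite (@eq_Rintegral _ _ _ mu _ (cst 0)).
    by rewrite Rintegral_cst//= mul0r.
  by move=> s; rewrite inE/= in_itv/= => /andP[_ sb]; rewrite h0// (le_trans sb).
apply: (ae_eq0_of_intervals mh hC) => p q pq.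
have : ratr p <= ratr q :> R by rewrite ler_rat.
move: (ratr p) (ratr q) => a b ab.
have [b0|b0] := leP b 0; first exact: neg.
have [a0|a0] := leP a 0.
  by rewrite (bounded_integral_cat mh hC a0 (ltW b0)) neg// F0// addr0.
have := bounded_integral_cat mh hC (ltW a0) ab.
by rewrite !F0// add0r => /esym.
Qed.

End primitive_uniqueness.

Lemma patch_indicator (T : Type) (R : realType) (k : T -> R) (A : set T) x :
  (k \_ A) x = k x * \1_A x.
Proof. by rewrite patchE indicE; case: (x \in A); rewrite ?mulr1 ?mulr0. Qed.

(** In its use r is the initial integral shared by two weak identities; either equation forces it to
    be finite, so it cancels. *)
Lemma addr_fin_inj (R : realType) (a b : R) (r : \bar R) :
  (a%:E + r = 0 -> b%:E + r = 0 -> a = b)%E.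
Proof.
case: r => [r| |]//; rewrite -!EFinD => -[] h1 -[] h2.
by apply: (addIr r); rewrite h1 h2.
Qed.

(** * Two weak solutions with equal currents *)

Section equal_currents.
Context {R : realType} (K : option nat) (g : R -> \bar R) (rho0 : R -> R).
Variables l1 l2 : R -> R -> R.
Local Notation mu := (@lebesgue_measure R).
Local Notation mu2 := (mu \x mu)%E.
Hypothesis gP : shape_bounds K g.
Local Notation f := (flux g).
Local Notation G0 := (fine (g 0%R)).
Hypothesis w1 : weak_solution K f rho0 l1.
Hypothesis w2 : weak_solution K f rho0 l2.
Local Notation ext k := (half_plane_extension k).
Local Notation f1 := (half_plane_extension (fun x t => f (l1 x t))).
Local Notation f2 := (half_plane_extension (fun x t => f (l2 x t))).

Lemma equal_currents_flux :
  {ae mu2, forall z : R * R, 0 < z.2 ->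
    (\int[mu]_(s in `]0%R, z.2]) (f (l1 z.1 s))%:E =
     \int[mu]_(s in `]0%R, z.2]) (f (l2 z.1 s))%:E)%E} ->
  {ae mu2, forall z, f1 z = f2 z}.
Proof.
move=> eqc; have m1 := flam_measurable gP w1; have m2 := flam_measurable gP w2.
pose h z := f1 z - f2 z.
have mh : measurable_fun [set: R * R] h by exact: measurable_funB.
suff : {ae mu2, forall z, h z = 0}.
  by apply: aeS => z; rewrite /h => /eqP; rewrite subr_eq0 => /eqP.
apply: ae_prod_eq0 => //.
apply: aeS (ae_prod_xsection eqc) => x eqx.
have hC s : `|h (x, s)| <= G0 + G0.
  have /andP[a1 a2] := flam_range gP w1 (x, s); have /andP[a3 a4] := flam_range gP w2 (x, s).
  by rewrite (le_trans (ler_normB _ _))// !ger0_norm// lerD.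
apply: (@ae_eq0_of_primitive _ (fun s => h (x, s)) (G0 + G0)) => //.
- exact: (measurable_fun_pair2 x mh).
- by move=> s s0; rewrite /h /half_plane_extension/= ltNge s0/= subrr.
apply: aeS eqx => t /= eqt t0; have := eqt t0.
rewrite (current_EFin gP w1) (current_EFin gP w2) !currentE => -[/eqP].
rewrite -subr_eq0 -RintegralB//; [|exact: (current_integrable gP w1)|exact: (current_integrable gP w2)].
move=> /eqP E; rewrite -[RHS]E [LHS]Rintegral_mkcond; congr Rintegral; apply/funext => s.
by rewrite (patch_indicator (fun s => h (x, s))) -mulrBl.
Qed.

Hypothesis ff : {ae mu2, forall z, f1 z = f2 z}.

Local Notation D := (fun z : R * R => ext l1 z - ext l2 z).

Lemma difference_measurable : measurable_fun [set: R * R] D.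
Proof. by apply: measurable_funB; [exact: (lam_measurable w1)|exact: (lam_measurable w2)]. Qed.

Lemma difference_product_measurable (v w : R -> R) : measurable_fun [set: R] v ->
  measurable_fun [set: R] w -> measurable_fun [set: R * R] (fun z => D z * (v z.1 * w z.2)).
Proof.
move=> mv mw; apply: measurable_funM; first exact: difference_measurable.
by apply: measurable_funM; [exact: (measurableT_comp mv measurable_fst)|
  exact: (measurableT_comp mw measurable_snd)].
Qed.

Lemma difference_bounded (A c : R) : 0 < c -> exists B, 0 <= B /\
  forall z, `|z.1| <= A -> c <= z.2 <= A -> `|D z| <= B.
Proof.
move=> c0; have [B1 [B10 h1]] := weak_bounded_slab w1 A c0.
have [B2 [B20 h2]] := weak_bounded_slab w2 A c0.
exists (B1 + B2); split; first exact: addr_ge0.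
move=> [x t] /= xA tA; have t0 : 0 < t by have /andP[ct _] := tA; exact: lt_le_trans ct.
rewrite /half_plane_extension/= t0 (le_trans (ler_normB _ _))// lerD//.
  exact: h1.
exact: h2.
Qed.

Lemma difference_bump (a b c e d : R) : 0 < d -> 0 < c -> c <= e ->
  \int[mu2]_z (D z * (smooth_bump a b d z.1 * trap c e d z.2)) = 0.
Proof.
move=> d0 c0 ce; pose A := `|a| + `|b| + 2 * d + e + 1.
have na := normr_ge0 a; have nb := normr_ge0 b.
have tA s : A < `|s| -> time_cutoff c e d s = 0.
  by move=> sA; apply: time_cutoff_support => //; rewrite /A in sA; lra.
have pA x : A < `|x| -> smooth_bump a b d x = 0.
  by move=> xA; apply: smooth_bump_far => //; rewrite /A in xA; lra.
have dp := @is_derive_smooth_bump R a b d; have cp := @continuous_smooth_bump_deriv R a b d.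
have dt := @is_derive_time_cutoff R c e d; have ct := @continuous_time_cutoff_deriv R c e d.
have tphi := product_test_function dp cp dt ct tA pA.
set phi := (fun x s : R => _) in tphi.
have phit x s : derive1 (phi x) s = smooth_bump a b d x * time_cutoff_deriv c e d s.
  exact: (is_derive_derive1 (is_deriveZ (smooth_bump a b d x) (dt s))).
have early x s : 0 < s <= c -> derive1 (phi x) s = 0.
  move=> /andP[s0 sc]; rewrite phit time_cutoff_derivE; last exact: ltW.
  by rewrite trap_left ?oppr0 ?mulr0.
have [A' [C AC]] := test_function_bounds tphi.
have [i1 e1] := weak_plane_identity gP w1 tphi AC c0 early.
have [i2 e2] := weak_plane_identity gP w2 tphi AC c0 early.
move: i1 e1 i2 e2; set k1 := (fun z : R * R => _) => i1 e1; set k2 := (fun z : R * R => _) => i2 e2.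
have k12 : \int[mu2]_z k1 z = \int[mu2]_z k2 z.
  move: e1 e2; rewrite (integral_real_EFin measurableT i1) (integral_real_EFin measurableT i2).
  exact: addr_fin_inj.
have mk12 : measurable_fun [set: R * R] (fun z => k1 z - k2 z).
  by apply/measurable_EFinP; exact: measurable_int (integrable_realB measurableT i1 i2).
(* The factor -1 matches the time derivative of the cutoff, which is [- trap] for s >= 0; the flux
   terms cancel by [ff]. *)
have : \int[mu2]_z (-1 * (k1 z - k2 z)) = 0.
  by rewrite RintegralZl//; [rewrite RintegralB// k12 subrr mulr0|exact: integrable_realB].
rewrite /Rintegral => <-; congr fine; apply: ae_eq_integral => //.
- apply/measurable_EFinP; apply: difference_product_measurable.
    by apply: continuous_measurable_fun; exact: is_derive_continuous dp.
  by apply: continuous_measurable_fun; exact: continuous_trap.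
- by apply/measurable_EFinP; apply: measurable_funM => //; exact: measurable_cst.
apply: aeS ff => -[x s] fe _; congr EFin; rewrite /k1 /k2 /= fe phit.
have [s0|s0] := leP s 0.
  by rewrite /half_plane_extension/= ltNge s0/= subrr !mul0r subrr mulr0.
rewrite time_cutoff_derivE; last exact: ltW.
by rewrite mulN1r; ring.
Qed.

Lemma difference_rectangle (a b c e : R) : a <= b -> 0 < c -> c <= e ->
  \int[mu2]_z (D z * (\1_(`]a, b]%classic) z.1 * \1_(`]c, e]%classic) z.2)) = 0.
Proof.
move=> ab c0 ce; have na := normr_ge0 a; have nb := normr_ge0 b.
have e0 : 0 < e by exact: lt_le_trans ce.
(* This bounds the supports for all n at once, since the smoothing width 1/(n+1) is at most 1; in
   time they start at c > 0, where [D] is bounded. *)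
pose A := `|a| + `|b| + 2 + e.
have [B [B0 DB]] := difference_bounded A c0.
have n0 n : 0 < n.+1%:R^-1 :> R by rewrite invr_gt0.
have n1 n : n.+1%:R^-1 <= 1 :> R by rewrite invf_le1// ler1n.
pose k_ n (z : R * R) := D z * (smooth_bump a b n.+1%:R^-1 z.1 * trap c e n.+1%:R^-1 z.2).
have out n z : A < `|z.1| \/ (z.2 <= c \/ A < z.2) -> k_ n z = 0.
  rewrite /k_ => -[xA|[sc|sA]].
  - rewrite smooth_bump_far ?mul0r ?mulr0//; apply: le_lt_trans xA.
    by have := n1 n; rewrite /A; move: (n.+1%:R^-1 : R) => y; lra.
  - by rewrite (trap_left (n0 n) ce sc) !mulr0.
  - rewrite (trap_right (n0 n) ce) ?mulr0//; apply: le_trans (ltW sA).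
    by have := n1 n; rewrite /A; move: (n.+1%:R^-1 : R) => y; lra.
have mk n : measurable_fun [set: R * R] (k_ n).
  apply: difference_product_measurable; apply: continuous_measurable_fun.
    exact: is_derive_continuous (@is_derive_smooth_bump R a b _).
  exact: continuous_trap.
have kC n z : `|k_ n z| <= B * (2 * 1).
  have [xA|xA] := ltP A `|z.1|; first by rewrite out ?normr0 ?mulr_ge0//; left.
  have [sc|sc] := leP z.2 c; first by rewrite out ?normr0 ?mulr_ge0//; right; left.
  have [sA|sA] := ltP A z.2; first by rewrite out ?normr0 ?mulr_ge0//; right; right.
  rewrite normrM; apply: ler_pM => //; first by apply: DB => //; rewrite (ltW sc).
  rewrite normrM; apply: ler_pM => //; first exact: smooth_bump_norm.
  by rewrite ger0_norm ?trap_le1// trap_ge0.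
have kA n z : ~ box A z -> k_ n z = 0.
  case: z => x s /boxP h; apply: out => /=; have [xA|xA] := ltP A `|x|; [by left|right].
  have [sc|sc] := leP s c; [by left|right].
  rewrite ltNge; apply/negP => sA; apply: h; split => //.
  by rewrite gtr0_norm// (lt_trans c0).
pose k (z : R * R) := D z * (\1_(`]a, b]%classic) z.1 * \1_(`]c, e]%classic) z.2).
have mk0 : measurable_fun [set: R * R] k.
  by apply: difference_product_measurable; exact: measurable_indic.
have kk z : k_ n z @[n --> \oo] --> k z.
  apply: cvgM; first exact: cvg_cst.
  by apply: cvgM; [exact: smooth_bump_cvg|exact: trap_cvg].
have cv := box_dominated_cvg mk mk0 kC kA (aeW mu2 kk).
have k0 n : (\int[mu2]_z (k_ n z)%:E)%E = 0%E.
  rewrite (integral_real_EFin measurableT (box_integrable (mk n) (kC n) (kA n))).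
  by rewrite difference_bump.
rewrite /Rintegral -/(k _); have -> : (\int[mu2]_z (k z)%:E)%E = 0%E.
  rewrite (funext k0) in cv.
  exact: (cvg_unique (@ereal_hausdorff R) cv (cvg_cst _)).
by [].
Qed.

Lemma indicator_itv_cap (a b c e x : R) :
  \1_(`]a, b]%classic) x * \1_(`]c, e]%classic) x =
  (\1_(`]Num.max a c, Num.min b e]%classic) x : R).
Proof.
rewrite !indicE -natrM mulnb -in_setI; congr (_ \in _)%:R; apply/seteqP; split => y /=.
  by rewrite !in_itv/= gt_max le_min => -[/andP[-> ->] /andP[-> ->]].
by rewrite !in_itv/= gt_max le_min => /andP[/andP[-> ->] /andP[-> ->]].
Qed.

(** [D] has a uniform bound only away from t = 0, so it is cut to a slab. The interval criterion is
    then applied twice: in x, to the integrals over each rational time interval, and afterwards in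
    t, at almost every x. *)
Lemma difference_slab_eq0 (n : nat) (N := n.+1%:R : R) : {ae mu2, forall z,
  D z * (\1_(`]- N, N]%classic) z.1 * \1_(`]N^-1, N]%classic) z.2) = 0}.
Proof.
have N1 : 1 <= N by rewrite ler1n.
have N0 : 0 < N^-1 by rewrite invr_gt0; exact: lt_le_trans N1.
have [B [B0 DB]] := difference_bounded N N0.
pose k (z : R * R) := D z * (\1_(`]- N, N]%classic) z.1 * \1_(`]N^-1, N]%classic) z.2).
have mk : measurable_fun [set: R * R] k.
  by apply: difference_product_measurable; exact: measurable_indic.
have kA z : ~ (`|z.1| <= N /\ N^-1 <= z.2 <= N) -> k z = 0.
  move=> h; rewrite /k !indicE; have [xN|xN] := boolP (z.1 \in _); last by rewrite mul0r mulr0.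
  have [sN|sN] := boolP (z.2 \in _); last by rewrite !mulr0.
  exfalso; apply: h; move: xN sN; rewrite !inE/= !in_itv/= => /andP[x1 x2] /andP[s1 s2].
  by rewrite ler_norml (ltW x1) x2 (ltW s1) s2.
have kC z : `|k z| <= B.
  have [[xN sN]|h] := pselect (`|z.1| <= N /\ N^-1 <= z.2 <= N); last by rewrite kA// normr0.
  rewrite /k normrM -[leRHS]mulr1; apply: ler_pM => //; first exact: DB.
  by rewrite !indicE; do 2 case: (_ \in _); rewrite ?mulr1 ?mulr0 ?normr1 ?normr0.
have kbox z : ~ box N z -> k z = 0.
  case: z => x s /boxP h; apply: kA => -[/= xN /andP[s1 s2]]; apply: h; split => //.
  by rewrite gtr0_norm// (lt_le_trans N0).
have ik := box_integrable mk kC kbox.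
have rect (a b c e : R) :
    \int[mu2]_z (k z * (\1_(`]a, b]%classic) z.1 * \1_(`]c, e]%classic) z.2)) = 0.
  (* The given rectangle meets the slab in another rectangle; if its endpoints come in reversed
     order it is empty and the integral is 0. *)
  pose a' := Num.max (- N) a; pose b' := Num.min N b.
  pose c' := Num.max N^-1 c; pose e' := Num.min N e.
  have E z : k z * (\1_(`]a, b]%classic) z.1 * \1_(`]c, e]%classic) z.2) =
      D z * (\1_(`]a', b']%classic) z.1 * \1_(`]c', e']%classic) z.2).
    by rewrite -!indicator_itv_cap /k; ring.
  under eq_Rintegral do rewrite E.
  have [ab|ba] := leP a' b'; last first.
    rewrite (@eq_Rintegral _ _ _ mu2 _ (cst 0)) ?Rintegral_cst ?mul0r// => z _.
    rewrite indicE memNset ?mul0r ?mulr0//= in_itv/= => /andP[h1 h2].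
    by move: ba; rewrite ltNge => /negP; apply; apply: ltW; exact: lt_le_trans h2.
  have [ce|ec] := leP c' e'; last first.
    rewrite (@eq_Rintegral _ _ _ mu2 _ (cst 0)) ?Rintegral_cst ?mul0r// => z _.
    rewrite [X in _ * X]mulrC indicE memNset ?mul0r ?mulr0//= in_itv/= => /andP[h1 h2].
    by move: ec; rewrite ltNge => /negP; apply; apply: ltW; exact: lt_le_trans h2.
  by apply: difference_rectangle => //; rewrite lt_max N0.
have mo (a b : R) : measurable_fun [set: R] (\1_(`]a, b]%classic) : R -> R) by exact: measurable_indic.
have onorm (a b x : R) : `|\1_(`]a, b]%classic) x : R| <= 1.
  by rewrite indicE; case: (_ \in _); rewrite ?normr1 ?normr0.
apply: ae_prod_eq0 => //.
have : {ae mu, forall x, forall pq : rat * rat, pq.1 <= pq.2 ->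
    \int[mu]_(s in `]ratr pq.1, ratr pq.2]) k (x, s) = 0}.
  apply: ae_forall_countable => -[c e]/=; have [ce|ce] := boolP (c <= e); last exact: aeW.
  pose M x := \int[mu]_(s in `]ratr c, ratr e]) k (x, s).
  pose k1 (z : R * R) := k z * \1_(`]ratr c, ratr e]%classic) z.2.
  have mk1 : measurable_fun [set: R * R] k1.
    by apply: measurable_funM => //; exact: (measurableT_comp (mo _ _) measurable_snd).
  have k1C z : `|k1 z| <= B by rewrite normrM -[leRHS]mulr1; apply: ler_pM.
  have k1box z : ~ box N z -> k1 z = 0 by move=> /kbox; rewrite /k1 => ->; rewrite mul0r.
  have ik1 := box_integrable mk1 k1C k1box.
  have ME x : M x = \int[mu]_s k1 (x, s).
    rewrite /M Rintegral_mkcond; congr Rintegral; apply/funext => s.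
    exact: (patch_indicator (fun s => k (x, s))).
  have mM : measurable_fun [set: R] M.
    rewrite (_ : M = fine \o fubini_F mu (EFin \o k1)).
      by apply: measurableT_comp => //; exact: (measurable_fubini_F ik1).
    by apply/funext => x; rewrite ME.
  have ce' : ratr c <= ratr e :> R by rewrite ler_rat.
  have MC x : `|M x| <= B * (ratr e - ratr c).
    exact: (bounded_integral_norm (measurable_fun_pair2 x mk) (fun s => kC (x, s)) ce').
  have : {ae mu, forall x, M x = 0}.
    apply: (ae_eq0_of_intervals mM MC) => p q pq.
    rewrite -[RHS](rect (ratr p) (ratr q) (ratr c) (ratr e)).
    rewrite (@box_Rintegral12 _ _ N B).
    - rewrite [LHS]Rintegral_mkcond; congr Rintegral; apply/funext => x.
      rewrite (patch_indicator M) ME mulrC -RintegralZl//; last first.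
        exact: (box_xsection_integrable mk1 k1C k1box).
      by congr Rintegral; apply/funext => s; rewrite /k1/= mulrCA.
    - apply: measurable_funM => //; apply: measurable_funM.
        exact: (measurableT_comp (mo _ _) measurable_fst).
      exact: (measurableT_comp (mo _ _) measurable_snd).
    - move=> z; rewrite normrM -[leRHS]mulr1; apply: ler_pM => //.
      by rewrite normrM -[leRHS]mulr1; apply: ler_pM.
    - by move=> z /kbox ->; rewrite mul0r.
  by apply: aeS => x Mx _.
apply: aeS => x Mx; apply: (ae_eq0_of_intervals (measurable_fun_pair2 x mk) (fun s => kC (x, s))).
by move=> p q pq; exact: (Mx (p, q) pq).
Qed.

Lemma equal_flux_unique : {ae mu2, forall z : R * R, 0 < z.2 -> l1 z.1 z.2 = l2 z.1 z.2}.
Proof.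
have /ae_foralln := difference_slab_eq0.
apply: aeS => -[x s] h /= s0.
(* This n exceeds [|x|], s and the inverse of s, which puts (x, s) into the slab. *)
pose n := Num.bound (`|x| + `|s| + s^-1).
have := h n; have := archi_boundP (_ : 0 <= `|x| + `|s| + s^-1).
have si : 0 < s^-1 by rewrite invr_gt0.
move=> /(_ ltac:(by rewrite !addr_ge0// ltW)); rewrite -/n => nb.
have nx := normr_ge0 x; have ns := normr_ge0 s.
have n1 : (n%:R : R) <= n.+1%:R by rewrite ler_nat.
have xn : `|x| < n.+1%:R by lra.
have sn : s < n.+1%:R by have := ler_norm s; lra.
have sin : n.+1%:R^-1 < s.
  by rewrite -[ltRHS]invrK ltf_pV2 ?posrE//; lra.
rewrite !indicE !mem_set/=.
- rewrite !mulr1 /half_plane_extension/= s0 => /eqP; rewrite subr_eq0 => /eqP; exact.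
- by rewrite in_itv/= sin ltW.
- by rewrite in_itv/=; move: xn; rewrite ltr_norml => /andP[-> /ltW].
Qed.

End equal_currents.

(** * Heights of the particle system *)

Section finite_points.
Context {R : realType}.
Implicit Types (A : set R) (a b s t : R).

Lemma finite_set_maximum A : finite_set A -> A !=set0 ->
  exists2 s, A s & forall y, A y -> y <= s.
Proof.
move=> /finite_seqP[X ->]; elim: X => [[x]|x X IH _] //=.
have [[y yX]|/nonemptyPn X0] := pselect ([set` X] !=set0); last first.
  exists x; first by rewrite /= inE eqxx.
  move=> y; rewrite /= inE => /orP[/eqP->//|yX].
  by have : [set` X] y by []; rewrite X0.
have [|m mX mP] := IH; first by exists y.
exists (Num.max x m).
  by rewrite /= inE; case: leP => _; [rewrite orbC mX|rewrite eqxx].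
move=> z; rewrite /= inE => /orP[/eqP->|zX]; first by rewrite le_max lexx.
by rewrite le_max mP ?orbT.
Qed.

Lemma count_points_eq0 A b : finite_set (A `&` `]0, b]) ->
  count_points A `]0, b] = 0%N -> A `&` `]0, b] = set0.
Proof.
move=> fA /eqP; rewrite /count_points cardfs_eq0 => /eqP h.
by rewrite -(fset_setK fA) h; apply/seteqP; split.
Qed.

Lemma count_points_mono A a b : (forall b, finite_set (A `&` `]0, b])) -> a <= b ->
  (count_points A `]0%R, a] <= count_points A `]0%R, b])%N.
Proof.
move=> fA ab; apply: fsubset_leq_card; rewrite -fset_set_sub//.
move=> x [Ax]; rewrite /= !in_itv/= => /andP[-> xa]; split => //.
exact: le_trans ab.
Qed.

Lemma count_points_lt A a s b : (forall b, finite_set (A `&` `]0, b])) ->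
  a < s -> s <= b -> 0 < s -> A s ->
  (count_points A `]0%R, a] < count_points A `]0%R, b])%N.
Proof.
move=> fA as_ sb s0 As; apply: fproper_ltn_card; rewrite fproperE; apply/andP; split.
  rewrite -fset_set_sub// => x [Ax]; rewrite /= !in_itv/= => /andP[-> xa]; split => //.
  by rewrite (le_trans xa)// (le_trans (ltW as_)).
apply/fsubsetPn; exists s; first by rewrite in_fset_set// inE; split => //=; rewrite in_itv/= s0.
rewrite in_fset_set// notin_setE /= in_itv/= => -[_ /andP[_]]; by rewrite leNgt as_.
Qed.

End finite_points.

(** * Heights of one realization *)

Section heights.
Context {R : realType} (K : option nat) (D : int -> set R) (h : int -> R -> \bar R).
Hypothesis D_fin : forall i b, finite_set (D i `&` `]0, b]).
Hypothesis hP : K_exclusion_height K D h.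

Lemma height_before_points i t : 0 <= t -> D i `&` `]0, t] = set0 -> h i t = initial_height R K i.
Proof. by move=> t0 D0; rewrite (height_const hP (lexx 0) t0 D0) (height_init hP). Qed.

Lemma height_last_jump i t : 0 <= t -> D i `&` `]0, t] !=set0 ->
  exists2 s, 0 < s <= t & D i s /\ h i t = h i s.
Proof.
move=> t0 Dt; have [s [Ds]] := finite_set_maximum (D_fin i t) Dt.
rewrite /= in_itv/= => /andP[s0 st] smax; exists s; first by rewrite s0.
split => //; apply: (height_const hP (ltW s0) st).
apply/seteqP; split => // r [Dr]; rewrite /= in_itv/= => /andP[sr rt].
have : r <= s by apply: smax; split => //=; rewrite in_itv/= rt (lt_trans s0).
by rewrite leNgt sr.
Qed.

(** [height_jump] speaks of all times close to s from the left; extracting a single positive one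
    prepares the inductions on the number of epochs. *)
Lemma height_jump_left i s : 0 < s -> D i s ->
  exists2 r, 0 < r < s & h i s = height_update K (fun j => h j r) i.
Proof.
move=> s0 Ds; have := height_jump hP Ds => H.
have : \forall r \near s^'-, 0 < r < s /\ h i s = height_update K (fun j => h j r) i.
  near=> r; split; last by near: r.
  by apply/andP; split; near: r; [exact: nbhs_left_gt|exact: nbhs_left_lt].
by move=> /filter_ex[r [h1 h2]]; exists r.
Unshelve. all: by end_near. Qed.

Lemma height0_le_count t : 0 <= t ->
  (h 0 t <= (count_points (D 0) `]0%R, t])%:R%:E)%E.
Proof.
have [n] := ubnP (count_points (D 0) `]0, t]); elim: n t => // n IH t cn t0.
have [Dt|/nonemptyPn D0] := pselect (D 0 `&` `]0, t] !=set0); last first.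
  by rewrite height_before_points// /initial_height lexx lee_fin.
have [s /andP[s0 st] [Ds ->]] := height_last_jump t0 Dt.
have [r /andP[r0 rs] ->] := height_jump_left s0 Ds.
(* The epoch s lies in ]0, t] but not in ]0, r], so the count drops. *)
have rt := count_points_lt (D_fin 0) rs st s0 Ds.
apply: (@le_trans _ _ (h 0 r + 1)%E).
  by rewrite /height_update; case: (K) => [k|]; rewrite !ge_min lexx.
apply: (@le_trans _ _ ((count_points (D 0) `]0%R, r])%:R%:E + 1)%E).
  by rewrite leeD2r// IH ?(ltW r0)//; apply: leq_trans rt _.
by rewrite -EFinD lee_fin natr1 ler_nat.
Qed.

Lemma initial_height_ge0 i : (0 <= initial_height R K i)%E.
Proof.
rewrite /initial_height; case: ifPn => // i0; rewrite mule_ge0 ?capacity_ge0//.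
by rewrite lee_fin ler0z oppr_ge0 ltW// ltNge.
Qed.

Lemma initial_height_left i : (initial_height R K i <= initial_height R K (i - 1)%R)%E.
Proof.
rewrite [leLHS]/initial_height; case: ifPn => [_|i0]; first exact: initial_height_ge0.
rewrite /initial_height ifF; last by apply/negbTE; move: i0; rewrite -!ltNge; lia.
by rewrite lee_wpmul2l ?capacity_ge0// lee_fin ler_int; lia.
Qed.

Lemma initial_height_right k i : K = Some k ->
  (initial_height R K i <= initial_height R K (i + 1)%R + (k%:R)%:E)%E.
Proof.
move=> Kk; rewrite /initial_height Kk/=; case: ifPn => i0.
  by rewrite ifT ?add0e ?lee_fin//; lia.
case: ifPn => i1.
  by rewrite (_ : i = -1); [rewrite opprK mulr1z add0e -EFinM mulr1|lia].
rewrite -!EFinM -EFinD lee_fin.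
have -> : - i = - (i + 1) + 1 by lia.
by rewrite intrD mulrDr mulr1.
Qed.

(** The initial profile itself satisfies the constraints of the exclusion rule, being nonincreasing
    in i with steps of at most K, so every term of the minimum stays above it. *)
Lemma height_update_ge_initial (k : int -> \bar R) i :
  (initial_height R K (i - 1)%R <= k (i - 1)%R)%E -> (initial_height R K i <= k i)%E ->
  (initial_height R K (i + 1)%R <= k (i + 1)%R)%E ->
  (initial_height R K i <= height_update K k i)%E.
Proof.
move=> kl ki kr; have kl' : (initial_height R K i <= Order.min (k i + 1) (k (i - 1)%R))%E.
  rewrite le_min (le_trans (initial_height_left i) kl) andbT.
  by apply: le_trans ki _; rewrite leeDl// lee_fin.
rewrite /height_update; case Kk: {2}K => [c|] //.
by rewrite le_min kl' (le_trans (initial_height_right i Kk))// leeD2r.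
Qed.

(* A site without epochs up to time T keeps its initial height up to T, hence
   shields the sites on either side of it from each other. *)
Lemma height_ge_initial (a b : int) (T t : R) i : a <= i <= b -> 0 <= t <= T ->
  D a `&` `]0, T] = set0 -> D b `&` `]0, T] = set0 ->
  (initial_height R K i <= h i t)%E.
Proof.
move=> aib tT Da Db; pose N := `|b - a|%N.
(* Induction on the number of epochs in the block up to t. A site with an epoch is not an end of the
   block, so both of its neighbours still belong to the block. *)
pose C t := (\sum_(m < N.+1) count_points (D (a + m%:Z)%R) `]0%R, t])%N.
have [n] := ubnP (C t); elim: n t i aib tT => // n IH t i aib tT Cn.
have /andP[t0 tT'] := tT; have /andP[ai ib] := aib.
have [Dt|/nonemptyPn D0] := pselect (D i `&` `]0, t] !=set0); last first.
  by rewrite height_before_points.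
have [s /andP[s0 st] [Ds ->]] := height_last_jump t0 Dt.
have [r /andP[r0 rs] ->] := height_jump_left s0 Ds.
have sT : D i `&` `]0, T] !=set0.
  by exists s; split => //=; rewrite in_itv/= s0 (le_trans st).
have ia : i <> a by move=> ia; move: sT; rewrite ia Da => -[].
have ib' : i <> b by move=> ie; move: sT; rewrite ie Db => -[].
have rt : r <= t by rewrite (le_trans (ltW rs)).
have Cr : (C r < C t)%N.
  have mi : (`|i - a| < N.+1)%N by rewrite /N; lia.
  rewrite /C (bigD1 (Ordinal mi))//= [ltnRHS](bigD1 (Ordinal mi))//= -addSn.
  have -> : a + `|i - a|%N%:Z = i by lia.
  apply: leq_add; first exact: count_points_lt (D_fin i) rs st s0 Ds.
  by apply: leq_sum => m _; apply: count_points_mono.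
have rT : 0 <= r <= T by rewrite (ltW r0) (le_trans rt).
have Crn : (C r < n)%N := leq_trans Cr Cn.
have l1 : a <= i - 1 <= b by clear -ai ib ia; lia.
have l2 : a <= i + 1 <= b by clear -ai ib ib'; lia.
by apply: height_update_ge_initial; exact: IH.
Qed.

End heights.

(** * Tail of the Poisson distribution *)

Section poisson_tail.
Context {R : realType}.
Implicit Types (x : R).

Local Notation p x k := (exp_coeff x k * expR (- x)).

Lemma poisson_pmfE x k : 0 < x -> poisson_pmf x k = p x k.
Proof. by move=> x0; rewrite /poisson_pmf x0 exp_coeffE (mulrC (x ^+ k)). Qed.

Lemma exp_coeff_mul x k : k.+1%:R * exp_coeff x k.+1 = x * exp_coeff x k.
Proof.
rewrite !exp_coeffE /= exprS factS natrM; field.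
by rewrite !pnatr_eq0 -lt0n fact_gt0/=.
Qed.

Lemma poisson_sum_cvg x : (\sum_(k < n) p x k : R) @[n --> \oo] --> (1 : R).
Proof.
rewrite (_ : (fun n => _) = (fun n => series (exp_coeff x) n * expR (- x))).
  rewrite -(expRxMexpNx_1 x); apply: cvgM; last exact: cvg_cst.
  exact: is_cvg_series_exp_coeff.
by apply/funext => n; rewrite /series/= mulr_suml big_mkord.
Qed.

Lemma poisson_sum_le1 x n : 0 <= x -> \sum_(k < n) p x k <= 1.
Proof.
move=> x0; rewrite -(cvg_lim (@Rhausdorff R) (@poisson_sum_cvg x)).
apply: (@nondecreasing_cvgn_le R (fun n => \sum_(k < n) p x k)); last exact: cvgP (@poisson_sum_cvg x).
apply/nondecreasing_seqP => m; rewrite big_ord_recr/= lerDl mulr_ge0 ?expR_ge0//.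
exact: exp_coeff_ge0.
Qed.

(* Markov's inequality, from k p_k = x p_(k-1). *)
Lemma poisson_sum_ge x m : 0 <= x -> m.+1%:R * (1 - \sum_(k < m.+1) p x k) <= x.
Proof.
move=> x0; pose S n := \sum_(k < n) p x k.
have p0 k : 0 <= p x k by rewrite mulr_ge0 ?expR_ge0// exp_coeff_ge0.
have S1 n : S n.+1 = S n + p x n by rewrite /S big_ord_recr.
(* In terms of the weights p_k this says [(m + 1) * (p_(m+1) + ... + p_(m+j)) <= x * (p_m + ... +
   p_(m+j-1))], rearranged into partial sums. *)
have H j : m.+1%:R * S (m.+1 + j)%N + x * S m <= m.+1%:R * S m.+1 + x * S (m + j)%N.
  elim: j => [|j IH]; first by rewrite !addn0.
  rewrite !addnS (S1 (m.+1 + j)%N) (S1 (m + j)%N) !mulrDr.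
  have : m.+1%:R * p x (m.+1 + j)%N <= x * p x (m + j)%N.
    rewrite [leRHS]mulrA -exp_coeff_mul -mulrA addSn ler_wpM2r// ler_nat.
    by rewrite ltnS leq_addr.
  by move: IH; rewrite (S1 (m + j)%N) !mulrDr; lra.
have H' j : m.+1%:R * S (m.+1 + j)%N <= m.+1%:R * S m.+1 + x.
  have := H j; have : 0 <= x * S m by rewrite mulr_ge0// sumr_ge0.
  have : x * S (m + j)%N <= x * 1 by rewrite ler_wpM2l// poisson_sum_le1.
  by lra.
rewrite mulrBr mulr1 lerBlDl -[leLHS]mulr1.
have cv : m.+1%:R * S (m.+1 + j)%N @[j --> \oo] --> (m.+1%:R * 1 : R).
  apply: cvgM; first exact: cvg_cst.
  by have := @poisson_sum_cvg x; rewrite -(cvg_shiftn m.+1); under eq_fun do rewrite addnC.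
rewrite -(cvg_lim (@Rhausdorff R) cv); apply: limr_le; first exact: cvgP cv.
exact: nearW.
Qed.

End poisson_tail.

(** * From the particle system to the limit shape *)

Section random_heights.
Context {R : realType} (d : measure_display) (T : measurableType d) (P : probability T R).
Variables (K : option nat) (D : int -> T -> set R) (xi : T -> int -> R -> \bar R).
Variable g : R -> \bar R.
Hypothesis D_poisson : forall i, poisson_process P 1 (D i).
Hypothesis D_independent : independent_processes P D.
Hypothesis xi_height : {ae P, forall w, K_exclusion_height K (fun i => D i w) (xi w)}.
Hypothesis g_shape : limit_shape P K xi g.

Lemma ae_meets (Q : T -> Prop) (A : set T) : measurable A -> (0 < P A)%E ->
  {ae P, forall w, Q w} -> exists w, A w /\ Q w.
Proof.
move=> mA A0 [N [mN N0 QN]]; apply: contrapT => h.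
have : (P A <= P N)%E.
  apply: le_measure; rewrite ?inE// => w Aw; apply: QN => /= Qw.
  by apply: h; exists w.
by rewrite N0 leNgt A0.
Qed.

Let F (t : R) i := ~` [set w | count_points (D i w) `]0, t] = 0%N].

Lemma prode_const (I : Type) (s : seq I) (c : R) :
  (\prod_(i <- s) c%:E = (c ^+ size s)%:E)%E.
Proof.
elim: s => [|i s IH]; first by rewrite big_nil expr0.
by rewrite big_cons IH -EFinM exprS.
Qed.

Lemma busy_probability t i : 0 < t -> P (F t i) = (1 - expR (- t))%:E.
Proof.
move=> t0; rewrite /F probability_setC; last exact: poisson_measurable (D_poisson i) _ _ _.
rewrite (poisson_law (D_poisson i))// mul1r subr0 poisson_pmfE//.
by rewrite exp_coeffE/= expr0 fact0 invr1 !mul1r.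
Qed.

Lemma measurable_busy t i : measurable (F t i).
Proof. by apply: measurableC; exact: poisson_measurable (D_poisson i) _ _ _. Qed.

(** By independence, n distinct sites all have epochs in ]0, t] with probability [c ^+ n], where c <
    1; injectivity of [phi] supplies the distinct sites. *)
Lemma quiet_site (phi : nat -> int) t : injective phi -> 0 < t ->
  {ae P, forall w, exists m, D (phi m) w `&` `]0, t] = set0}.
Proof.
move=> phi_inj t0; pose N := \bigcap_m F t (phi m).
have mN : measurable N by apply: bigcapT_measurable => m; exact: measurable_busy.
exists N; split => //; last first.
  move=> w /= h m _ /= c0; apply: h; exists m.
  by apply: count_points_eq0 => //; exact: poisson_locally_finite (D_poisson _) _ _.
pose c : R := 1 - expR (- t).
have c1 : c < 1 by rewrite /c ltrBlDr ltrDl expR_gt0.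
have c0 : 0 <= c by rewrite subr_ge0 expR_le1 oppr_le0 ltW.
have Nc n : (P N <= (c ^+ n)%:E)%E.
  pose J := seq_fset tt (map phi (iota 0 n)).
  have Jn : size J = n.
    rewrite /J size_seq_fset undup_id ?size_map ?size_iota//.
    by rewrite map_inj_uniq ?iota_uniq.
  rewrite -Jn -prode_const.
  have -> : (\prod_(i <- J) c%:E = \prod_(i <- J) P (F t i))%E.
    by apply: eq_bigr => i _; rewrite busy_probability.
  rewrite -(D_independent (E := F t)); last first.
    move=> i _; rewrite /F -setTD; apply: sigma_algebraCD.
    by apply: sub_sigma_algebra; exists 0, t, 0%N.
  apply: le_measure; rewrite ?inE//.
    by apply: fin_bigcap_measurable => // i _; exact: measurable_busy.
  by move=> w Nw i /=; rewrite seq_fsetE => /mapP[m _ ->]; exact: Nw.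
have Pfin : P N \is a fin_num by rewrite fin_num_measure.
have P0 : fine (P N) <= 0.
  have cv : c ^+ n @[n --> \oo] --> (0 : R) by apply: cvg_expr; rewrite ger0_norm.
  rewrite -(cvg_lim (@Rhausdorff R) cv); apply: limr_ge; first exact: cvgP cv.
  by apply: nearW => n; rewrite -lee_fin fineK.
by apply/eqP; rewrite -measure_le0; move: P0; rewrite -lee_fin fineK.
Qed.

Lemma initial_height_lower (r : R) (j : int) : (r%:E <= capacity R K)%E -> j < 0 ->
  ((r * (- j)%:~R)%:E <= initial_height R K j)%E.
Proof.
move=> rK j0; rewrite /initial_height ifF ?EFinM; last by apply/negbTE; rewrite -ltNge.
by rewrite lee_wpmul2r// lee_fin ler0z oppr_ge0 ltW.
Qed.

(** Since [g] is deterministic, a single outcome in the almost sure events suffices. At that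
    outcome, for every n >= 1, quiet sites on both sides of [i n] keep its height above the initial
    one, which is at least [- r * i n]. *)
Lemma shape_lower (q r : R) : q <= 0 -> 0 <= r -> (r%:E <= capacity R K)%E ->
  (0 <= g q + (r * q)%:E)%E.
Proof.
move=> q0 r0 rK; have gq0 := shape_ge0 g_shape q.
suff : ((- (r * q))%:E <= g q)%E.
  case: (g q) gq0 => [s| |]// _.
  by rewrite -EFinD !lee_fin -subr_ge0 opprK.
move: q0; rewrite le_eqVlt => /predU1P[->|q0]; first by rewrite mulr0 oppr0 (shape_ge0 g_shape).
pose i n := Num.floor (n%:R * q); pose t n : R := n.+1%:R * 1.
have t0 n : 0 < t n by rewrite /t mulr1.
have L : {ae P, forall w, forall n, exists m, D (i n.+1 - m%:Z)%R w `&` `]0, t n] = set0}.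
  by apply/ae_foralln => n; apply: (@quiet_site (fun m => i n.+1 - m%:Z)) => // m m'; lia.
have Rt : {ae P, forall w, forall n, exists m, D (i n.+1 + m%:Z)%R w `&` `]0, t n] = set0}.
  by apply/ae_foralln => n; apply: (@quiet_site (fun m => i n.+1 + m%:Z)) => // m m'; lia.
have P1 : (0 < P setT)%E by rewrite probability_setT lte01.
have S := shape_limit g_shape q ltr01.
have [w [_ [[Lw Rw] [xiw Sw]]]] := ae_meets measurableT P1
  (filterI (filterI L Rt) (filterI xi_height S)).
rewrite divr1 mul1e in Sw; rewrite -(cvg_lim (@ereal_hausdorff R) Sw).
apply: lime_ge; first exact: cvgP Sw.
(* The index 0 is left out: its scaling factor is 0, and the bound may fail there. *)
exists 1%N => // -[//|n] _ /=.
have [m Lm] := Lw n; have [m' Rm] := Rw n.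
have in0 : i n.+1 < 0 by rewrite /i floor_lt0// pmulr_rlt0.
have := @height_ge_initial R K (fun i => D i w) (xi w)
  (fun i b => poisson_locally_finite (D_poisson i) w b) xiw _ _ (t n) (t n) (i n.+1) _ _ Lm Rm.
have h1 : i n.+1 - m%:Z <= i n.+1 <= i n.+1 + m'%:Z by clear; lia.
have h2 : 0 <= t n <= t n by rewrite lexx ltW.
move=> /(_ h1 h2) /(le_trans (initial_height_lower rK in0)) h.
have n1 : (0 <= (n.+1%:R^-1 : R)%:E)%E by rewrite lee_fin invr_ge0.
apply: le_trans (lee_wpmul2l n1 h); rewrite -EFinM lee_fin.
(* Rounding down acts in the right direction: a smaller index has a larger initial height. *)
have fl : (i n.+1)%:~R <= n.+1%:R * q by exact: floor_le.
rewrite ler_pdivlMl// mulrN mulrCA -mulrN ler_wpM2l// mulrNz lerN2//.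
Qed.

(** The mean of the count is n + 1, so by Markov's inequality it reaches [2 * (n + 1)] with
    probability at most one half. *)
Lemma poisson_count_half (n : nat) :
  let A := [set w | (count_points (D 0 w) `]0%R, n.+1%:R] < n.+1.*2)%N] in
  measurable A /\ (2^-1%:E <= P A)%E.
Proof.
move=> A; pose B k := [set w | count_points (D 0 w) `]0%R, n.+1%:R] = k].
have mB k : measurable (B k) by exact: poisson_measurable (D_poisson 0) _ _ _.
have AB : A = \big[setU/set0]_(k < n.+1.*2) B k.
  apply/seteqP; split => w.
    move=> Aw; rewrite -(bigcup_mkord _ B); by exists (count_points (D 0 w) `]0, n.+1%:R]).
  by rewrite -(bigcup_mkord _ B) => -[k /= kn Bk]; rewrite /A/= Bk.
have mA : measurable A by rewrite AB; exact: bigsetU_measurable.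
split => //; rewrite AB measure_bigsetU_ord//; last first.
  by apply/trivIsetP => j k _ _ jk; apply/seteqP; split => // w [/= Bj Bk]; move: jk; rewrite -(inj_eq val_inj)/= -Bj -Bk eqxx.
have n0 : 0 < n.+1%:R :> R by [].
have E (k : nat) : P (B k) = (exp_coeff n.+1%:R k * expR (- n.+1%:R))%:E.
  by rewrite (poisson_law (D_poisson 0))// mul1r subr0 poisson_pmfE.
rewrite (eq_bigr (fun k : 'I_(n.+1.*2) =>
  (exp_coeff n.+1%:R k * expR (- n.+1%:R))%:E)); last by move=> k _; exact: E.
rewrite sumEFin lee_fin.
have := @poisson_sum_ge R n.+1%:R (n.*2.+1) (ltW n0).
rewrite -doubleS; set S := \sum_(k < _) _.
have -> : (n.+1.*2)%:R = 2 * n.+1%:R :> R by rewrite -muln2 natrM mulrC.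
move: n0; move: (n.+1%:R : R) => x x0 h.
have : 2 * (1 - S) <= 1 by rewrite -(ler_pM2r x0) mul1r mulrAC.
by lra.
Qed.

Lemma shape_at0 : (g 0 < +oo)%E.
Proof.
rewrite ltNge; apply/negP; rewrite leye_eq => /eqP g0.
pose A n := [set w | (count_points (D 0 w) `]0%R, n.+1%:R] < n.+1.*2)%N].
have mA n : measurable (A n) := (poisson_count_half n).1.
have mL : measurable (lim_sup_set A).
  by apply: bigcapT_measurable => n; apply: bigcup_measurable.
have PL : (0 < P (lim_sup_set A))%E.
  apply: (@lt_le_trans _ _ 2^-1%:E); first by rewrite lte_fin invr_gt0.
  have mU : measurable (\bigcup_(k >= 0) A k) by exact: bigcup_measurable.
  (* Continuity from above, along the decreasing unions of the tails, passes the lower bound one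
     half on to the limit superior. *)
  have cv := lim_sup_set_cvg P A mA (le_lt_trans (probability_le1 P mU) (ltry 1)).
  rewrite -(cvg_lim (@ereal_hausdorff R) cv); apply: lime_ge; first exact: cvgP cv.
  apply: nearW => n; apply: le_trans (poisson_count_half n).2 _.
  apply: le_measure; rewrite ?inE; [exact: mA|exact: bigcup_measurable|].
  by move=> w Aw; exists n => //=.
have S := shape_limit g_shape 0 ltr01.
have [w [Lw [xiw Sw]]] := ae_meets mL PL (filterI xi_height S).
rewrite divr1 mul1e g0 in Sw.
(* Any level above 2 would do: on the event [A m] the scaled height at site 0 is at most 2. *)
have /cvgeyPge/(_ 3)[n _ nP] := Sw.
have [m /= nm Am] := Lw n I.
have := nP m.+1 (leqW nm); rewrite /= mulr0 floor0 mulr1.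
apply/negP; rewrite -ltNge.
have x0 : 0 < m.+1%:R :> R by [].
have := @height0_le_count R K (fun i => D i w) (xi w)
  (fun i b => poisson_locally_finite (D_poisson i) w b) xiw m.+1%:R (ltW x0).
have c2 : (count_points (D 0 w) `]0%R, m.+1%:R])%:R <= 2 * m.+1%:R :> R.
  by rewrite -natrM ler_nat mul2n ltnW.
have x1 : (0 <= (m.+1%:R^-1 : R)%:E)%E by rewrite lee_fin invr_ge0.
move=> /(lee_wpmul2l x1) /le_lt_trans; apply; rewrite -EFinM lte_fin.
by rewrite ltr_pdivrMl//; apply: le_lt_trans c2 _; rewrite mulrC ltr_pM2l// ltr_nat.
Qed.

Lemma limit_shape_bounds : shape_bounds K g.
Proof.
split; first exact: (shape_ge0 g_shape).
- exact: (shape_noninc g_shape).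
- exact: (shape_convex g_shape).
- exact: shape_at0.
- exact: shape_lower.
Qed.

End random_heights.

(** One real [L] serves as the Lipschitz constant of all heights and as an admissible density in
    [sb_lower]: K itself if finite, otherwise the positive part of a bound of [rho0]. *)
Lemma real_density_bound (R : realType) (K : option nat) (rho0 : R -> R) :
  (exists M, forall x, rho0 x <= M) ->
  (forall x, 0 <= rho0 x /\ ((rho0 x)%:E <= capacity R K)%E) ->
  exists L : R, [/\ 0 <= L, (L%:E <= capacity R K)%E & forall x, 0 <= rho0 x <= L].
Proof.
move=> [M rho0M]; case: K => [k|] rho0K.
  exists k%:R; split => // x; have [-> +] := rho0K x.
  by rewrite /= lee_fin.
exists (Num.max M 0); split; first by rewrite le_max lexx orbT.
  exact: leey.
by move=> x; have [-> _] := rho0K x; rewrite le_max rho0M.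
Qed.

Theorem theorem2 (R : realType) (d : measure_display) (T : measurableType d)
    (P : probability T R) (K : option nat) (D : int -> T -> set R)
    (xi : T -> int -> R -> \bar R) (g : R -> \bar R) (rho0 u0 : R -> R)
    (K_pos : K <> Some 0%N)
    (D_poisson : forall i, poisson_process P 1 (D i))
    (D_independent : independent_processes P D)
    (xi_height : {ae P, forall w, K_exclusion_height K (fun i => D i w) (xi w)})
    (g_shape : limit_shape P K xi g)
    (rho0_measurable : measurable_fun [set: R] rho0)
    (rho0_bounded : exists M, forall x : R, rho0 x <= M)
    (rho0_range : forall x, 0 <= rho0 x /\ ((rho0 x)%:E <= capacity R K)%E)
    (u0_0 : u0 0 = 0)
    (u0_increment : forall a b : R, a < b ->
      (u0 b - u0 a)%:E = (\int[lebesgue_measure]_(x in `[a, b]) (rho0 x)%:E)%E) :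
  let f := flux g in
  let rho := hopf_lax_density g u0 in
  weak_solution K f rho0 rho /\
  forall lambda, weak_solution K f rho0 lambda ->
    (forall t : R, 0 < t ->
      {ae lebesgue_measure, forall x : R,
        (\int[lebesgue_measure]_(s in `]0%R, t]) (f (lambda x s))%:E <=
         \int[lebesgue_measure]_(s in `]0%R, t]) (f (rho x s))%:E)%E}) /\
    ({ae (lebesgue_measure \x lebesgue_measure)%E, forall z : R * R, 0 < z.2 ->
        (\int[lebesgue_measure]_(s in `]0%R, z.2]) (f (lambda z.1 s))%:E =
         \int[lebesgue_measure]_(s in `]0%R, z.2]) (f (rho z.1 s))%:E)%E} ->
     {ae (lebesgue_measure \x lebesgue_measure)%E, forall z : R * R, 0 < z.2 ->
        lambda z.1 z.2 = rho z.1 z.2}).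
Proof.
move=> f rho; have gP := limit_shape_bounds D_poisson D_independent xi_height g_shape.
have [L [L0 LK rho0L]] := real_density_bound rho0_bounded rho0_range.
have wrho := density_is_weak_solution gP L0 LK rho0_measurable rho0L u0_increment.
split => // lambda wl; split => [t t0|eqc].
  exact: (current_maximal gP L0 LK rho0_measurable rho0L u0_increment wl t0).
exact: (equal_flux_unique gP wl wrho (equal_currents_flux gP wl wrho eqc)).
Qed.
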